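(* Let $h$ be a positive even integer and let $f \in M(2,h)$ have Fourier expansion at infinity $f(z) = \sum_{n\ge0} A_n q^n$ with $A_0 \neq 0$. Then $A_n \neq 0$ for some $n$ with $1 \le n \le r(2,h) = \lfloor h/4 \rfloor + 1$.
   Context: $\mathfrak{H}$ is the complex upper half plane, $z \in \mathfrak{H}$, $q = e^{2\pi i z}$. $\Gamma_0(2) = \{\begin{pmatrix} a&b\\c&d\end{pmatrix} \in SL(2,\mathbb{Z}) : c \equiv 0 \pmod 2\}$. $M(2,h)$ denotes the complex vector space of entire (holomorphic on $\mathfrak{H}$ and at the cusps) modular forms of weight $h$ for $\Gamma_0(2)$ with trivial character, and $r(2,h)$ its dimension, which equals $\lfloor h/4\rfloor+1$ for positive even $h$. *)

(* Defs.v *)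
From Stdlib Require Import Reals ZArith.
From Coquelicot Require Import Coquelicot.
Open Scope C_scope.

Definition cexp (z : C) : C :=
  (exp (Re z) * cos (Im z), exp (Re z) * sin (Im z))%R.

Definition qpar (z : C) : C := cexp (2 * PI * Ci * z).

Definition in_H (z : C) : Prop := (0 < Im z)%R.

Definition mobius (a b c d : Z) (z : C) : C :=
  (RtoC (IZR a) * z + RtoC (IZR b)) / (RtoC (IZR c) * z + RtoC (IZR d)).

Definition jfac (c d : Z) (h : nat) (z : C) : C :=
  Cpow (RtoC (IZR c) * z + RtoC (IZR d)) h.

Definition in_SL2Z (a b c d : Z) : Prop := (a * d - b * c = 1)%Z.

Definition in_Gamma0_2 (a b c d : Z) : Prop :=
  in_SL2Z a b c d /\ (2 | c)%Z.

Definition holomorphic_on_H (f : C -> C) : Prop :=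
  forall z, in_H z -> ex_derive (K := C_AbsRing) (V := C_NormedModule) f z.

Definition modular_Gamma0_2 (h : nat) (f : C -> C) : Prop :=
  forall a b c d z, in_Gamma0_2 a b c d -> in_H z ->
    f (mobius a b c d z) = jfac c d h z * f z.

(* holomorphic at all cusps: for every gamma in SL2(Z), (f|_h gamma)(z)
   = (cz+d)^{-h} f(gamma z) stays bounded as Im z -> +infinity *)
Definition holomorphic_at_cusps (h : nat) (f : C -> C) : Prop :=
  forall a b c d, in_SL2Z a b c d ->
    exists M Y : R, forall z, (Y < Im z)%R ->
      (Cmod (f (mobius a b c d z) / jfac c d h z) <= M)%R.

Definition is_modform_Gamma0_2 (h : nat) (f : C -> C) : Prop :=
  holomorphic_on_H f /\ modular_Gamma0_2 h f /\ holomorphic_at_cusps h f.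

Definition fourier_expansion (f : C -> C) (A : nat -> C) : Prop :=
  forall z, in_H z ->
    is_series (K := C_AbsRing) (V := C_NormedModule)
      (fun n => A n * Cpow (qpar z) n) (f z).

Definition r2 (h : nat) : nat := (h / 4 + 1)%nat.

(* Main.v *)
(* Put q = e^{2 pi i z}, D = q d/dq, and let C = eta(2z)^16 / eta(z)^8 = q + ..., a weight 4 form without zeros
   on the upper half plane or at the cusp 0. Following Siegel, if f = A_0 + O(q^{r+1}) with r = floor(h/4) + 1, one
   exhibits a weight 2 - h form T = t_0 + ... with a pole of order at most r at infinity, vanishing at the cusp 0:
   the residue theorem applied to f T dz then says A_0 t_0 = 0, while t_0 <> 0 for reasons of sign.
   With L = D C / C = 1 - 8 M, M = sum_n mu_n q^n and mu_n = sum_{d | n} (-1)^d d, the form B = L^2 - 4 D L has weight 4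
   and vanishes at the cusp 0; one takes T = B C^{-r} if h = 4m+2 and T = C^{-r} (B L - D B) if h = 4m.
   As (-1)^n mu_n >= 0, the coefficients of B and of C^{-r} (the solution of D Y = -r L Y) alternate in sign, hence
   t_0 <> 0; if h = 4m, integrating by parts gives t_0 = (1/r - 1) times the constant term of C^{-r} D B.

   The transformation of L under w -> -1/w comes from the conditionally convergent double sum
   pi^2 L(z) = sum_m sum_n 1/(m z + n + 1/2)^2, compared with the absolutely convergent sum of 1/x^2 - 1/(x^2 - 1/4).
   No Cauchy theory is needed: f T is a q-series, so it has an explicit primitive G on the whole half plane.
   G(-1/(w+2)) - G(-1/w) is constant, tends to 0 as Im w -> oo, and at w = -1+i it is minus the constant term of f T. *)
Require Import Defs.
From Stdlib Require Import Reals ZArith Lra Lia Classical.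
From Coquelicot Require Import Coquelicot.
Open Scope C_scope.

(** * Absolutely convergent complex series *)

(** The periods of the invariant form f T dz explain the choice of -1+i. Translation by 1 has the
    constant term of f T as its period. The parabolic map z -> z/(1-2z), which fixes the cusp 0, has
    period 0 because T vanishes there. The product of the two is elliptic of order 2 and fixes
    (1+i)/2 = -1/(-1+i), so its period is 0 as well, and the constant term must vanish. The obstacle
    is t_0 <> 0. The sign pattern is visible on L and its derivatives, but L is only quasi-modular:
    w -> -1/w adds a term 4w/(2 pi i), where 4 is the weight of C. In L^2 - 4 D L, and again in B L
    - D B, these extra terms cancel. In B L - D B the signs no longer agree term by term; since L
    C^{-r} = -(1/r) D(C^{-r}), integration by parts turns both halves into multiples of the same
    sum. The factor 1/r - 1 that remains is nonzero because h > 0 forces r >= 2 when h = 4m. *)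

Lemma Cmod_le_abs (z : C) : (Cmod z <= Rabs (Re z) + Rabs (Im z))%R.
Proof.
  destruct z as [x y]; simpl.
  replace (x, y) with (RtoC x + Ci * RtoC y) by (unfold RtoC, Ci; apply injective_projections; simpl; ring).
  eapply Rle_trans; [apply Cmod_triangle|].
  rewrite Cmod_mult, Cmod_Ci, !Cmod_R; lra.
Qed.

Lemma im_le_Cmod (z : C) : (Rabs (Im z) <= Cmod z)%R.
Proof.
  eapply Rle_trans; [|apply Rmax_Cmod]. apply Rmax_r.
Qed.

Lemma Cmod_minus_sym (a b : C) : Cmod (a - b) = Cmod (b - a).
Proof. rewrite <- Cmod_opp. f_equal. ring. Qed.

Lemma Cmod_triangle3 (a b c : C) : (Cmod (a - c) <= Cmod (a - b) + Cmod (b - c))%R.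
Proof.
  replace (a - c) with ((a - b) + (b - c)) by ring. apply Cmod_triangle.
Qed.

Lemma Cmod_triangle_sub (a b : C) : (Cmod a - Cmod b <= Cmod (a - b))%R.
Proof.
  pose proof (Cmod_triangle (a - b) b).
  replace (a - b + b) with a in H by ring. lra.
Qed.

Lemma Ceq_eps (a b : C) : (forall eps, 0 < eps -> Cmod (a - b) <= eps)%R -> a = b.
Proof.
  intros H. apply Ceq_minus, Cmod_eq_0.
  destruct (Cmod_ge_0 (a - b)) as [h|h]; [|auto].
  specialize (H (Cmod (a - b) / 2)%R ltac:(lra)). lra.
Qed.

Lemma RtoC_m1 : RtoC (-1) = - (1).
Proof. now rewrite <- RtoC_opp. Qed.

Fixpoint csum (a : nat -> C) (n : nat) : C :=
  match n with O => 0 | S k => csum a k + a k end.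

(** The real [Series] is total, so terms can be rewritten with [Csum_ext] free of side conditions;
    [absc] enters only in laws that depend on convergence. *)
Definition Csum (a : nat -> C) : C :=
  (Series (fun n => Re (a n)), Series (fun n => Im (a n))).

Definition absc (a : nat -> C) : Prop := ex_series (fun n => Cmod (a n)).

Lemma ex_series_le_R (a b : nat -> R) : (forall n, Rabs (a n) <= b n)%R -> ex_series b -> ex_series a.
Proof. apply (ex_series_le (K := R_AbsRing) (V := R_CompleteNormedModule)). Qed.

Lemma ex_series_shift (a : nat -> R) k : ex_series a <-> ex_series (fun n => a (k + n)%nat).
Proof. apply (ex_series_incr_n (K := R_AbsRing) (V := R_NormedModule)). Qed.

Lemma absc_le (a : nat -> C) (b : nat -> R) :
  (forall n, Cmod (a n) <= b n)%R -> ex_series b -> absc a.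
Proof.
  intros H Hb. apply ex_series_le_R with (2 := Hb). intros n. rewrite Rabs_pos_eq; auto using Cmod_ge_0.
Qed.

Lemma absc_ext (a b : nat -> C) : (forall n, a n = b n) -> absc a -> absc b.
Proof. intros H Ha. apply absc_le with (2 := Ha). intros n; rewrite H; lra. Qed.

Lemma absc_re a : absc a -> ex_series (fun n => Re (a n)).
Proof.
  intros H. apply ex_series_le_R with (2 := H).
  intros n. apply re_le_Cmod.
Qed.

Lemma absc_im a : absc a -> ex_series (fun n => Im (a n)).
Proof.
  intros H. apply ex_series_le_R with (2 := H).
  intros n. apply im_le_Cmod.
Qed.

Lemma absc_plus a b : absc a -> absc b -> absc (fun n => a n + b n).
Proof.
  intros Ha Hb. apply absc_le with (b := fun n => (Cmod (a n) + Cmod (b n))%R).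
  intros; apply Cmod_triangle.
  apply (ex_series_plus (K := R_AbsRing) (V := R_NormedModule) _ _ Ha Hb).
Qed.

Lemma ex_series_scal_R (c : R) (b : nat -> R) : ex_series b -> ex_series (fun n => (c * b n)%R).
Proof. intros; apply (ex_series_scal_l (K := R_AbsRing) c b H). Qed.

Lemma absc_scal c a : absc a -> absc (fun n => c * a n).
Proof.
  intros Ha. apply absc_le with (b := fun n => (Cmod c * Cmod (a n))%R).
  intros; rewrite Cmod_mult; lra. apply ex_series_scal_R, Ha.
Qed.

Lemma absc_opp a : absc a -> absc (fun n => - a n).
Proof.
  intros Ha. apply absc_le with (2 := Ha). intros; rewrite Cmod_opp; lra.
Qed.

Lemma absc_minus a b : absc a -> absc b -> absc (fun n => a n - b n).
Proof. intros Ha Hb. apply (absc_plus a (fun n => - b n)); auto. now apply absc_opp. Qed.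

Lemma absc_shift a k : absc a -> absc (fun n => a (k + n)%nat).
Proof.
  exact (proj1 (ex_series_shift (fun n => Cmod (a n)) k)).
Qed.

Lemma absc_incr (a : nat -> C) : absc (fun n => a (S n)) -> absc a.
Proof. exact (proj2 (ex_series_shift (fun n => Cmod (a n)) 1)). Qed.

Lemma Csum_ext (a b : nat -> C) : (forall n, a n = b n) -> Csum a = Csum b.
Proof. intros H. unfold Csum. f_equal; apply Series_ext; intros; now rewrite H. Qed.

Lemma Csum_plus a b : absc a -> absc b -> Csum (fun n => a n + b n) = Csum a + Csum b.
Proof.
  intros Ha Hb. unfold Csum, Cplus; simpl. f_equal; apply Series_plus;
  auto using absc_re, absc_im.
Qed.

Lemma Csum_scal c a : absc a -> Csum (fun n => c * a n) = c * Csum a.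
Proof.
  intros Ha. pose proof (absc_re _ Ha). pose proof (absc_im _ Ha).
  destruct c as [x y]. unfold Csum, Cmult; simpl. f_equal.
  - rewrite <- !Series_scal_l. apply Series_minus; now apply ex_series_scal_R.
  - rewrite <- !Series_scal_l. apply Series_plus; now apply ex_series_scal_R.
Qed.

Lemma Csum_opp a : Csum (fun n => - a n) = - Csum a.
Proof. unfold Csum, Copp; simpl. f_equal; apply Series_opp. Qed.

Lemma Csum_minus a b : absc a -> absc b -> Csum (fun n => a n - b n) = Csum a - Csum b.
Proof.
  intros Ha Hb. unfold Cminus. rewrite <- Csum_opp. apply Csum_plus; auto using absc_opp.
Qed.

Lemma Csum_incr a : absc a -> Csum a = a 0%nat + Csum (fun n => a (S n)).
Proof.
  intros Ha. unfold Csum, Cplus; simpl. f_equal; apply (Series_incr_1 (fun n => _)); auto using absc_re, absc_im.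
Qed.

Lemma Csum_split a n : absc a -> Csum a = csum a n + Csum (fun k => a (n + k)%nat).
Proof.
  intros Ha. induction n as [|n IH]; simpl.
  - rewrite Cplus_0_l. reflexivity.
  - rewrite IH. rewrite (Csum_incr (fun k => a (n + k)%nat)) by now apply absc_shift.
    rewrite Nat.add_0_r. rewrite <- Cplus_assoc. do 2 f_equal. apply Csum_ext.
    intros k; f_equal; lia.
Qed.

Lemma Csum_0 : Csum (fun _ => 0) = 0.
Proof.
  unfold Csum; simpl.
  assert (Series (fun _ : nat => 0%R) = 0%R) as ->.
  { rewrite (Series_ext _ (fun n => 0 * 0)%R) by (intros; ring).
    rewrite Series_scal_l; ring. }
  reflexivity.
Qed.

Lemma series_tail (u : nat -> R) : ex_series u -> forall eps, (0 < eps)%R ->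
  exists N, forall n, (N <= n)%nat -> (Rabs (Series (fun k => u (n + k)%nat)) < eps)%R.
Proof.
  intros Hu eps He. pose proof (Series_correct _ Hu) as H.
  unfold is_series in H.
  destruct (proj1 (filterlim_locally (F := eventually) (sum_n u) (Series u)) H (mkposreal _ He)) as [N HN].
  exists (S N). intros n Hn. destruct n; [lia|].
  specialize (HN n ltac:(lia)). rewrite (Series_incr_n u (S n)) in HN by (auto; lia).
  rewrite <- sum_n_Reals in HN. simpl pred in HN.
  unfold ball in HN; simpl in HN; unfold AbsRing_ball, abs, minus, plus, opp in HN; simpl in HN.
  match goal with |- (Rabs ?x < _)%R => rewrite <- (Rabs_Ropp x) end.
  eapply Rle_lt_trans; [|exact HN]. right; f_equal; simpl. ring.
Qed.

Lemma Series_pos (u : nat -> R) : (forall n, 0 <= u n)%R -> ex_series u -> (0 <= Series u)%R.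
Proof.
  intros H Hu. replace 0%R with (Series (fun n => 0 * u n)%R) by (rewrite Series_scal_l; ring).
  apply Series_le; auto. intros n; specialize (H n); lra.
Qed.

(** The factor 2 comes from treating real and imaginary parts separately. The bound is enough to
    prove convergence of the partial sums, after which [Csum_le] removes the factor. *)
Lemma Csum_le2 a : absc a -> (Cmod (Csum a) <= 2 * Series (fun n => Cmod (a n)))%R.
Proof.
  intros Ha. eapply Rle_trans; [apply Cmod_le_abs|]. unfold Csum; simpl.
  assert (H : forall g : nat -> R, (forall n, Rabs (g n) <= Cmod (a n))%R ->
     (Rabs (Series g) <= Series (fun n => Cmod (a n)))%R).
  { intros g Hg. eapply Rle_trans; [apply Series_Rabs|].
    - apply ex_series_le_R with (2 := Ha). intros n. rewrite Rabs_Rabsolu. apply Hg.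
    - apply Series_le; auto. intros; split; auto using Rabs_pos. }
  pose proof (H _ (fun n => re_le_Cmod (a n))). pose proof (H _ (fun n => im_le_Cmod (a n))). lra.
Qed.

Lemma csum_le a n : absc a -> (Cmod (csum a n) <= Series (fun k => Cmod (a k)))%R.
Proof.
  intros Ha.
  (* The tail is carried along so that the induction closes: moving one term from the tail into the
     partial sum can only decrease the left side. *)
  assert (H : forall n, (Cmod (csum a n) + Series (fun k => Cmod (a (n + k)%nat)) <= Series (fun k => Cmod (a k)))%R).
  { clear n; intros n; induction n as [|n IH]; simpl.
    - rewrite Cmod_0; lra.
    - rewrite (Series_incr_1 (fun k => Cmod (a (n + k)%nat))) in IH by now apply (absc_shift a n).
      rewrite Nat.add_0_r in IH. pose proof (Cmod_triangle (csum a n) (a n)).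
      rewrite (Series_ext _ (fun k => Cmod (a (n + S k)%nat))) by (intros; f_equal; f_equal; lia). lra. }
  specialize (H n). pose proof (Series_pos _ (fun k => Cmod_ge_0 (a (n + k)%nat)) (absc_shift a n Ha)). lra.
Qed.

Lemma Csum_lim a : absc a -> forall eps, (0 < eps)%R ->
  exists N, forall n, (N <= n)%nat -> (Cmod (csum a n - Csum a) < eps)%R.
Proof.
  intros Ha eps He. destruct (series_tail _ Ha (eps / 2) ltac:(lra)) as [N HN].
  exists N; intros n Hn. specialize (HN n Hn).
  rewrite Cmod_minus_sym, (Csum_split a n Ha).
  match goal with |- context [Cmod ?x] => replace x with (Csum (fun k => a (n + k)%nat)) by ring end.
  pose proof (Csum_le2 _ (absc_shift a n Ha)).
  rewrite Rabs_pos_eq in HN. lra. apply Series_pos. intros; apply Cmod_ge_0. now apply (absc_shift a n).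
Qed.

Lemma Csum_le a : absc a -> (Cmod (Csum a) <= Series (fun n => Cmod (a n)))%R.
Proof.
  intros Ha. apply le_epsilon. intros eps He.
  destruct (Csum_lim a Ha eps He) as [N HN]. specialize (HN N (Nat.le_refl _)).
  pose proof (csum_le a N Ha). rewrite Cmod_minus_sym in HN.
  pose proof (Cmod_triangle_sub (Csum a) (csum a N)). lra.
Qed.

Lemma Csum_bound a (b : nat -> R) : (forall n, Cmod (a n) <= b n)%R -> ex_series b ->
  (Cmod (Csum a) <= Series b)%R.
Proof.
  intros H Hb. eapply Rle_trans; [apply Csum_le; eapply absc_le; eauto|].
  apply Series_le; auto. intros; split; auto using Cmod_ge_0.
Qed.

Lemma Csum_unique a l : absc a ->
  (forall eps, (0 < eps)%R -> exists N, forall n, (N <= n)%nat -> (Cmod (csum a n - l) <= eps)%R) ->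
  Csum a = l.
Proof.
  intros Ha H. apply Ceq_eps. intros eps He.
  destruct (H (eps / 2)%R ltac:(lra)) as [N HN]. destruct (Csum_lim a Ha (eps / 2) ltac:(lra)) as [N' HN'].
  specialize (HN (Nat.max N N') ltac:(lia)). specialize (HN' (Nat.max N N') ltac:(lia)).
  rewrite Cmod_minus_sym in HN'.
  pose proof (Cmod_triangle3 (Csum a) (csum a (Nat.max N N')) l). lra.
Qed.

Lemma csum_ext (a b : nat -> C) n : (forall k, (k < n)%nat -> a k = b k) -> csum a n = csum b n.
Proof.
  induction n; simpl; intros H; auto. rewrite IHn by (intros; apply H; lia). now rewrite H by lia.
Qed.

Lemma csum_scal c a n : csum (fun k => c * a k) n = c * csum a n.
Proof. induction n; simpl; [ring|]. rewrite IHn; ring. Qed.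

Lemma csum_0 (a : nat -> C) n : (forall k, (k < n)%nat -> a k = 0) -> csum a n = 0.
Proof.
  intros H; induction n; simpl; auto. rewrite IHn by (intros; apply H; lia). rewrite H by lia. ring.
Qed.

Lemma csum_incr a n : csum a (S n) = a 0%nat + csum (fun k => a (S k)) n.
Proof. induction n; [simpl; ring|]. change (csum a (S n) + a (S n) = a 0%nat + (csum (fun k => a (S k)) n + a (S n))). rewrite IHn; ring. Qed.

Lemma csum_Cmod a (b : R) n : (forall k, (k < n)%nat -> Cmod (a k) <= b)%R -> (Cmod (csum a n) <= INR n * b)%R.
Proof.
  intros H. induction n; simpl csum. rewrite Cmod_0; simpl; lra.
  rewrite S_INR. pose proof (Cmod_triangle (csum a n) (a n)).
  specialize (H n ltac:(lia)) as H1. specialize (IHn ltac:(intros; apply H; lia)). lra.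
Qed.

Lemma absc_0 : absc (fun _ => 0).
Proof.
  exists 0%R. apply is_series_Reals. intros e He. exists 0%nat. intros.
  rewrite sum_eq_R0 by (intros; apply Cmod_0). unfold Rdist. now rewrite Rminus_0_r, Rabs_R0.
Qed.

Lemma csum_Csum (t : nat -> nat -> C) n : (forall i, absc (t i)) ->
  absc (fun j => csum (fun i => t i j) n) /\
  csum (fun i => Csum (t i)) n = Csum (fun j => csum (fun i => t i j) n).
Proof.
  intros H. induction n as [|n [IH1 IH2]]; simpl.
  - split. 2: now rewrite Csum_0. exact absc_0.
  - split. now apply absc_plus. rewrite Csum_plus; auto. now rewrite IH2.
Qed.

Lemma Csum_finite (a : nat -> C) n : (forall k, (n <= k)%nat -> a k = 0) -> absc a /\ Csum a = csum a n.
Proof.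
  intros H.
  assert (Ha : absc a).
  { apply (proj2 (ex_series_shift (fun n => Cmod (a n)) n)).
    apply absc_le with (2 := absc_0). intros k. rewrite H by lia. lra. }
  split; auto. rewrite (Csum_split a n Ha). rewrite (Csum_ext _ (fun _ => 0)).
  rewrite Csum_0; ring. intros k; apply H; lia.
Qed.

(** * Interchange of double sums dominated by a product *)

Section Fubini.
Variables (t : nat -> nat -> C) (u v : nat -> R).
Hypothesis (Hu : ex_series u) (Hv : ex_series v).
Hypothesis (Hu0 : forall n, (0 <= u n)%R) (Hv0 : forall n, (0 <= v n)%R).
Hypothesis (Ht : forall i j, (Cmod (t i j) <= u i * v j)%R).

Lemma fubini_row i : absc (t i).
Proof. apply absc_le with (1 := Ht i). now apply ex_series_scal_R. Qed.

Lemma fubini_col j : absc (fun i => t i j).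
Proof.
  apply absc_le with (b := fun i => (v j * u i)%R). intros i; specialize (Ht i j); lra.
  now apply ex_series_scal_R.
Qed.

Lemma fubini_rows : absc (fun i => Csum (t i)).
Proof.
  apply absc_le with (b := fun i => (Series v * u i)%R).
  - intros i. eapply Rle_trans; [apply (Csum_bound _ _ (Ht i)); now apply ex_series_scal_R|].
    rewrite Series_scal_l; lra.
  - now apply ex_series_scal_R.
Qed.

Lemma fubini_cols : absc (fun j => Csum (fun i => t i j)).
Proof.
  apply absc_le with (b := fun j => (Series u * v j)%R).
  - intros j. eapply Rle_trans; [apply (Csum_bound _ (fun i => u i * v j)%R)|].
    + intros; apply Ht.
    + apply ex_series_scal_r; auto.
    + rewrite Series_scal_r; lra.
  - now apply ex_series_scal_R.
Qed.

(** The first n rows can be exchanged with the sum over j by finite additivity; the rest is at most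
    the tail of [u] times the sum of [v]. *)
Lemma fubini : Csum (fun i => Csum (t i)) = Csum (fun j => Csum (fun i => t i j)).
Proof.
  apply Csum_unique; [apply fubini_rows|]. intros eps He.
  assert (HV : (0 <= Series v)%R) by now apply Series_pos.
  (* Adding 1 keeps the divisor positive when [v] sums to 0. *)
  destruct (series_tail u Hu (eps / (Series v + 1)) ltac:(apply Rdiv_lt_0_compat; lra)) as [N HN].
  exists N. intros n Hn. specialize (HN n Hn).
  destruct (csum_Csum t n fubini_row) as [H1 H2]. rewrite H2.
  rewrite Cmod_minus_sym, <- Csum_minus; [|apply fubini_cols|exact H1].
  assert (Hun : ex_series (fun k => u (n + k)%nat)) by now apply (ex_series_shift u n).
  eapply Rle_trans; [apply (Csum_bound _ (fun j => Series (fun k => u (n + k)%nat) * v j)%R)|].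
  - intros j. rewrite (Csum_split _ n (fubini_col j)).
    match goal with |- context [Cmod ?x] => replace x with (Csum (fun k => t (n + k)%nat j)) by ring end.
    rewrite <- Series_scal_r. apply Csum_bound. intros; apply Ht.
    apply ex_series_scal_r; auto.
  - now apply ex_series_scal_R.
  - rewrite Series_scal_l. rewrite Rabs_pos_eq in HN by now apply Series_pos.
    apply Rle_trans with (eps / (Series v + 1) * Series v)%R.
    apply Rmult_le_compat_r; lra.
    unfold Rdiv. rewrite Rmult_assoc. rewrite <- (Rmult_1_r eps) at 2. apply Rmult_le_compat_l. lra.
    apply Rmult_le_reg_l with (Series v + 1)%R. lra. field_simplify; lra.
Qed.
End Fubini.

Lemma is_series_Csum a l : absc a -> is_series (K := C_AbsRing) (V := C_NormedModule) a l -> Csum a = l.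
Proof.
  intros Ha H. apply Csum_unique; auto. intros eps He.
  unfold is_series in H.
  (* Balls of [C] are squares in the two coordinates; passing to the modulus costs a factor sqrt
     2. *)
  assert (Hs : (0 < sqrt 2)%R) by (apply sqrt_lt_R0; lra).
  destruct (proj1 (filterlim_locally (F := eventually) (sum_n a) l) H
    (mkposreal (eps / sqrt 2) ltac:(now apply Rdiv_lt_0_compat))) as [N HN].
  exists (S N). intros n Hn. destruct n; [lia|]. specialize (HN n ltac:(lia)).
  assert (E : csum a (S n) = sum_n a n).
  { clear. induction n. rewrite sum_O; simpl; ring. rewrite sum_Sn, <- IHn. reflexivity. }
  rewrite E. apply C_NormedModule_mixin_compat2 in HN. left. eapply Rlt_le_trans; [exact HN|].
  right; simpl; field; lra.
Qed.

(** * Power series in the unit disc *)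

(* Convergence in the open unit disc, as boundedness of the terms (Abel's lemma). *)
Definition disc (a : nat -> C) : Prop :=
  forall rho, (0 <= rho < 1)%R -> exists M, forall n, (Cmod (a n) * rho ^ n <= M)%R.

Definition ev (a : nat -> C) (q : C) : C := Csum (fun n => a n * q ^ n).

Definition Dq (a : nat -> C) (n : nat) : C := RtoC (INR n) * a n.

Definition conv (a b : nat -> C) (n : nat) : C := csum (fun i => a i * b (n - i)%nat) (S n).

(** The quotient of rho by the midpoint (1 + rho)/2 between rho and 1: terms bounded at the midpoint
    decay geometrically at rho with this ratio. *)
Definition ratio (rho : R) : R := (2 * rho / (1 + rho))%R.

Lemma ratio_bounds rho : (0 <= rho < 1)%R -> (0 <= ratio rho < 1)%R.
Proof.
  intros H; unfold ratio. split.
  - apply Rmult_le_pos. lra. left; apply Rinv_0_lt_compat; lra.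
  - apply Rmult_lt_reg_r with (1 + rho)%R. lra. field_simplify; lra.
Qed.

Lemma pow_nonneg r n : (0 <= r -> 0 <= r ^ n)%R.
Proof. intros; now apply pow_le. Qed.

Lemma disc_geo a rho : disc a -> (0 <= rho < 1)%R ->
  exists K, (0 <= K)%R /\ forall n, (Cmod (a n) * rho ^ n <= K * ratio rho ^ n)%R.
Proof.
  intros Ha Hr. destruct (Ha ((1 + rho) / 2)%R ltac:(lra)) as [M HM].
  exists M. split.
  - specialize (HM 0%nat). simpl in HM. pose proof (Cmod_ge_0 (a 0%nat)). lra.
  - intros n. specialize (HM n).
    assert (E : (rho ^ n = ((1 + rho) / 2) ^ n * ratio rho ^ n)%R).
    { rewrite <- Rpow_mult_distr. f_equal. unfold ratio. field; lra. }
    rewrite E, <- Rmult_assoc. apply Rmult_le_compat_r; auto.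
    apply pow_nonneg, ratio_bounds, Hr.
Qed.

Lemma ex_series_geo K r : (0 <= r < 1)%R -> ex_series (fun n => (K * r ^ n)%R).
Proof.
  intros H. apply ex_series_scal_R. exists (/ (1 - r))%R. apply is_series_geom.
  rewrite Rabs_pos_eq; lra.
Qed.

Lemma ex_series_le_pos (a b : nat -> R) : (forall n, 0 <= a n <= b n)%R -> ex_series b -> ex_series a.
Proof.
  intros H. apply ex_series_le_R. intros n. specialize (H n). rewrite Rabs_pos_eq; lra.
Qed.

Lemma disc_series a rho : disc a -> (0 <= rho < 1)%R -> ex_series (fun n => (Cmod (a n) * rho ^ n)%R).
Proof.
  intros Ha Hr. destruct (disc_geo a rho Ha Hr) as [K [HK H]].
  eapply ex_series_le_pos; [|apply (ex_series_geo K), (ratio_bounds _ Hr)].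
  intros n; split; auto. apply Rmult_le_pos. apply Cmod_ge_0. apply pow_nonneg; lra.
Qed.

Lemma ev_absc a q : disc a -> (Cmod q < 1)%R -> absc (fun n => a n * q ^ n).
Proof.
  intros Ha Hq. eapply absc_le; [|apply (disc_series a (Cmod q) Ha)].
  - intros n. rewrite Cmod_mult, Cmod_pow. lra.
  - split; auto. apply Cmod_ge_0.
Qed.

Lemma disc_le (a b : nat -> C) : (forall n, Cmod (b n) <= Cmod (a n))%R -> disc a -> disc b.
Proof.
  intros H Ha rho Hr. destruct (Ha rho Hr) as [M HM]. exists M. intros n.
  eapply Rle_trans; [|apply (HM n)]. apply Rmult_le_compat_r; auto. apply pow_nonneg; lra.
Qed.

Lemma disc_plus (a b : nat -> C) : disc a -> disc b -> disc (fun n => a n + b n).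
Proof.
  intros Ha Hb rho Hr. destruct (Ha rho Hr) as [M HM]. destruct (Hb rho Hr) as [M' HM'].
  exists (M + M')%R. intros n. specialize (HM n). specialize (HM' n).
  pose proof (Cmod_triangle (a n) (b n)). pose proof (pow_nonneg rho n ltac:(lra)). nra.
Qed.

Lemma disc_scal (c : C) (a : nat -> C) : disc a -> disc (fun n => c * a n).
Proof.
  intros Ha rho Hr. destruct (Ha rho Hr) as [M HM].
  exists (Cmod c * M)%R. intros n. rewrite Cmod_mult, Rmult_assoc.
  apply Rmult_le_compat_l; auto. apply Cmod_ge_0.
Qed.

Lemma n_pow_bound r : (0 <= r < 1)%R -> exists M, (0 <= M)%R /\ forall n, (INR n * r ^ n <= M)%R.
Proof.
  intros Hr. destruct (Req_dec r 0) as [->|Hn].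
  - exists 0%R. split; [lra|]. intros [|n]; simpl; lra.
  - exists (/ (/ r - 1))%R.
    assert (Hx : (0 < / r - 1)%R).
    { apply Rlt_0_minus. rewrite <- Rinv_1. apply Rinv_lt_contravar; lra. }
    split. left; now apply Rinv_0_lt_compat.
    (* Bernoulli's inequality: (1/r)^n >= 1 + n (1/r - 1). *)
    intros n. pose proof (poly n (/ r - 1) Hx) as H.
    replace (1 + (/ r - 1))%R with (/ r)%R in H by ring.
    rewrite pow_inv in H.
    assert (0 < r ^ n)%R by (apply pow_lt; lra).
    apply Rmult_le_reg_r with (/ r - 1)%R; auto. rewrite Rinv_l by lra.
    apply Rmult_le_reg_r with (/ (r ^ n))%R. now apply Rinv_0_lt_compat.
    replace (INR n * r ^ n * (/ r - 1) * / r ^ n)%R with (INR n * (/ r - 1))%R by (field; split; lra).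
    lra.
Qed.

Lemma disc_Dq a : disc a -> disc (Dq a).
Proof.
  intros Ha rho Hr. destruct (disc_geo a rho Ha Hr) as [K [HK H]].
  destruct (n_pow_bound _ (ratio_bounds rho Hr)) as [M [HM0 HM]].
  exists (K * M)%R. intros n. unfold Dq. rewrite Cmod_mult, Cmod_R, Rabs_pos_eq by apply pos_INR.
  specialize (H n). specialize (HM n). pose proof (pos_INR n).
  rewrite Rmult_assoc. apply Rle_trans with (INR n * (K * ratio rho ^ n))%R.
  apply Rmult_le_compat_l; auto.
  replace (INR n * (K * ratio rho ^ n))%R with (K * (INR n * ratio rho ^ n))%R by ring.
  apply Rmult_le_compat_l; auto.
Qed.

Lemma disc_1 : disc (fun _ => 1).
Proof.
  intros rho Hr. exists 1%R. intros n. rewrite Cmod_1, Rmult_1_l.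
  rewrite <- (pow1 n). apply pow_incr; lra.
Qed.

Lemma disc_bounded (a : nat -> C) M : (forall n, Cmod (a n) <= M)%R -> disc a.
Proof.
  intros H. apply disc_le with (a := fun n => RtoC M * 1). 2: apply disc_scal, disc_1.
  intros n. rewrite Cmult_1_r, Cmod_R. eapply Rle_trans; [apply H|apply Rle_abs].
Qed.

Lemma conv_term_bound a b rho K K' i n :
  (forall n, (Cmod (a n) * rho ^ n <= K * ratio rho ^ n)%R) ->
  (forall n, (Cmod (b n) * rho ^ n <= K' * ratio rho ^ n)%R) ->
  (0 <= rho < 1)%R -> (i <= n)%nat ->
  (Cmod (a i * b (n - i)%nat) * rho ^ n <= K * K' * ratio rho ^ n)%R.
Proof.
  intros Ha Hb Hr Hi. rewrite Cmod_mult.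
  replace n with (i + (n - i))%nat at 2 3 by lia. rewrite !pow_add.
  pose proof (pow_nonneg rho i ltac:(lra)). pose proof (pow_nonneg rho (n - i) ltac:(lra)).
  pose proof (Cmod_ge_0 (a i)). pose proof (Cmod_ge_0 (b (n - i)%nat)).
  replace (Cmod (a i) * Cmod (b (n - i)%nat) * (rho ^ i * rho ^ (n - i)))%R
    with ((Cmod (a i) * rho ^ i) * (Cmod (b (n - i)%nat) * rho ^ (n - i)))%R by ring.
  replace (K * K' * (ratio rho ^ i * ratio rho ^ (n - i)))%R
    with ((K * ratio rho ^ i) * (K' * ratio rho ^ (n - i)))%R by ring.
  apply Rmult_le_compat; auto; now apply Rmult_le_pos.
Qed.

Lemma disc_conv a b : disc a -> disc b -> disc (conv a b).
Proof.
  intros Ha Hb rho Hr.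
  destruct (disc_geo a rho Ha Hr) as [K [HK H]]. destruct (disc_geo b rho Hb Hr) as [K' [HK' H']].
  destruct (n_pow_bound _ (ratio_bounds rho Hr)) as [M [HM0 HM]].
  exists (K * K' * (M + 1))%R. intros n. unfold conv.
  pose proof (pow_nonneg rho n ltac:(lra)). pose proof (ratio_bounds rho Hr) as Hq.
  pose proof (pow_nonneg (ratio rho) n ltac:(lra)).
  assert (Hp : (ratio rho ^ n <= 1)%R) by (rewrite <- (pow1 n); apply pow_incr; lra).
  rewrite <- (Rabs_pos_eq (rho ^ n)) by auto. rewrite <- Cmod_R, <- Cmod_mult, Cmult_comm, <- csum_scal.
  eapply Rle_trans; [apply csum_Cmod with (b := (K * K' * ratio rho ^ n)%R)|].
  - intros i Hi. rewrite Cmult_comm, Cmod_mult, Cmod_R, Rabs_pos_eq by auto.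
    apply conv_term_bound; auto. lia.
  - specialize (HM n). rewrite S_INR.
    replace ((INR n + 1) * (K * K' * ratio rho ^ n))%R with (K * K' * (INR n * ratio rho ^ n + ratio rho ^ n))%R by ring.
    apply Rmult_le_compat_l. now apply Rmult_le_pos. lra.
Qed.

(* For i <= n one has r^n <= sqrt(r)^i * sqrt(r)^n, so the family is dominated by a product. *)
Lemma tri_fubini (t : nat -> nat -> C) K r : (0 <= r < 1)%R -> (0 <= K)%R ->
  (forall i n, (n < i)%nat -> t i n = 0) ->
  (forall i n, (i <= n)%nat -> (Cmod (t i n) <= K * r ^ n)%R) ->
  absc (fun i => Csum (t i)) /\
  absc (fun n => csum (fun i => t i n) (S n)) /\
  Csum (fun i => Csum (t i)) = Csum (fun n => csum (fun i => t i n) (S n)).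
Proof.
  intros Hr HK H0 Hb. set (s := sqrt r).
  assert (Hs : (0 <= s < 1)%R).
  { split. apply sqrt_pos. unfold s; rewrite <- sqrt_1. apply sqrt_lt_1; lra. }
  assert (Hss : (s * s = r)%R) by (apply sqrt_sqrt; lra).
  assert (Ht : forall i n, (Cmod (t i n) <= (K * s ^ i) * (1 * s ^ n))%R).
  { intros i n. pose proof (pow_nonneg s i ltac:(lra)). pose proof (pow_nonneg s n ltac:(lra)).
    destruct (Nat.le_gt_cases i n) as [Hi|Hi].
    - eapply Rle_trans; [apply Hb; auto|]. rewrite <- Hss, Rpow_mult_distr.
      assert (s ^ n <= s ^ i)%R.
      { replace n with (i + (n - i))%nat by lia. rewrite pow_add. rewrite <- (Rmult_1_r (s ^ i)) at 2.
        apply Rmult_le_compat_l; auto. rewrite <- (pow1 (n - i)). apply pow_incr; lra. }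
      rewrite Rmult_1_l, Rmult_assoc. apply Rmult_le_compat_l; auto. apply Rmult_le_compat_r; auto.
    - rewrite H0, Cmod_0 by auto. rewrite Rmult_1_l. repeat apply Rmult_le_pos; auto. }
  pose proof (ex_series_geo K s Hs) as Hu. pose proof (ex_series_geo 1 s Hs) as Hv.
  assert (Hu0 : forall n, (0 <= K * s ^ n)%R) by (intros; apply Rmult_le_pos; auto; apply pow_nonneg; lra).
  assert (Hv0 : forall n, (0 <= 1 * s ^ n)%R) by (intros; apply Rmult_le_pos; [lra|]; apply pow_nonneg; lra).
  assert (E : forall n, Csum (fun i => t i n) = csum (fun i => t i n) (S n)).
  { intros n. apply Csum_finite. intros k Hk. apply H0; lia. }
  split; [|split].
  - exact (fubini_rows t _ _ Hu Hv Ht).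
  - apply absc_ext with (1 := E). exact (fubini_cols t _ _ Hu Hv Ht).
  - rewrite (fubini t _ _ Hu Hv Hu0 Hv0 Ht). now apply Csum_ext.
Qed.

Lemma ev_ext a b q : (forall n, a n = b n) -> ev a q = ev b q.
Proof. intros H. apply Csum_ext. intros; now rewrite H. Qed.

Lemma ev_plus a b q : disc a -> disc b -> (Cmod q < 1)%R ->
  ev (fun n => a n + b n) q = ev a q + ev b q.
Proof.
  intros Ha Hb Hq. unfold ev. rewrite <- Csum_plus by now apply ev_absc.
  apply Csum_ext. intros; ring.
Qed.

Lemma ev_scal c a q : disc a -> (Cmod q < 1)%R -> ev (fun n => c * a n) q = c * ev a q.
Proof.
  intros Ha Hq. unfold ev. rewrite <- Csum_scal by now apply ev_absc.
  apply Csum_ext. intros; ring.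
Qed.

Lemma ev_conv a b q : disc a -> disc b -> (Cmod q < 1)%R -> ev (conv a b) q = ev a q * ev b q.
Proof.
  intros Ha Hb Hq. pose proof (Cmod_ge_0 q) as Hq0.
  destruct (disc_geo a (Cmod q) Ha ltac:(lra)) as [K [HK H]].
  destruct (disc_geo b (Cmod q) Hb ltac:(lra)) as [K' [HK' H']].
  (* In this triangular array the columns sum to the terms of the Cauchy product and row i sums to
     a_i q^i times [ev b q]. *)
  set (t := fun i n => if Nat.leb i n then a i * b (n - i)%nat * q ^ n else 0).
  destruct (tri_fubini t (K * K') (ratio (Cmod q))) as [_ [_ E]].
  - apply ratio_bounds; lra.
  - now apply Rmult_le_pos.
  - intros i n Hi. unfold t. destruct (Nat.leb_spec i n); auto; lia.
  - intros i n Hi. unfold t. destruct (Nat.leb_spec i n); [|lia].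
    rewrite Cmod_mult, Cmod_pow. apply conv_term_bound; auto; lra.
  - transitivity (Csum (fun n => csum (fun i => t i n) (S n))).
    + unfold ev. apply Csum_ext. intros n. unfold conv. rewrite Cmult_comm, <- csum_scal.
      apply csum_ext. intros i Hi. unfold t. destruct (Nat.leb_spec i n); [ring|lia].
    + rewrite <- E. unfold ev at 1. rewrite Cmult_comm, <- Csum_scal by now apply ev_absc.
      apply Csum_ext. intros i.
      assert (E1 : Csum (t i) = csum (t i) i + Csum (fun k => t i (i + k)%nat)).
      { apply Csum_split. apply absc_le with (b := fun n => (K * K' * ratio (Cmod q) ^ n)%R).
        2: apply ex_series_geo, ratio_bounds; lra.
        intros n. unfold t. destruct (Nat.leb_spec i n).
        rewrite Cmod_mult, Cmod_pow. apply conv_term_bound; auto; lra.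
        rewrite Cmod_0. apply Rmult_le_pos. now apply Rmult_le_pos. apply pow_nonneg, ratio_bounds; lra. }
      rewrite E1, csum_0, Cplus_0_l.
      2:{ intros k Hk. unfold t. destruct (Nat.leb_spec i k); auto; lia. }
      rewrite Cmult_comm. unfold ev. rewrite <- Csum_scal by now apply ev_absc.
      apply Csum_ext. intros k. unfold t. destruct (Nat.leb_spec i (i + k)); [|lia].
      replace (i + k - i)%nat with k by lia. rewrite Cpow_add_r. ring.
Qed.

Lemma ev_near0 a : disc a -> exists K, (0 <= K)%R /\ forall q, (Cmod q <= 1 / 2)%R ->
  (Cmod (ev a q - a 0%nat) <= K * Cmod q)%R.
Proof.
  intros Ha.
  assert (Hb : ex_series (fun n => (2 * (Cmod (a (S n)) * (1 / 2) ^ (S n)))%R)).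
  { apply ex_series_scal_R. apply (ex_series_shift (fun n => (Cmod (a n) * (1 / 2) ^ n)%R) 1).
    apply disc_series; auto; lra. }
  exists (Series (fun n => (2 * (Cmod (a (S n)) * (1 / 2) ^ (S n)))%R)). split.
  - apply Series_pos; auto. intros n. pose proof (Cmod_ge_0 (a (S n))). pose proof (pow_nonneg (1 / 2) (S n) ltac:(lra)). nra.
  - intros q Hq. unfold ev. rewrite Csum_incr by (apply ev_absc; auto; lra).
    match goal with |- context [Cmod ?x] => replace x with (Csum (fun n => a (S n) * q ^ S n)) by (simpl Cpow; ring) end.
    rewrite Rmult_comm, <- Series_scal_l. apply Csum_bound. 2: now apply ex_series_scal_R.
    intros n. rewrite Cmod_mult, Cmod_pow. simpl pow. pose proof (Cmod_ge_0 q). pose proof (Cmod_ge_0 (a (S n))).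
    assert (Cmod q ^ n <= (1 / 2) ^ n)%R by (apply pow_incr; lra).
    replace (Cmod q * (2 * (Cmod (a (S n)) * (1 / 2 * (1 / 2) ^ n))))%R with (Cmod (a (S n)) * (Cmod q * (1 / 2) ^ n))%R by field.
    apply Rmult_le_compat_l; auto. apply Rmult_le_compat_l; auto.
Qed.

(** Course-of-values recursion made structural: [solf b n] is a table whose entries are final up to
    index [n], and each new entry reads all the previous ones. *)
Fixpoint solf (b : nat -> C) (n : nat) : nat -> C :=
  match n with
  | O => fun _ => 1
  | S k => fun j => if Nat.leb j k then solf b k j
                    else csum (fun i => solf b k i * b (S k - i)%nat) (S k) / RtoC (INR (S k))
  end.

(* The power series solution, with constant term 1, of q X' = b X. *)
Definition sol (b : nat -> C) (n : nat) : C := solf b n n.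

Lemma solf_sol b n j : (j <= n)%nat -> solf b n j = sol b j.
Proof.
  induction n; intros H.
  - now replace j with 0%nat by lia.
  - destruct (Nat.eq_dec j (S n)) as [->|Hj]; auto.
    change (solf b (S n) j) with (if Nat.leb j n then solf b n j
                    else csum (fun i => solf b n i * b (S n - i)%nat) (S n) / RtoC (INR (S n))).
    destruct (Nat.leb_spec j n); [|lia]. apply IHn; lia.
Qed.

Lemma RtoC_INR_neq0 n : RtoC (INR (S n)) <> 0.
Proof. intros H. apply RtoC_inj in H. revert H. apply not_0_INR. lia. Qed.

Lemma sol_rec b n : RtoC (INR (S n)) * sol b (S n) = csum (fun i => sol b i * b (S n - i)%nat) (S n).
Proof.
  unfold sol at 1.
  change (solf b (S n) (S n)) with (if Nat.leb (S n) n then solf b n (S n)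
                    else csum (fun i => solf b n i * b (S n - i)%nat) (S n) / RtoC (INR (S n))).
  destruct (Nat.leb_spec (S n) n); [lia|].
  rewrite (csum_ext _ (fun i => sol b i * b (S n - i)%nat)).
  field. apply RtoC_INR_neq0. intros k Hk. rewrite solf_sol by lia. reflexivity.
Qed.

Lemma sol_0 b : sol b 0%nat = 1.
Proof. reflexivity. Qed.

Lemma Dq_sol (b : nat -> C) n : b 0%nat = 0 -> Dq (sol b) n = conv (sol b) b n.
Proof.
  intros Hb. destruct n; unfold Dq, conv.
  - simpl. rewrite Hb. ring.
  - rewrite sol_rec. change (csum ?f (S (S n))) with (csum f (S n) + f (S n)).
    cbv beta. rewrite Nat.sub_diag, Hb. ring.
Qed.

Lemma finite_max (f : nat -> R) N : exists M, (0 <= M)%R /\ forall n, (n <= N)%nat -> (f n <= M)%R.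
Proof.
  induction N as [|N [M [HM H]]].
  - exists (Rmax 0 (f 0%nat)). split. apply Rmax_l. intros n Hn. replace n with 0%nat by lia. apply Rmax_r.
  - exists (Rmax M (f (S N))). split. eapply Rle_trans; [exact HM|apply Rmax_l].
    intros n Hn. destruct (Nat.eq_dec n (S N)) as [->|]. apply Rmax_r.
    eapply Rle_trans; [apply H; lia|apply Rmax_l].
Qed.

(** If the first n+1 terms are bounded by M at radius rho, the recurrence bounds n+1 times the next
    one by M K r/(1-r). Once n+1 exceeds K/(1-r), dividing by n+1 gives back a bound by M, so the
    maximum over the finitely many earlier terms bounds them all. *)
Lemma disc_sol b : disc b -> disc (sol b).
Proof.
  intros Hb rho Hr. destruct (disc_geo b rho Hb Hr) as [K [HK H]].
  pose proof (ratio_bounds rho Hr) as Hq. set (r := ratio rho) in *. clearbody r.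
  destruct (archimed (K / (1 - r))) as [Hup _]. set (N := Z.to_nat (up (K / (1 - r)))).
  assert (HP : (0 <= K / (1 - r))%R) by (apply Rmult_le_pos; [lra|left; apply Rinv_0_lt_compat; lra]).
  assert (HN : (K / (1 - r) <= INR N)%R).
  { unfold N. rewrite INR_IZR_INZ, Z2Nat.id. lra. apply le_IZR. lra. }
  destruct (finite_max (fun n => Cmod (sol b n) * rho ^ n)%R N) as [M [HM0 HM]].
  exists M. intros n. induction n as [n IH] using (well_founded_induction lt_wf).
  destruct (Nat.le_gt_cases n N) as [Hn|Hn]; [now apply HM|].
  destruct n as [|n]; [lia|].
  (* The sum of r^(n+1-i) over i < m is at most r^(n+1-m) times r/(1-r); in this form each further
     term is absorbed exactly. *)
  assert (S1 : forall m, (m <= S n)%nat ->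
    (Cmod (csum (fun i => (sol b i * b (S n - i)%nat)%C) m) * rho ^ S n <= M * K * r ^ (S n - m) * (r / (1 - r)))%R).
  { induction m; intros Hm.
    - simpl csum. rewrite Cmod_0, Rmult_0_l. repeat apply Rmult_le_pos; auto; try (apply pow_nonneg); try lra.
      left; apply Rinv_0_lt_compat; lra.
    - simpl csum. eapply Rle_trans.
      apply Rmult_le_compat_r; [apply pow_nonneg; lra|]. apply Cmod_triangle.
      rewrite Rmult_plus_distr_r. specialize (IHm ltac:(lia)).
      assert (T : (Cmod (sol b m * b (S n - m)%nat) * rho ^ S n <= M * K * r ^ (S n - m))%R).
      { rewrite Cmod_mult. replace (S n) with (m + (S n - m))%nat at 2 by lia. rewrite pow_add.
        replace (Cmod (sol b m) * Cmod (b (S n - m)%nat) * (rho ^ m * rho ^ (S n - m)))%R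
        with ((Cmod (sol b m) * rho ^ m) * (Cmod (b (S n - m)%nat) * rho ^ (S n - m)))%R by ring.
        rewrite (Rmult_assoc M). apply Rmult_le_compat.
        apply Rmult_le_pos; [apply Cmod_ge_0|apply pow_nonneg; lra].
        apply Rmult_le_pos; [apply Cmod_ge_0|apply pow_nonneg; lra].
        apply IH; lia. apply H. }
      assert (E : (r ^ (S n - m) = r * r ^ (S n - S m))%R) by (replace (S n - m)%nat with (S (S n - S m)) by lia; reflexivity).
      rewrite E in IHm, T. set (x := (r ^ (S n - S m))%R) in *.
      eapply Rle_trans; [apply Rplus_le_compat; [exact IHm|exact T]|].
      right. field. lra. }
  specialize (S1 (S n) ltac:(lia)). rewrite Nat.sub_diag in S1.
  rewrite <- sol_rec, Cmod_mult, Cmod_R, Rabs_pos_eq in S1 by apply pos_INR.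
  assert (Hn1 : (INR N <= INR (S n))%R) by (apply le_INR; lia).
  assert (Hn2 : (0 < INR (S n))%R) by (apply lt_0_INR; lia).
  apply Rmult_le_reg_l with (INR (S n)); auto. rewrite <- Rmult_assoc.
  eapply Rle_trans; [exact S1|].
  replace (M * K * r ^ 0 * (r / (1 - r)))%R with (M * (r * (K / (1 - r))))%R by (simpl; field; lra).
  rewrite (Rmult_comm (INR (S n))). apply Rmult_le_compat_l; auto. nra.
Qed.

(** * Complex derivatives *)

(* Complex differentiability with a quadratic remainder: enough for analytic functions, and simpler to handle than limits. *)
Definition cder (f : C -> C) (z l : C) : Prop :=
  exists M d, (0 <= M)%R /\ (0 < d)%R /\
    forall k, (Cmod k <= d)%R -> (Cmod (f (z + k)%C - f z - k * l) <= M * Cmod k ^ 2)%R.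

Lemma Rmult_le_of_div K eps x : (0 <= K -> 0 <= x <= eps / (K + 1) -> K * x <= eps)%R.
Proof.
  intros HK Hx. apply Rle_trans with ((K + 1) * (eps / (K + 1)))%R. apply Rmult_le_compat; lra. right; field; lra.
Qed.

Lemma cder_ext_loc (f g : C -> C) z l d : (0 < d)%R ->
  (forall k, (Cmod k <= d)%R -> f (z + k) = g (z + k)) -> cder f z l -> cder g z l.
Proof.
  intros Hd H (M & e & HM & He & Hf). exists M, (Rmin d e). split; auto. split. now apply Rmin_pos.
  intros k Hk. pose proof (Rmin_l d e). pose proof (Rmin_r d e).
  rewrite <- H by lra. replace (g z) with (f z). apply Hf; lra.
  rewrite <- (Cplus_0_r z). apply H. rewrite Cmod_0; lra.
Qed.

Lemma cder_ext (f g : C -> C) z l : (forall x, f x = g x) -> cder f z l -> cder g z l.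
Proof. intros H. apply cder_ext_loc with 1%R; auto. lra. Qed.

Lemma cder_val (f : C -> C) z l l' : l = l' -> cder f z l -> cder f z l'.
Proof. now intros ->. Qed.

Lemma cder_const c z : cder (fun _ => c) z 0.
Proof.
  exists 0%R, 1%R. split; [lra|]. split; [lra|]. intros k _. right.
  replace (c - c - k * 0) with (RtoC 0) by ring. rewrite Cmod_0. ring.
Qed.

Lemma cder_id z : cder (fun x => x) z 1.
Proof.
  exists 0%R, 1%R. split; [lra|]. split; [lra|]. intros k _. right.
  replace (z + k - z - k * 1) with (RtoC 0) by ring. rewrite Cmod_0. ring.
Qed.

Lemma cder_plus f g z l l' : cder f z l -> cder g z l' -> cder (fun x => f x + g x) z (l + l').
Proof.
  intros (M & d & HM & Hd & Hf) (M' & d' & HM' & Hd' & Hg).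
  exists (M + M')%R, (Rmin d d'). split; [lra|]. split; [now apply Rmin_pos|].
  intros k Hk. pose proof (Rmin_l d d'). pose proof (Rmin_r d d').
  replace (f (z + k) + g (z + k) - (f z + g z) - k * (l + l')) with
    ((f (z + k) - f z - k * l) + (g (z + k) - g z - k * l')) by ring.
  eapply Rle_trans; [apply Cmod_triangle|]. specialize (Hf k ltac:(lra)). specialize (Hg k ltac:(lra)). lra.
Qed.

Lemma cder_lip f z l : cder f z l -> exists K d, (0 <= K)%R /\ (0 < d)%R /\
  forall k, (Cmod k <= d)%R -> (Cmod (f (z + k)%C - f z) <= K * Cmod k)%R.
Proof.
  intros (M & d & HM & Hd & Hf). exists (M * d + Cmod l)%R, d.
  pose proof (Cmod_ge_0 l). split; [nra|]. split; auto. intros k Hk. specialize (Hf k Hk).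
  replace (f (z + k) - f z) with ((f (z + k) - f z - k * l) + k * l) by ring.
  eapply Rle_trans; [apply Cmod_triangle|]. rewrite Cmod_mult. pose proof (Cmod_ge_0 k).
  assert (M * Cmod k ^ 2 <= M * d * Cmod k)%R. { simpl. rewrite Rmult_1_r, Rmult_assoc. apply Rmult_le_compat_l; auto. apply Rmult_le_compat_r; auto. }
  lra.
Qed.

Lemma cder_mult f g z l l' : cder f z l -> cder g z l' ->
  cder (fun x => f x * g x) z (l * g z + f z * l').
Proof.
  intros Df Dg. destruct (cder_lip f z l Df) as (K & e & HK & He & Lf).
  destruct (cder_lip g z l' Dg) as (K' & e' & HK' & He' & Lg).
  destruct Df as (M & d & HM & Hd & Hf). destruct Dg as (M' & d' & HM' & Hd' & Hg).
  set (r := Rmin (Rmin d d') (Rmin e e')).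
  pose proof (Rmin_l (Rmin d d') (Rmin e e')). pose proof (Rmin_r (Rmin d d') (Rmin e e')).
  pose proof (Rmin_l d d'). pose proof (Rmin_r d d'). pose proof (Rmin_l e e'). pose proof (Rmin_r e e').
  exists (M * Cmod (g z) + Cmod (f z) * M' + K * K')%R, r.
  pose proof (Cmod_ge_0 (g z)). pose proof (Cmod_ge_0 (f z)).
  split. assert (0 <= K * K')%R by nra. nra.
  split. unfold r. repeat apply Rmin_pos; auto.
  intros k Hk. fold r in H, H0. pose proof (Cmod_ge_0 k).
  specialize (Hf k ltac:(lra)). specialize (Hg k ltac:(lra)). specialize (Lf k ltac:(lra)). specialize (Lg k ltac:(lra)).
  replace (f (z + k) * g (z + k) - f z * g z - k * (l * g z + f z * l')) with
   ((f (z + k) - f z - k * l) * g z + f z * (g (z + k) - g z - k * l') + (f (z + k) - f z) * (g (z + k) - g z)) by ring.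
  eapply Rle_trans; [apply Cmod_triangle|].
  eapply Rle_trans; [apply Rplus_le_compat_r, Cmod_triangle|]. rewrite !Cmod_mult.
  replace ((M * Cmod (g z) + Cmod (f z) * M' + K * K') * Cmod k ^ 2)%R with
   (M * Cmod k ^ 2 * Cmod (g z) + Cmod (f z) * (M' * Cmod k ^ 2) + (K * Cmod k) * (K' * Cmod k))%R by ring.
  apply Rplus_le_compat. apply Rplus_le_compat.
  now apply Rmult_le_compat_r. now apply Rmult_le_compat_l.
  apply Rmult_le_compat; auto using Cmod_ge_0.
Qed.

Lemma cder_scal c f z l : cder f z l -> cder (fun x => c * f x) z (c * l).
Proof.
  intros H. eapply cder_val; [|apply cder_mult; [apply cder_const|exact H]]. cbv beta; ring.
Qed.

Lemma cder_minus f g z l l' : cder f z l -> cder g z l' -> cder (fun x => f x - g x) z (l - l').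
Proof.
  intros Hf Hg. apply cder_ext with (f := fun x => f x + (- (1)) * g x). intros; ring.
  eapply cder_val; [|apply cder_plus; [exact Hf|apply cder_scal, Hg]]. cbv beta; ring.
Qed.

Lemma cder_comp f g z l l' : cder g z l' -> cder f (g z) l -> cder (fun x => f (g x)) z (l' * l).
Proof.
  intros Dg (M & d & HM & Hd & Hf). destruct (cder_lip g z l' Dg) as (K & e & HK & He & Lg).
  destruct Dg as (M' & d' & HM' & Hd' & Hg).
  set (r := Rmin (Rmin d' e) (d / (K + 1))).
  assert (0 < d / (K + 1))%R by (apply Rdiv_lt_0_compat; lra).
  pose proof (Rmin_l (Rmin d' e) (d / (K + 1))). pose proof (Rmin_r (Rmin d' e) (d / (K + 1))).
  pose proof (Rmin_l d' e). pose proof (Rmin_r d' e).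
  exists (M * K ^ 2 + M' * Cmod l)%R, r. pose proof (Cmod_ge_0 l).
  split. pose proof (pow_nonneg K 2 HK). nra.
  split. unfold r. repeat apply Rmin_pos; auto.
  intros k Hk. fold r in H0, H1. pose proof (Cmod_ge_0 k).
  specialize (Hg k ltac:(lra)). specialize (Lg k ltac:(lra)).
  set (j := g (z + k) - g z) in *.
  assert (Hj : (Cmod j <= d)%R).
  { eapply Rle_trans; [exact Lg|]. apply Rmult_le_of_div; lra. }
  specialize (Hf j Hj). replace (g z + j) with (g (z + k)) in Hf by (unfold j; ring).
  replace (f (g (z + k)) - f (g z) - k * (l' * l)) with
    ((f (g (z + k)) - f (g z) - j * l) + (j - k * l') * l) by ring.
  eapply Rle_trans; [apply Cmod_triangle|]. rewrite Cmod_mult.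
  rewrite Rmult_plus_distr_r. apply Rplus_le_compat.
  - eapply Rle_trans; [exact Hf|]. rewrite Rmult_assoc, <- Rpow_mult_distr. apply Rmult_le_compat_l; auto.
    apply pow_incr. split; auto. apply Cmod_ge_0.
  - replace (M' * Cmod l * Cmod k ^ 2)%R with (M' * Cmod k ^ 2 * Cmod l)%R by ring. now apply Rmult_le_compat_r.
Qed.

(** This is how a functional equation gets differentiated: both sides are derived separately and the
    two results compared. *)
Lemma cder_unique f z l l' : cder f z l -> cder f z l' -> l = l'.
Proof.
  intros (M & d & HM & Hd & Hf) (M' & d' & HM' & Hd' & Hg).
  apply Ceq_eps. intros eps He.
  set (s := Rmin (Rmin d d') (eps / (M + M' + 1))).
  assert (0 < eps / (M + M' + 1))%R by (apply Rdiv_lt_0_compat; lra).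
  assert (Hs : (0 < s)%R) by (unfold s; repeat apply Rmin_pos; auto).
  pose proof (Rmin_l (Rmin d d') (eps / (M + M' + 1))) as h1. pose proof (Rmin_r (Rmin d d') (eps / (M + M' + 1))) as h2.
  pose proof (Rmin_l d d'). pose proof (Rmin_r d d'). fold s in h1, h2.
  assert (Es : Cmod (RtoC s) = s) by (rewrite Cmod_R, Rabs_pos_eq; lra).
  specialize (Hf (RtoC s) ltac:(lra)). specialize (Hg (RtoC s) ltac:(lra)). rewrite Es in Hf, Hg.
  pose proof (Cmod_triangle3 (f (z + RtoC s) - f z - RtoC s * l') 0 (f (z + RtoC s) - f z - RtoC s * l)) as H2.
  replace (f (z + RtoC s) - f z - RtoC s * l' - (f (z + RtoC s) - f z - RtoC s * l)) with (RtoC s * (l - l')) in H2 by ring.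
  rewrite Cmod_mult, Es, (Cmod_minus_sym 0) in H2.
  replace (f (z + RtoC s) - f z - RtoC s * l' - 0) with (f (z + RtoC s) - f z - RtoC s * l') in H2 by ring.
  replace (f (z + RtoC s) - f z - RtoC s * l - 0) with (f (z + RtoC s) - f z - RtoC s * l) in H2 by ring.
  assert (H3 : (s * Cmod (l - l') <= s * ((M + M') * s))%R) by (simpl in Hf, Hg; nra).
  apply Rmult_le_reg_l in H3; auto. eapply Rle_trans; [exact H3|]. apply Rmult_le_of_div; lra.
Qed.

Lemma cder_pow f n z l : cder f z l -> cder (fun x => f x ^ n) z (RtoC (INR n) * l * f z ^ pred n).
Proof.
  intros H. induction n.
  - eapply cder_val; [|apply (cder_const 1)]. simpl. cbv beta; ring.
  - eapply cder_val; [|apply (cder_mult f (fun x => f x ^ n) z _ _ H IHn)].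
    rewrite S_INR, RtoC_plus. destruct n; simpl; ring.
Qed.

Lemma cder_inv (z : C) : z <> 0 -> cder (fun x => / x) z (- / (z * z)).
Proof.
  intros Hz. assert (H0 : (0 < Cmod z)%R) by now apply Cmod_gt_0.
  exists (2 / Cmod z ^ 3)%R, (Cmod z / 2)%R.
  assert (Hp : (0 < Cmod z ^ 3)%R) by now apply pow_lt.
  split. apply Rmult_le_pos; [lra|]. left; now apply Rinv_0_lt_compat.
  split. lra.
  intros k Hk.
  assert (Hzk : (Cmod z / 2 <= Cmod (z + k))%R).
  { pose proof (Cmod_triangle_sub z (- k)). rewrite Cmod_opp in H.
    replace (z - - k) with (z + k) in H by ring. lra. }
  assert (Hzk0 : z + k <> 0) by (apply Cmod_gt_0; lra).
  replace (/ (z + k) - / z - k * - / (z * z)) with (k * k / ((z * z) * (z + k))) by (field; auto).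
  rewrite Cmod_div by (repeat apply Cmult_neq_0; auto). rewrite !Cmod_mult.
  apply Rmult_le_reg_r with (Cmod z * Cmod z * Cmod (z + k))%R.
  repeat apply Rmult_lt_0_compat; lra.
  replace (Cmod k * Cmod k / (Cmod z * Cmod z * Cmod (z + k)) * (Cmod z * Cmod z * Cmod (z + k)))%R with (Cmod k ^ 2)%R by (field; lra).
  replace (2 / Cmod z ^ 3 * Cmod k ^ 2 * (Cmod z * Cmod z * Cmod (z + k)))%R with
   (Cmod k ^ 2 * (Cmod (z + k) / (Cmod z / 2)))%R by (field; lra).
  rewrite <- (Rmult_1_r (Cmod k ^ 2)) at 1. apply Rmult_le_compat_l. apply pow_nonneg, Cmod_ge_0.
  apply Rmult_le_reg_r with (Cmod z / 2)%R. lra. field_simplify; lra.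
Qed.

(** The real mean value theorem along the segment, applied to the real and to the imaginary part;
    hence the factor 2. In the proof [pr] stands for either part, of which only real linearity and
    contraction matter. *)
Lemma cder_MVT f g a b K :
  (forall t, (0 <= t <= 1)%R -> cder f (a + RtoC t * (b - a))%C (g t) /\ (Cmod (g t) <= K)%R) ->
  (Cmod (f b - f a) <= 2 * K * Cmod (b - a))%R.
Proof.
  intros H.
  assert (P : forall pr : C -> R, (forall x y : C, pr (x - y)%C = (pr x - pr y)%R) ->
     (forall (s : R) (x : C), pr (RtoC s * x)%C = (s * pr x)%R) -> (forall x, (Rabs (pr x) <= Cmod x)%R) ->
     (Rabs (pr (f b - f a)%C) <= K * Cmod (b - a))%R).
  { intros pr P1 P2 P3.
    destruct (MVT_cor2 (fun t => pr (f (a + RtoC t * (b - a))%C)) (fun t => pr ((b - a) * g t)%C) 0 1 ltac:(lra)) as [c [E Hc]].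
    - intros t Ht. destruct (H t Ht) as [(M & d & HM & Hd & Hf) _].
      pose proof (Cmod_ge_0 (b - a)) as Hba. set (B := Cmod (b - a)) in *.
      intros eps He.
      assert (Hmin : (0 < Rmin (d / (B + 1)) (eps / (M * B ^ 2 + 1)))%R).
      { assert (0 <= M * B ^ 2)%R by (apply Rmult_le_pos; auto; apply pow_nonneg; auto).
        apply Rmin_pos; apply Rdiv_lt_0_compat; lra. }
      exists (mkposreal _ Hmin). intros s Hs0 Hs. cbn [pos] in Hs.
      pose proof (Rmin_l (d / (B + 1)) (eps / (M * B ^ 2 + 1))).
      pose proof (Rmin_r (d / (B + 1)) (eps / (M * B ^ 2 + 1))).
      assert (Hk : Cmod (RtoC s * (b - a)) = (Rabs s * B)%R) by (rewrite Cmod_mult, Cmod_R; auto).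
      assert (Hsp : (0 < Rabs s)%R) by now apply Rabs_pos_lt.
      specialize (Hf (RtoC s * (b - a))). rewrite Hk in Hf.
      assert (Hle : (Rabs s * B <= d)%R).
      { apply Rle_trans with (d / (B + 1) * (B + 1))%R. apply Rmult_le_compat; lra. right; field; lra. }
      specialize (Hf Hle).
      replace (a + RtoC t * (b - a) + RtoC s * (b - a)) with (a + RtoC (t + s) * (b - a)) in Hf by (rewrite RtoC_plus; ring).
      replace ((pr (f (a + RtoC (t + s) * (b - a))%C) - pr (f (a + RtoC t * (b - a))%C)) / s - pr ((b - a) * g t)%C)%R
        with (pr (f (a + RtoC (t + s) * (b - a)) - f (a + RtoC t * (b - a)) - RtoC s * (b - a) * g t)%C / s)%R.
      2:{ rewrite !P1. rewrite <- Cmult_assoc, P2. field; auto. }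
      unfold Rdiv at 1. rewrite Rabs_mult, Rabs_inv.
      apply Rmult_lt_reg_r with (Rabs s); auto. rewrite Rmult_assoc, Rinv_l by lra. rewrite Rmult_1_r.
      eapply Rle_lt_trans; [apply P3|]. eapply Rle_lt_trans; [exact Hf|].
      replace (M * (Rabs s * B) ^ 2)%R with (M * B ^ 2 * Rabs s * Rabs s)%R by ring.
      apply Rmult_lt_compat_r; auto.
      assert (Hm : (0 <= M * B ^ 2)%R) by (apply Rmult_le_pos; auto; apply pow_nonneg; auto).
      apply Rlt_le_trans with ((M * B ^ 2 + 1) * (eps / (M * B ^ 2 + 1)))%R. 2: right; field; lra.
      apply Rle_lt_trans with (M * B ^ 2 * (eps / (M * B ^ 2 + 1)))%R. apply Rmult_le_compat_l; lra.
      apply Rmult_lt_compat_r; try lra.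
    - assert (E1 : a + RtoC 1 * (b - a) = b) by ring. assert (E0 : a + RtoC 0 * (b - a) = a) by ring.
      rewrite E1, E0, <- P1 in E. rewrite E. rewrite Rminus_0_r, Rmult_1_r.
      eapply Rle_trans; [apply P3|]. rewrite Cmod_mult, Rmult_comm. apply Rmult_le_compat_r. apply Cmod_ge_0.
      apply H; lra. }
  eapply Rle_trans; [apply Cmod_le_abs|].
  pose proof (P Re ltac:(intros; reflexivity) ltac:(intros s x; apply re_scal_l) re_le_Cmod).
  pose proof (P Im ltac:(intros; reflexivity) ltac:(intros s x; apply im_scal_l) im_le_Cmod).
  lra.
Qed.

Lemma cder_0_const f a b :
  (forall t, (0 <= t <= 1)%R -> cder f (a + RtoC t * (b - a))%C 0) -> f b = f a.
Proof.
  intros H. apply Ceq_minus, Cmod_eq_0.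
  pose proof (cder_MVT f (fun _ => 0) a b 0%R). pose proof (Cmod_ge_0 (f b - f a)).
  assert (Cmod (f b - f a) <= 2 * 0 * Cmod (b - a))%R; [|lra].
  apply H0. intros t Ht. split. now apply H. rewrite Cmod_0; lra.
Qed.

Definition dev (a : nat -> C) (q : C) : C := Csum (fun n => RtoC (INR n) * a n * q ^ pred n).

(** The factor rho^2 on the left avoids the exponent n-2. The induction rests on R_{n+1} = (q+k) R_n
    + k^2 n q^(n-1) for the remainders R_n. *)
Lemma pow_taylor q k rho n : (0 <= rho)%R -> (Cmod q <= rho)%R -> (Cmod (q + k) <= rho)%R ->
  (rho ^ 2 * Cmod ((q + k) ^ n - q ^ n - k * (RtoC (INR n) * q ^ pred n)) <= INR n ^ 2 * Cmod k ^ 2 * rho ^ n)%R.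
Proof.
  intros Hr Hq Hk. induction n as [|n IH].
  - simpl. replace (1 - 1 - k * (0 * 1)) with (RtoC 0) by ring. rewrite Cmod_0. lra.
  - replace ((q + k) ^ S n - q ^ S n - k * (RtoC (INR (S n)) * q ^ pred (S n))) with
      ((q + k) * ((q + k) ^ n - q ^ n - k * (RtoC (INR n) * q ^ pred n)) + k * k * (RtoC (INR n) * q ^ pred n)).
    2:{ rewrite S_INR, RtoC_plus. destruct n; simpl; ring. }
    set (A := (q + k) ^ n - q ^ n - k * (RtoC (INR n) * q ^ pred n)) in *.
    assert (T : (rho ^ 2 * Cmod (k * k * (RtoC (INR n) * q ^ pred n)) <= INR n * Cmod k ^ 2 * rho ^ S n)%R).
    { rewrite !Cmod_mult, Cmod_R, Cmod_pow, Rabs_pos_eq by apply pos_INR.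
      destruct n. simpl; lra.
      simpl pred. assert (Cmod q ^ n <= rho ^ n)%R by (apply pow_incr; split; auto; apply Cmod_ge_0).
      pose proof (pos_INR (S n)). pose proof (Cmod_ge_0 k).
      replace (rho ^ 2 * (Cmod k * Cmod k * (INR (S n) * Cmod q ^ n)))%R with
        (INR (S n) * Cmod k ^ 2 * rho ^ 2 * Cmod q ^ n)%R by ring.
      replace (INR (S n) * Cmod k ^ 2 * rho ^ S (S n))%R with (INR (S n) * Cmod k ^ 2 * rho ^ 2 * rho ^ n)%R by (simpl; ring).
      apply Rmult_le_compat_l; auto. repeat apply Rmult_le_pos; auto; try lra. }
    assert (U : (rho ^ 2 * Cmod ((q + k) * A) <= INR n ^ 2 * Cmod k ^ 2 * rho ^ S n)%R).
    { rewrite Cmod_mult. simpl (rho ^ S n)%R.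
      replace (rho ^ 2 * (Cmod (q + k) * Cmod A))%R with (Cmod (q + k) * (rho ^ 2 * Cmod A))%R by ring.
      replace (INR n ^ 2 * Cmod k ^ 2 * (rho * rho ^ n))%R with (rho * (INR n ^ 2 * Cmod k ^ 2 * rho ^ n))%R by ring.
      apply Rmult_le_compat; auto. apply Cmod_ge_0. apply Rmult_le_pos. now apply pow_nonneg. apply Cmod_ge_0. }
    pose proof (Cmod_triangle ((q + k) * A) (k * k * (RtoC (INR n) * q ^ pred n))).
    pose proof (pow_nonneg rho 2 Hr). pose proof (pow_nonneg rho (S n) Hr). pose proof (pos_INR n).
    pose proof (pow_nonneg (Cmod k) 2 (Cmod_ge_0 k)).
    apply Rle_trans with (rho ^ 2 * (Cmod ((q + k) * A) + Cmod (k * k * (RtoC (INR n) * q ^ pred n))))%R.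
    now apply Rmult_le_compat_l.
    rewrite Rmult_plus_distr_l. rewrite (S_INR n).
    apply Rle_trans with (INR n ^ 2 * Cmod k ^ 2 * rho ^ S n + INR n * Cmod k ^ 2 * rho ^ S n)%R. lra.
    replace (INR n ^ 2 * Cmod k ^ 2 * rho ^ S n + INR n * Cmod k ^ 2 * rho ^ S n)%R with
     ((INR n ^ 2 + INR n) * (Cmod k ^ 2 * rho ^ S n))%R by ring.
    rewrite Rmult_assoc. apply Rmult_le_compat_r. now apply Rmult_le_pos. nra.
Qed.

Lemma cder_ev a q : disc a -> (Cmod q < 1)%R -> cder (ev a) q (dev a q).
Proof.
  intros Ha Hq. pose proof (Cmod_ge_0 q) as Hq0.
  set (rho := ((1 + Cmod q) / 2)%R). assert (Hr : (0 < rho < 1)%R) by (unfold rho; lra).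
  (* By [pow_taylor] the remainder of the n-th term is controlled by n^2 a_n, at a radius rho
     strictly between |q| and 1. *)
  set (c := Dq (Dq a)). assert (Hc : disc c) by (apply disc_Dq, disc_Dq, Ha).
  pose proof (disc_series c rho Hc ltac:(lra)) as Hs.
  set (S0 := Series (fun n => Cmod (c n) * rho ^ n)%R) in *.
  assert (HS0 : (0 <= S0)%R).
  { apply Series_pos; auto. intros; apply Rmult_le_pos. apply Cmod_ge_0. apply pow_nonneg; lra. }
  exists (S0 / rho ^ 2)%R, ((1 - Cmod q) / 2)%R.
  assert (Hr2 : (0 < rho ^ 2)%R) by (apply pow_lt; lra).
  split. apply Rmult_le_pos; auto. left; now apply Rinv_0_lt_compat.
  split. lra. intros k Hk.
  assert (Hqk : (Cmod (q + k) <= rho)%R) by (pose proof (Cmod_triangle q k); unfold rho; lra).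
  assert (A1 : absc (fun n => a n * (q + k) ^ n)) by (apply ev_absc; auto; lra).
  assert (A2 : absc (fun n => a n * q ^ n)) by (apply ev_absc; auto).
  assert (B : forall n, (rho ^ 2 * Cmod (a n * (q + k) ^ n - a n * q ^ n - k * (RtoC (INR n) * a n * q ^ pred n)) <= Cmod k ^ 2 * (Cmod (c n) * rho ^ n))%R).
  { intros n. replace (a n * (q + k) ^ n - a n * q ^ n - k * (RtoC (INR n) * a n * q ^ pred n)) with
      (a n * ((q + k) ^ n - q ^ n - k * (RtoC (INR n) * q ^ pred n))) by ring.
    rewrite Cmod_mult. pose proof (pow_taylor q k rho n ltac:(lra) ltac:(unfold rho; lra) Hqk) as T.
    set (X := Cmod ((q + k) ^ n - q ^ n - k * (RtoC (INR n) * q ^ pred n))) in *.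
    unfold c, Dq. rewrite !Cmod_mult, !Cmod_R, Rabs_pos_eq by apply pos_INR.
    apply Rle_trans with (Cmod (a n) * (rho ^ 2 * X))%R. right; ring.
    eapply Rle_trans; [apply Rmult_le_compat_l; [apply Cmod_ge_0|exact T]|]. right; ring. }
  assert (A4 : absc (fun n => a n * (q + k) ^ n - a n * q ^ n - k * (RtoC (INR n) * a n * q ^ pred n))).
  { apply absc_le with (b := fun n => (Cmod k ^ 2 / rho ^ 2 * (Cmod (c n) * rho ^ n))%R).
    2: now apply ex_series_scal_R.
    intros n. specialize (B n). apply Rmult_le_reg_l with (rho ^ 2)%R; auto.
    eapply Rle_trans; [exact B|]. right; field; lra. }
  (* Summability of the derivative series is deduced from that of the three other series by
     subtraction and division by k, so k = 0 is treated apart. *)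
  assert (A3 : absc (fun n => k * (RtoC (INR n) * a n * q ^ pred n))).
  { apply absc_ext with (a := fun n => a n * (q + k) ^ n - a n * q ^ n - (a n * (q + k) ^ n - a n * q ^ n - k * (RtoC (INR n) * a n * q ^ pred n))).
    intros; ring. apply absc_minus; auto. now apply absc_minus. }
  assert (A5 : k <> 0 -> absc (fun n => RtoC (INR n) * a n * q ^ pred n)).
  { intros Hk0. apply absc_ext with (a := fun n => / k * (k * (RtoC (INR n) * a n * q ^ pred n))).
    intros; field; auto. now apply absc_scal. }
  destruct (Ceq_dec k 0) as [->|Hk0].
  - replace (ev a (q + 0) - ev a q - 0 * dev a q) with (RtoC 0) by (rewrite Cplus_0_r; ring).
    rewrite Cmod_0. simpl. lra.
  - unfold ev, dev. rewrite <- Csum_minus by auto. rewrite <- Csum_scal by auto.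
    rewrite <- Csum_minus; auto. 2: now apply absc_minus.
    apply Rmult_le_reg_l with (rho ^ 2)%R; auto.
    rewrite <- (Rabs_pos_eq (rho ^ 2)) at 1 by lra. rewrite <- Cmod_R, <- Cmod_mult, <- Csum_scal by auto.
    replace (rho ^ 2 * (S0 / rho ^ 2 * Cmod k ^ 2))%R with (Cmod k ^ 2 * S0)%R by (field; lra).
    unfold S0. rewrite <- Series_scal_l. apply Csum_bound. 2: now apply ex_series_scal_R.
    intros n. rewrite Cmod_mult, Cmod_R, Rabs_pos_eq by lra. apply B.
Qed.

Lemma dev_Dq a q : disc a -> (Cmod q < 1)%R -> q * dev a q = ev (Dq a) q.
Proof.
  intros Ha Hq. destruct (Ceq_dec q 0) as [->|Hq0].
  - rewrite Cmult_0_l. unfold ev. symmetry. rewrite (Csum_ext _ (fun _ => 0)). apply Csum_0.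
    intros [|n]; unfold Dq; simpl; ring.
  - unfold dev, ev. rewrite <- Csum_scal.
    + apply Csum_ext. intros [|n]; unfold Dq; simpl; ring.
    + apply absc_ext with (a := fun n => / q * (Dq a n * q ^ n)).
      * intros [|n]; unfold Dq; simpl; field; auto.
      * apply absc_scal, ev_absc; auto. now apply disc_Dq.
Qed.

(** * The complex exponential *)

Lemma sin_abs_le x : (Rabs (sin x) <= Rabs x)%R.
Proof.
  assert (P : forall y, (0 <= y -> Rabs (sin y) <= y)%R).
  { intros y Hy. destruct (Rle_lt_dec 1 y) as [h|h].
    - pose proof (SIN_bound y). apply Rabs_le. lra.
    - destruct Hy as [Hy|<-]. 2: rewrite sin_0, Rabs_R0; lra.
      pose proof (sin_lt_x y Hy). pose proof PI2_1. pose proof (sin_ge_0 y ltac:(lra) ltac:(lra)).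
      rewrite Rabs_pos_eq; lra. }
  destruct (Rle_lt_dec 0 x) as [h|h].
  - rewrite (Rabs_pos_eq x); auto.
  - rewrite (Rabs_left x) by lra. rewrite <- Rabs_Ropp, <- sin_neg. apply P; lra.
Qed.

Lemma cos_near x : (Rabs (cos x - 1) <= x ^ 2 / 2)%R.
Proof.
  replace x with (2 * (x / 2))%R at 1 by field. rewrite cos_2a_sin.
  replace (1 - 2 * sin (x / 2) * sin (x / 2) - 1)%R with (- (2 * (sin (x / 2)) ^ 2))%R by ring.
  rewrite Rabs_Ropp, Rabs_pos_eq. 2: apply Rmult_le_pos; [lra|apply pow2_ge_0].
  pose proof (sin_abs_le (x / 2)) as H. apply pow_maj_Rabs with (n := 2%nat) in H.
  rewrite pow2_abs in H. simpl in *. lra.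
Qed.

Lemma sin_near x : (Rabs (sin x - x) <= Rabs x ^ 3 / 2)%R.
Proof.
  destruct (MVT_cor4 sin cos 0 (Rabs x)) with (b := x) as [c [E Hc]].
  - intros c _. apply is_derive_Reals, derivable_pt_lim_sin.
  - rewrite Rminus_0_r; lra.
  - rewrite sin_0, !Rminus_0_r in *. rewrite E.
    replace (cos c * x - x)%R with ((cos c - 1) * x)%R by ring. rewrite Rabs_mult.
    pose proof (cos_near c). pose proof (Rabs_pos x). rewrite <- (pow2_abs c) in H.
    assert (Rabs c ^ 2 <= Rabs x ^ 2)%R by (apply pow_incr; split; auto using Rabs_pos).
    replace (Rabs x ^ 3 / 2)%R with (Rabs x ^ 2 / 2 * Rabs x)%R by (simpl; field).
    apply Rmult_le_compat_r; lra.
Qed.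

Lemma exp_near x : (Rabs x <= 1 / 2 -> Rabs (exp x - 1 - x) <= 2 * x ^ 2)%R.
Proof.
  intros Hx. apply Rabs_le_between in Hx.
  pose proof (exp_ineq1_le x). pose proof (exp_ineq1_le (- x)). rewrite exp_Ropp in H0.
  pose proof (exp_pos x).
  assert (exp x <= / (1 - x))%R.
  { rewrite <- (Rinv_inv (exp x)). apply Rinv_le_contravar; lra. }
  assert (/ (1 - x) - 1 - x <= 2 * x ^ 2)%R.
  { replace (/ (1 - x) - 1 - x)%R with (x ^ 2 * / (1 - x))%R by (field; lra).
    rewrite Rmult_comm. apply Rmult_le_compat_r. apply pow2_ge_0.
    rewrite <- (Rinv_inv 2). apply Rinv_le_contravar; lra. }
  rewrite Rabs_pos_eq; lra.
Qed.

Lemma cexp_near k : (Cmod k <= 1 / 2)%R -> (Cmod (cexp k - 1 - k) <= 10 * Cmod k ^ 2)%R.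
Proof.
  intros Hk. pose proof (re_le_Cmod k) as Ha. pose proof (im_le_Cmod k) as Hb.
  eapply Rle_trans; [apply Cmod_le_abs|]. unfold cexp. destruct k as [a b]. cbn [Re Im fst snd] in *.
  unfold Cminus, Cplus, Copp; cbn [Re Im fst snd RtoC].
  set (m := Cmod (a, b)) in *.
  pose proof (exp_near a ltac:(lra)) as He. pose proof (cos_near b) as Hc. pose proof (sin_near b) as Hs.
  pose proof (sin_abs_le b) as Hs1.
  pose proof (Rabs_pos a). pose proof (Rabs_pos b).
  assert (Ha2 : (a ^ 2 <= m ^ 2)%R) by (rewrite <- pow2_abs; apply pow_incr; lra).
  assert (Hb2 : (b ^ 2 <= m ^ 2)%R) by (rewrite <- pow2_abs; apply pow_incr; lra).
  assert (Hab : (Rabs a * Rabs b <= m ^ 2)%R) by (simpl; rewrite Rmult_1_r; apply Rmult_le_compat; lra).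
  assert (Hb3 : (Rabs b ^ 3 / 2 <= m ^ 2)%R).
  { apply Rle_trans with (m ^ 2 * Rabs b)%R. rewrite <- pow2_abs in Hb2. simpl in *; nra. pose proof (pow2_ge_0 m); nra. }
  pose proof (COS_bound b) as Hcb.
  assert (R1 : (Rabs (exp a * cos b + - (1) + - a) <= 2 * m ^ 2 + m ^ 2)%R).
  { replace (exp a * cos b + - (1) + - a)%R with ((exp a - 1 - a) * cos b + (1 + a) * (cos b - 1))%R by ring.
    eapply Rle_trans; [apply Rabs_triang|]. rewrite !Rabs_mult.
    assert (Rabs (cos b) <= 1)%R by (apply Rabs_le; lra).
    assert (Rabs (1 + a) <= 2)%R by (apply Rabs_le; apply Rabs_le_between in Ha; lra).
    pose proof (Rabs_pos (exp a - 1 - a)). pose proof (Rabs_pos (cos b - 1)).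
    pose proof (Rabs_pos (cos b)). pose proof (Rabs_pos (1 + a)).
    assert (Rabs (exp a - 1 - a) * Rabs (cos b) <= (2 * m ^ 2) * 1)%R by (apply Rmult_le_compat; lra).
    assert (Rabs (1 + a) * Rabs (cos b - 1) <= 2 * (m ^ 2 / 2))%R by (apply Rmult_le_compat; lra).
    lra. }
  assert (R2 : (Rabs (exp a * sin b + - 0 + - b) <= 2 * m ^ 2 + m ^ 2)%R).
  { replace (exp a * sin b + - 0 + - b)%R with ((exp a - 1) * sin b + (sin b - b))%R by ring.
    eapply Rle_trans; [apply Rabs_triang|]. rewrite Rabs_mult.
    assert (Rabs (exp a - 1) <= 2 * Rabs a)%R.
    { replace (exp a - 1)%R with ((exp a - 1 - a) + a)%R by ring. eapply Rle_trans; [apply Rabs_triang|].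
      assert (2 * a ^ 2 <= Rabs a)%R. { rewrite <- pow2_abs. simpl. nra. } lra. }
    pose proof (Rabs_pos (exp a - 1)). pose proof (Rabs_pos (sin b)).
    assert (Rabs (exp a - 1) * Rabs (sin b) <= (2 * Rabs a) * Rabs b)%R by (apply Rmult_le_compat; lra).
    lra. }
  pose proof (pow2_ge_0 m). lra.
Qed.

Lemma cexp_add x y : cexp (x + y) = cexp x * cexp y.
Proof.
  destruct x as [a b], y as [c d]. unfold cexp, Cmult, Cplus; cbn [Re Im fst snd].
  rewrite exp_plus, cos_plus, sin_plus. apply injective_projections; cbn [fst snd]; ring.
Qed.

Lemma cexp_0 : cexp 0 = 1.
Proof. unfold cexp; cbn [Re Im fst snd RtoC]. rewrite exp_0, cos_0, sin_0. apply injective_projections; cbn [fst snd RtoC]; ring. Qed.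

Lemma Cmod_cexp z : Cmod (cexp z) = exp (Re z).
Proof.
  replace (cexp z) with (RtoC (exp (Re z)) * (cos (Im z), sin (Im z))).
  2:{ unfold cexp, Cmult, RtoC; cbn [fst snd]. apply injective_projections; cbn [fst snd]; ring. }
  rewrite Cmod_mult, Cmod_R, Rabs_pos_eq by (left; apply exp_pos).
  unfold Cmod; cbn [fst snd]. rewrite Rplus_comm, <- !Rsqr_pow2, sin2_cos2, sqrt_1. ring.
Qed.

Lemma cexp_neq0 z : cexp z <> 0.
Proof. apply Cmod_gt_0. rewrite Cmod_cexp. apply exp_pos. Qed.

Lemma cexp_pow z n : cexp z ^ n = cexp (RtoC (INR n) * z).
Proof.
  induction n. simpl. rewrite Cmult_0_l, cexp_0; auto.
  rewrite Cpow_S, IHn, <- cexp_add. f_equal. rewrite S_INR, RtoC_plus. ring.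
Qed.

Lemma cder_cexp z : cder cexp z (cexp z).
Proof.
  exists (Cmod (cexp z) * 10)%R, (1 / 2)%R. split. pose proof (Cmod_ge_0 (cexp z)); lra. split. lra.
  intros k Hk. rewrite cexp_add.
  replace (cexp z * cexp k - cexp z - k * cexp z) with (cexp z * (cexp k - 1 - k)) by ring.
  rewrite Cmod_mult, Rmult_assoc. apply Rmult_le_compat_l. apply Cmod_ge_0. now apply cexp_near.
Qed.

Lemma cder_cexp_scal s z : cder (fun x => cexp (s * x)) z (s * cexp (s * z)).
Proof.
  eapply cder_val; [|apply (cder_comp cexp (fun x => s * x) z (cexp (s * z)) (s * 1))].
  cbv beta; ring. apply cder_scal, cder_id. apply cder_cexp.
Qed.

Lemma cder_ev_exp a s z : disc a -> (Cmod (cexp (s * z)) < 1)%R ->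
  cder (fun x => ev a (cexp (s * x))) z (s * ev (Dq a) (cexp (s * z))).
Proof.
  intros Ha Hz. rewrite <- dev_Dq by auto.
  eapply cder_val; [|apply (cder_comp (ev a) (fun x => cexp (s * x)) z); [apply cder_cexp_scal|apply cder_ev; auto]].
  cbv beta; ring.
Qed.

(** * Partial fractions of 1/sin^2 and of the tangent *)

Definition inv2 (n : nat) : R := (/ (INR n + 1) ^ 2)%R.

Lemma inv2_pos n : (0 < inv2 n)%R.
Proof. apply Rinv_0_lt_compat, pow_lt. pose proof (pos_INR n); lra. Qed.

Lemma ex_series_inv2 : ex_series inv2.
Proof.
  apply ex_series_le_pos with (b := fun n => (2 * (/ (INR n + 1) - / (INR (S n) + 1)))%R).
  (* With t = n+1 >= 1, compare 1/t^2 with the telescoping term 2 (1/t - 1/(t+1)). *)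
  - intros n. split; [left; apply inv2_pos|]. unfold inv2. rewrite S_INR. pose proof (pos_INR n).
    set (t := (INR n + 1)%R). assert (1 <= t)%R by (unfold t; lra).
    replace (2 * (/ t - / (t + 1)))%R with (/ t ^ 2 * (2 * t / (t + 1)))%R by (field; lra).
    rewrite <- (Rmult_1_r (/ t ^ 2)) at 1. apply Rmult_le_compat_l. left; apply Rinv_0_lt_compat, pow_lt; lra.
    apply Rmult_le_reg_r with (t + 1)%R. lra. field_simplify; lra.
  - apply (ex_series_scal_R 2 (fun n => (/ (INR n + 1) - / (INR (S n) + 1))%R)). exists 1%R. apply is_series_Reals. intros eps He.
    destruct (archimed_cor1 eps He) as [N [HN HN0]]. exists N. intros n Hn.
    assert (E : sum_f_R0 (fun i => (/ (INR i + 1) - / (INR (S i) + 1))%R) n = (1 - / (INR (S n) + 1))%R).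
    { clear. induction n as [|n IHn]; [simpl; field|]. cbn [sum_f_R0]. rewrite IHn. ring. }
    rewrite E. unfold Rdist. replace (1 - / (INR (S n) + 1) - 1)%R with (- / (INR (S n) + 1))%R by ring.
    assert (0 < INR N)%R by (apply lt_0_INR; lia). assert (INR N <= INR n)%R by (apply le_INR; lia).
    rewrite Rabs_Ropp, S_INR, Rabs_pos_eq by (left; apply Rinv_0_lt_compat; lra).
    eapply Rle_lt_trans; [|exact HN]. apply Rinv_le_contravar; lra.
Qed.

(** Pairing n with -n-1 is the reflection about -1/2. It counts every integer once and matches the
    pairs of half-integers n+1/2 and -(n+1/2) used for the tangent. *)
Definition Zsum (F : Z -> C) : C := Csum (fun n => F (Z.of_nat n) + F (- Z.of_nat n - 1)%Z).

Definition bndZ (F : Z -> C) : Prop :=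
  exists K, (0 <= K)%R /\ forall n : Z, (Cmod (F n) <= K / (1 + Rabs (IZR n)) ^ 2)%R.

Lemma bndZ_nat F : bndZ F -> absc (fun n => F (Z.of_nat n)) /\ absc (fun n => F (- Z.of_nat n - 1)%Z).
Proof.
  intros (K & HK & H).
  assert (P : forall n g, (INR n <= Rabs (IZR g))%R -> (Cmod (F g) <= K * inv2 n)%R).
  { intros n g Hg. eapply Rle_trans; [apply H|]. unfold inv2. apply Rmult_le_compat_l; auto.
    pose proof (pos_INR n). apply Rinv_le_contravar. apply pow_lt; lra. apply pow_incr; lra. }
  split; (apply absc_le with (b := fun n => (K * inv2 n)%R); [|apply ex_series_scal_R, ex_series_inv2]); intros n; apply P.
  - rewrite <- INR_IZR_INZ, Rabs_pos_eq by apply pos_INR. lra.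
  - rewrite minus_IZR, opp_IZR, <- INR_IZR_INZ. pose proof (pos_INR n). rewrite Rabs_left by lra. lra.
Qed.

Lemma Zsum_ext F G : (forall n, F n = G n) -> Zsum F = Zsum G.
Proof. intros H. apply Csum_ext. intros n. now rewrite !H. Qed.

Lemma Zsum_scal c F : bndZ F -> Zsum (fun n => c * F n) = c * Zsum F.
Proof.
  intros H. destruct (bndZ_nat F H). unfold Zsum. rewrite <- Csum_scal by now apply absc_plus.
  apply Csum_ext. intros; ring.
Qed.

Lemma Zsum_shift F : bndZ F -> Zsum (fun n => F (n + 1)%Z) = Zsum F.
Proof.
  intros H. destruct (bndZ_nat F H) as [H1 H2]. unfold Zsum.
  rewrite (Csum_plus _ _ H1 H2), (Csum_incr _ H1).
  assert (E1 : absc (fun n => F (Z.of_nat n + 1)%Z)).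
  { apply absc_ext with (2 := absc_shift _ 1 H1). intros; f_equal; lia. }
  assert (E2 : absc (fun n => F (- Z.of_nat n)%Z)).
  { apply absc_incr. apply absc_ext with (2 := H2). intros; f_equal; lia. }
  rewrite (Csum_ext _ (fun n => F (Z.of_nat n + 1)%Z + F (- Z.of_nat n)%Z)).
  2:{ intros n. do 2 f_equal; lia. }
  rewrite (Csum_plus _ _ E1 E2), (Csum_incr _ E2).
  rewrite (Csum_ext (fun n => F (- Z.of_nat (S n))%Z) (fun n => F (- Z.of_nat n - 1)%Z)) by (intros; f_equal; lia).
  rewrite (Csum_ext (fun n => F (Z.of_nat (S n))%Z) (fun n => F (Z.of_nat n + 1)%Z)) by (intros; f_equal; lia).
  change (- Z.of_nat 0)%Z with 0%Z. change (Z.of_nat 0) with 0%Z. ring.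
Qed.

(** The same sum folded about 0, which isolates the term that carries the pole at 0. *)
Lemma Zsum_fold0 F : bndZ F ->
  Zsum F = F 0%Z + Csum (fun n => F (Z.of_nat n + 1)%Z + F (- Z.of_nat n - 1)%Z).
Proof.
  intros H. destruct (bndZ_nat F H) as [H1 H2]. unfold Zsum.
  rewrite (Csum_plus _ _ H1 H2), (Csum_incr _ H1).
  rewrite (Csum_ext (fun n => F (Z.of_nat (S n))%Z) (fun n => F (Z.of_nat n + 1)%Z)) by (intros; f_equal; lia).
  rewrite Csum_plus; auto. change (Z.of_nat 0) with 0%Z. ring.
  apply absc_ext with (2 := absc_shift _ 1 H1). intros; f_equal; lia.
Qed.

Lemma Csum_even_odd a : absc a -> absc (fun n => a (2 * n)%nat) -> absc (fun n => a (2 * n + 1)%nat) ->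
  Csum a = Csum (fun n => a (2 * n)%nat) + Csum (fun n => a (2 * n + 1)%nat).
Proof.
  intros H H0 H1. rewrite <- Csum_plus by auto. symmetry.
  apply Csum_unique. now apply absc_plus. intros eps He.
  destruct (Csum_lim a H eps He) as [N HN]. exists N. intros n Hn.
  replace (csum (fun n => a (2 * n)%nat + a (2 * n + 1)%nat) n) with (csum a (2 * n)).
  left; apply HN; lia.
  clear. induction n; auto. replace (2 * S n)%nat with (S (S (2 * n))) by lia. cbn [csum]. rewrite IHn.
  replace (2 * n + 1)%nat with (S (2 * n)) by lia. ring.
Qed.

Lemma bndZ_lin F a b : bndZ F -> (1 <= a)%Z -> (0 <= b < a)%Z -> bndZ (fun n => F (a * n + b)%Z).
Proof.
  intros (K & HK & H) Ha Hb. exists (4 * K)%R. split. lra. intros n. eapply Rle_trans; [apply H|].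
  apply Rle_trans with (K / ((1 + Rabs (IZR n)) / 2) ^ 2)%R.
  - apply Rmult_le_compat_l; auto. pose proof (Rabs_pos (IZR n)). apply Rinv_le_contravar. apply pow_lt; lra.
    apply pow_incr. split. lra. rewrite <- !abs_IZR.
    assert (IZR (1 + Z.abs n) <= IZR (2 + 2 * Z.abs (a * n + b)))%R by (apply IZR_le; nia).
    rewrite !plus_IZR, mult_IZR in H1. lra.
  - right. field. pose proof (Rabs_pos (IZR n)); lra.
Qed.

Lemma Zsum_even_odd F : bndZ F -> Zsum F = Zsum (fun n => F (2 * n + 0)%Z) + Zsum (fun n => F (2 * n + 1)%Z).
Proof.
  intros H. destruct (bndZ_nat F H) as [H1 H2].
  destruct (bndZ_nat _ (bndZ_lin F 2 0 H ltac:(lia) ltac:(lia))) as [H3 H4].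
  destruct (bndZ_nat _ (bndZ_lin F 2 1 H ltac:(lia) ltac:(lia))) as [H5 H6].
  unfold Zsum. rewrite !Csum_plus by auto.
  rewrite (Csum_even_odd _ H1), (Csum_even_odd _ H2).
  - rewrite (Csum_ext (fun n => F (Z.of_nat (2 * n))) (fun n => F (2 * Z.of_nat n + 0)%Z)) by (intros; f_equal; lia).
    rewrite (Csum_ext (fun n => F (Z.of_nat (2 * n + 1))) (fun n => F (2 * Z.of_nat n + 1)%Z)) by (intros; f_equal; lia).
    rewrite (Csum_ext (fun n => F (- Z.of_nat (2 * n) - 1)%Z) (fun n => F (2 * (- Z.of_nat n - 1) + 1)%Z)) by (intros; f_equal; lia).
    rewrite (Csum_ext (fun n => F (- Z.of_nat (2 * n + 1) - 1)%Z) (fun n => F (2 * (- Z.of_nat n - 1) + 0)%Z)) by (intros; f_equal; lia).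
    ring.
  - apply absc_ext with (2 := H6). intros; f_equal; lia.
  - apply absc_ext with (2 := H4). intros; f_equal; lia.
  - apply absc_ext with (2 := H3). intros; f_equal; lia.
  - apply absc_ext with (2 := H5). intros; f_equal; lia.
Qed.

(** A positive distance to the integers, stronger in form than avoiding each of them: the uniform d
    feeds the quadratic decay in [nonint_bndZ]. *)
Definition nonint (x : C) : Prop :=
  exists d, (0 < d)%R /\ forall n : Z, (d <= Cmod (x + RtoC (IZR n)))%R.

Lemma nonint_neq0 x n : nonint x -> x + RtoC (IZR n) <> 0.
Proof. intros (d & Hd & H) E. specialize (H n). rewrite E, Cmod_0 in H. lra. Qed.

Lemma nonint_im x : Im x <> 0%R -> nonint x.
Proof.
  intros H. exists (Rabs (Im x)). split. now apply Rabs_pos_lt. intros n.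
  replace (Im x) with (Im (x + RtoC (IZR n))) by (destruct x; simpl; ring). apply im_le_Cmod.
Qed.

Lemma nonint_shift x n : nonint x -> nonint (x + RtoC (IZR n)).
Proof.
  intros (d & Hd & H). exists d. split; auto. intros m. specialize (H (n + m)%Z).
  rewrite plus_IZR, RtoC_plus, Cplus_assoc in H. exact H.
Qed.

Lemma nonint_half x : nonint x -> nonint (x / 2).
Proof.
  intros (d & Hd & H). exists (d / 2)%R. split. lra. intros n. specialize (H (2 * n)%Z).
  replace (x + RtoC (IZR (2 * n))) with (2 * (x / 2 + RtoC (IZR n))) in H by (rewrite mult_IZR, RtoC_mult; field).
  rewrite Cmod_mult, Cmod_R, Rabs_pos_eq in H by lra. lra.
Qed.

Lemma nonint_bound x : nonint x -> exists d, (0 < d)%R /\ forall n : Z, (d * (1 + Rabs (IZR n)) <= Cmod (x + RtoC (IZR n)))%R.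
Proof.
  intros (d & Hd & H). pose proof (Cmod_ge_0 x).
  assert (Hp : (0 < 1 + (Cmod x + 1) / d)%R).
  { assert (0 <= (Cmod x + 1) / d)%R by (apply Rmult_le_pos; [lra|left; now apply Rinv_0_lt_compat]). lra. }
  exists (/ (1 + (Cmod x + 1) / d))%R. split. now apply Rinv_0_lt_compat. intros n.
  specialize (H n). set (c := Cmod (x + RtoC (IZR n))) in *.
  assert (Rabs (IZR n) <= c + Cmod x)%R.
  { rewrite <- Cmod_R. replace (RtoC (IZR n)) with ((x + RtoC (IZR n)) + - x) by ring.
    eapply Rle_trans; [apply Cmod_triangle|]. rewrite Cmod_opp. unfold c; lra. }
  apply Rmult_le_reg_l with (1 + (Cmod x + 1) / d)%R; auto. rewrite <- Rmult_assoc, Rinv_r by lra.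
  assert (1 <= c / d)%R by (apply Rmult_le_reg_r with d; auto; field_simplify; lra).
  replace ((1 + (Cmod x + 1) / d) * c)%R with (c + (Cmod x + 1) * (c / d))%R by (field; lra).
  assert ((Cmod x + 1) * 1 <= (Cmod x + 1) * (c / d))%R by (apply Rmult_le_compat_l; lra). lra.
Qed.

Lemma nonint_bndZ x : nonint x -> bndZ (fun n => / (x + RtoC (IZR n)) ^ 2).
Proof.
  intros Hx. destruct (nonint_bound x Hx) as (d & Hd & H).
  exists (/ d ^ 2)%R. assert (Hd2 : (0 < d ^ 2)%R) by now apply pow_lt.
  split. left; now apply Rinv_0_lt_compat. intros n.
  pose proof (Rabs_pos (IZR n)).
  rewrite Cmod_inv by (apply Cpow_nz, nonint_neq0; auto). rewrite Cmod_pow.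
  unfold Rdiv. rewrite <- Rinv_mult, <- Rpow_mult_distr. apply Rinv_le_contravar.
  apply pow_lt, Rmult_lt_0_compat; lra. apply pow_incr. split; auto. apply Rmult_le_pos; lra.
Qed.

(** This is pi^2/sin^2(pi x), as [hsum_ecot] will show in exponential form. *)
Definition hsum (x : C) : C := Zsum (fun n => / (x + RtoC (IZR n)) ^ 2).

Lemma hsum_periodic x : nonint x -> hsum (x + 1) = hsum x.
Proof.
  intros Hx. unfold hsum. rewrite <- (Zsum_shift (fun n => / (x + RtoC (IZR n)) ^ 2)) by now apply nonint_bndZ.
  apply Zsum_ext. intros n. rewrite plus_IZR, RtoC_plus. do 2 f_equal. ring.
Qed.

(** Even and odd n separate into the sums at x/2 and (x+1)/2. The closed form satisfies the same
    duplication formula, so it passes to the difference of the two (Herglotz's trick). *)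
Lemma hsum_dup x : nonint x -> 4 * hsum x = hsum (x / 2) + hsum ((x + 1) / 2).
Proof.
  intros Hx. unfold hsum at 1. rewrite <- Zsum_scal by now apply nonint_bndZ.
  assert (B : bndZ (fun n => 4 * / (x + RtoC (IZR n)) ^ 2)).
  { destruct (nonint_bndZ x Hx) as (K & HK & H). exists (4 * K)%R. split. lra. intros n.
    rewrite Cmod_mult, Cmod_R, Rabs_pos_eq by lra. unfold Rdiv. rewrite Rmult_assoc. apply Rmult_le_compat_l. lra. apply H. }
  rewrite (Zsum_even_odd _ B). unfold hsum. f_equal; apply Zsum_ext; intros n.
  - pose proof (nonint_neq0 x (2 * n)%Z Hx) as h1. pose proof (nonint_neq0 _ n (nonint_half x Hx)) as h2.
    rewrite Z.add_0_r. rewrite mult_IZR, RtoC_mult in *. field. intros E; apply h1; rewrite <- E; ring.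
  - pose proof (nonint_neq0 x (2 * n + 1)%Z Hx) as h1. rewrite plus_IZR, mult_IZR, RtoC_plus, RtoC_mult in *.
    field. intros E; apply h1; rewrite <- E; ring.
Qed.

Definition tpi : C := 2 * PI * Ci.

(** pi^2/sin^2(pi x) written in terms of e^{2 pi i x}. *)
Definition ecot (x : C) : C := - (4 * PI ^ 2) * (cexp (tpi * x) / (1 - cexp (tpi * x)) ^ 2).

Lemma cexp_PI : cexp (PI * Ci) = - (1).
Proof.
  unfold cexp, Cmult, Copp, Ci, RtoC; cbn [Re Im fst snd].
  replace (PI * 0 - 0 * 1)%R with 0%R by ring. replace (PI * 1 + 0 * 0)%R with PI by ring.
  rewrite exp_0, cos_PI, sin_PI. apply injective_projections; cbn [fst snd]; ring.
Qed.

Lemma cexp_tpi : cexp tpi = 1.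
Proof.
  unfold tpi. replace (2 * PI * Ci) with (PI * Ci + PI * Ci) by ring. rewrite cexp_add, cexp_PI. ring.
Qed.

Lemma tpi_re_im x : Re (tpi * x) = (- (2 * PI * Im x))%R /\ Im (tpi * x) = (2 * PI * Re x)%R.
Proof. destruct x as [a b]. unfold tpi, Cmult, Ci, RtoC; simpl. split; ring. Qed.

Lemma cexp_eq_1 x : cexp (tpi * x) = 1 -> exists n : Z, x = RtoC (IZR n).
Proof.
  intros H. pose proof (Cmod_cexp (tpi * x)) as Hm. rewrite H, Cmod_1 in Hm.
  destruct (tpi_re_im x) as [E1 E2]. rewrite E1 in Hm. pose proof PI_RGT_0.
  rewrite <- exp_0 in Hm. apply exp_inv in Hm.
  assert (Hi : Im x = 0%R) by nra.
  unfold cexp in H. rewrite E1, E2, Hi in H. replace (- (2 * PI * 0))%R with 0%R in H by ring.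
  rewrite exp_0, !Rmult_1_l in H. assert (Hc : cos (2 * PI * Re x) = 1%R) by (apply (f_equal fst) in H; exact H).
  replace (2 * PI * Re x)%R with (2 * (PI * Re x))%R in Hc by ring. rewrite cos_2a_sin in Hc.
  assert (Hs : sin (PI * Re x) = 0%R) by nra.
  apply sin_eq_0_0 in Hs. destruct Hs as [k Hk]. exists k.
  assert (Re x = IZR k) by nra. destruct x as [a b]; simpl in *. subst. reflexivity.
Qed.

Lemma nonint_exp x : nonint x -> 1 - cexp (tpi * x) <> 0.
Proof.
  intros Hx E. destruct (cexp_eq_1 x) as [n Hn]. symmetry; now apply Ceq_minus.
  apply (nonint_neq0 x (- n)%Z Hx). rewrite Hn, opp_IZR, RtoC_opp. ring.
Qed.

Lemma ecot_periodic x : ecot (x + 1) = ecot x.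
Proof.
  unfold ecot. replace (tpi * (x + 1)) with (tpi * x + tpi) by ring. rewrite cexp_add, cexp_tpi, Cmult_1_r. auto.
Qed.

Lemma ecot_dup x : nonint x -> 4 * ecot x = ecot (x / 2) + ecot ((x + 1) / 2).
Proof.
  intros Hx. pose proof (nonint_exp x Hx) as H. unfold ecot.
  replace (tpi * ((x + 1) / 2)) with (tpi * (x / 2) + PI * Ci) by (unfold tpi; field).
  replace (tpi * x) with (tpi * (x / 2) + tpi * (x / 2)) in * by field.
  rewrite !cexp_add, cexp_PI in *. set (r := cexp (tpi * (x / 2))) in *.
  assert (1 - r <> 0) by (intros E; apply H; replace (1 - r * r) with ((1 - r) * (1 + r)) by ring; rewrite E; ring).
  assert (1 + r <> 0) by (intros E; apply H; replace (1 - r * r) with ((1 - r) * (1 + r)) by ring; rewrite E; ring).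
  replace (1 - r * - (1)) with (1 + r) by ring. field. auto.
Qed.

(** 2 sinh(u/2), convenient for estimates near the pole at u = 0. *)
Definition ssin (u : C) : C := cexp (u / 2) - cexp (- u / 2).

Lemma ecot_ssin x : ecot x = - (4 * PI ^ 2) / ssin (tpi * x) ^ 2.
Proof.
  unfold ecot, ssin. set (u := tpi * x).
  assert (E : cexp u = cexp (u / 2) * cexp (u / 2)) by (rewrite <- cexp_add; f_equal; field).
  assert (E' : cexp (u / 2) * cexp (- u / 2) = 1) by (rewrite <- cexp_add, <- cexp_0; f_equal; field).
  pose proof (cexp_neq0 (u / 2)) as H0. rewrite E.
  assert (E2 : cexp (- u / 2) = / cexp (u / 2)).
  { replace (cexp (- u / 2)) with (/ cexp (u / 2) * (cexp (u / 2) * cexp (- u / 2))) by (field; auto). rewrite E'. ring. }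
  rewrite E2. set (r := cexp (u / 2)) in *.
  replace (r - / r) with (- ((1 - r * r) / r)) by (field; auto).
  (* At integers x both sides are 0, since the inverse of 0 evaluates to 0. *)
  destruct (Ceq_dec (1 - r * r) 0) as [Z|Z].
  - rewrite Z. replace (- (0 / r)) with (RtoC 0) by (field; auto). unfold Cdiv. replace (0 ^ 2) with (RtoC 0) by (simpl; ring).
    assert (I0 : / 0 = 0) by (unfold Cinv, RtoC; simpl; apply injective_projections; simpl; unfold Rdiv; ring). rewrite I0. ring.
  - field. split; auto.
Qed.

Lemma sin_lower b : (Rabs b <= PI / 2 -> Rabs b / 4 <= Rabs (sin b))%R.
Proof.
  intros Hb.
  assert (P : forall y, (0 <= y <= PI / 2 -> y / 4 <= sin y)%R).
  { intros y Hy. pose proof PI_4.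
    assert (Q : forall y, (0 <= y <= 1 -> y / 2 <= sin y)%R).
    { intros t Ht.
      pose proof (sin_near t) as S. rewrite (Rabs_pos_eq t) in S by lra. apply Rabs_le_between in S.
      assert (t ^ 3 <= t)%R by (assert (t * t <= 1)%R by nra; simpl; nra). lra. }
    destruct (Rle_lt_dec y 1) as [h|h]. specialize (Q y ltac:(lra)); lra.
    pose proof (Q 1%R ltac:(lra)). assert (sin 1 <= sin y)%R by (apply sin_incr_1; lra). lra. }
  destruct (Rle_lt_dec 0 b) as [h|h].
  - rewrite Rabs_pos_eq in * by lra. eapply Rle_trans; [apply P; lra|]. apply Rle_abs.
  - rewrite (Rabs_left b) in * by lra. rewrite <- (Rabs_Ropp (sin b)), <- sin_neg. eapply Rle_trans; [apply P; lra|]. apply Rle_abs.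
Qed.

(** With u/2 = a + i b, |2 sinh(u/2)|^2 = (2 sinh a)^2 + 4 sin^2 b; both terms grow at least
    linearly as long as |b| <= pi/2. *)
Lemma ssin_lower u : (Rabs (Im u) <= PI -> Cmod u <= 8 * Cmod (ssin u))%R.
Proof.
  intros H. unfold ssin.
  assert (E : cexp (u / 2) - cexp (- u / 2) = (((exp (Re u / 2) - exp (- (Re u / 2))) * cos (Im u / 2))%R, ((exp (Re u / 2) + exp (- (Re u / 2))) * sin (Im u / 2))%R)).
  { destruct u as [a b].
    replace ((a, b) / 2) with ((a / 2)%R, (b / 2)%R) by (unfold Cdiv, Cmult, Cinv, RtoC; apply injective_projections; simpl; field).
    replace (- (a, b) / 2) with ((- (a / 2))%R, (- (b / 2))%R) by (unfold Cdiv, Cmult, Cinv, Copp, RtoC; apply injective_projections; simpl; field).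
    unfold cexp; cbn [Re Im fst snd]. rewrite cos_neg, sin_neg. apply injective_projections; simpl; ring. }
  rewrite E. clear E. set (a := (Re u / 2)%R). set (b := (Im u / 2)%R).
  assert (Hb : (Rabs b <= PI / 2)%R) by (unfold b, Rdiv; rewrite Rabs_mult, (Rabs_pos_eq (/ 2)) by lra; lra).
  pose proof (sin_lower b Hb) as Hs.
  assert (Ha : (Rabs a <= Rabs (exp a - exp (- a)))%R).
  { destruct (Rle_lt_dec 0 a) as [h|h].
    - rewrite (Rabs_pos_eq a) by lra. pose proof (exp_ineq1_le a). assert (exp (- a) <= 1)%R by (rewrite <- exp_0; destruct h as [h|<-]; [left; apply exp_increasing; lra|rewrite Ropp_0; lra]).
      eapply Rle_trans; [|apply Rle_abs]. lra.
    - rewrite (Rabs_left a) by lra. pose proof (exp_ineq1_le (- a)). assert (exp a <= 1)%R by (rewrite <- exp_0; left; apply exp_increasing; lra).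
      rewrite <- Rabs_Ropp. eapply Rle_trans; [|apply Rle_abs]. lra. }
  assert (Hsum : (2 <= exp a + exp (- a))%R) by (pose proof (exp_ineq1_le a); pose proof (exp_ineq1_le (- a)); lra).
  set (z := ((exp a - exp (- a)) * cos b, (exp a + exp (- a)) * sin b)%R).
  assert (Hz : ((exp a - exp (- a)) ^ 2 + 4 * sin b ^ 2 <= Cmod z ^ 2)%R).
  { rewrite Cmod2_alt. unfold z; cbn [Re Im fst snd]. pose proof (sin2_cos2 b) as Hsc. unfold Rsqr in Hsc.
    assert (Hp : (exp a * exp (- a) = 1)%R) by (rewrite <- exp_plus, Rplus_opp_r; apply exp_0).
    replace (((exp a - exp (- a)) * cos b) ^ 2 + ((exp a + exp (- a)) * sin b) ^ 2)%R with
      ((exp a - exp (- a)) ^ 2 * (sin b * sin b + cos b * cos b) + 4 * (exp a * exp (- a)) * sin b ^ 2)%R by ring.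
    rewrite Hsc, Hp. lra. }
  assert (H1 : (Rabs a <= Cmod z)%R).
  { eapply Rle_trans; [exact Ha|].
    apply Rsqr_incr_0_var. 2: apply Cmod_ge_0. rewrite !Rsqr_pow2, pow2_abs. pose proof (pow2_ge_0 (sin b)). lra. }
  assert (H2 : (2 * Rabs (sin b) <= Cmod z)%R).
  { apply Rsqr_incr_0_var. 2: apply Cmod_ge_0. rewrite !Rsqr_pow2, Rpow_mult_distr, pow2_abs. pose proof (pow2_ge_0 (exp a - exp (- a))). lra. }
  apply Rle_trans with (8 * Cmod z)%R; [|right; reflexivity]. eapply Rle_trans; [apply Cmod_le_abs|].
  replace (Re u) with (2 * a)%R by (unfold a; field). replace (Im u) with (2 * b)%R by (unfold b; field).
  rewrite !Rabs_mult, (Rabs_pos_eq 2) by lra. pose proof (Cmod_ge_0 z). lra.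
Qed.

Lemma ssin_near u : (Cmod u <= 1 -> Cmod (ssin u - u) <= 5 * Cmod u ^ 3)%R.
Proof.
  intros Hu.
  assert (Dh : forall s z, cder (fun x => cexp (s * x)) z (s * cexp (s * z))) by apply cder_cexp_scal.
  pose proof (cder_MVT (fun x => cexp (/ 2 * x) - cexp (- / 2 * x) - x)
    (fun t => / 2 * cexp (/ 2 * (RtoC t * u)) - - / 2 * cexp (- / 2 * (RtoC t * u)) - 1) 0 u (5 / 2 * Cmod u ^ 2)%R) as H.
  replace (ssin u - u) with ((cexp (/ 2 * u) - cexp (- / 2 * u) - u) - (cexp (/ 2 * 0) - cexp (- / 2 * 0) - 0)).
  2:{ unfold ssin. rewrite !Cmult_0_r, !cexp_0. replace (u / 2) with (/ 2 * u) by (field). replace (- u / 2) with (- / 2 * u) by field. ring. }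
  eapply Rle_trans; [apply H|].
  - intros t Ht. replace (0 + RtoC t * (u - 0)) with (RtoC t * u) by ring. split.
    + apply cder_minus; [apply cder_minus; apply Dh|apply cder_id].
    + set (k := / 2 * (RtoC t * u)). replace (- / 2 * (RtoC t * u)) with (- k) by (unfold k; ring).
      assert (Hk : (Cmod k <= Cmod u / 2)%R).
      { unfold k. rewrite !Cmod_mult, Cmod_inv, !Cmod_R, !Rabs_pos_eq by (try lra; apply RtoC_INR_neq0 with (n := 1%nat)).
        pose proof (Cmod_ge_0 u). nra. }
      pose proof (cexp_near k ltac:(lra)) as N1. pose proof (cexp_near (- k) ltac:(rewrite Cmod_opp; lra)) as N2.
      rewrite Cmod_opp in N2.
      (* The linear terms of the exponentials at k and -k cancel, so the derivative is quadratic in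
         u and its integral cubic. *)
      replace (/ 2 * cexp k - - / 2 * cexp (- k) - 1) with (/ 2 * ((cexp k - 1 - k) + (cexp (- k) - 1 - - k))) by field.
      rewrite Cmod_mult, Cmod_inv, Cmod_R, Rabs_pos_eq by (try lra; apply RtoC_INR_neq0 with (n := 1%nat)).
      pose proof (Cmod_triangle (cexp k - 1 - k) (cexp (- k) - 1 - - k)).
      assert (Cmod k ^ 2 <= (Cmod u / 2) ^ 2)%R by (apply pow_incr; split; auto; apply Cmod_ge_0). simpl in *. lra.
  - replace (u - 0) with u by ring. right. field.
Qed.

(** For |u| <= 1 the numerator is at most 5|u|^3 times 7|u| and |u|^2 <= 64 |ssin u|^2, whence 35 *
    64 = 2240. For |u| > 1 the two terms are at most 64 and 1. The constant 3000 covers both. *)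
Lemma ssin_inv (u : C) : u <> 0 -> (Rabs (Im u) <= PI)%R -> (Cmod (/ ssin u ^ 2 - / u ^ 2) <= 3000)%R.
Proof.
  intros Hu Hi. assert (H0 : (0 < Cmod u)%R) by now apply Cmod_gt_0.
  pose proof (ssin_lower u Hi) as HL. assert (Hs0 : ssin u <> 0) by (apply Cmod_gt_0; lra).
  destruct (Rle_lt_dec (Cmod u) 1) as [h|h].
  - pose proof (ssin_near u h) as HN.
    replace (/ ssin u ^ 2 - / u ^ 2) with (- ((ssin u - u) * (ssin u + u) / (ssin u ^ 2 * u ^ 2))) by (field; auto).
    rewrite Cmod_opp, Cmod_div by (apply Cmult_neq_0; apply Cpow_nz; auto). rewrite !Cmod_mult, !Cmod_pow.
    set (s := Cmod (ssin u)) in *. set (v := Cmod u) in *.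
    assert (Hsu : (Cmod (ssin u + u) <= 7 * v)%R).
    { replace (ssin u + u) with ((ssin u - u) + 2 * u) by ring. eapply Rle_trans; [apply Cmod_triangle|].
      rewrite Cmod_mult, Cmod_R, Rabs_pos_eq by lra. fold v.
      assert (v ^ 3 <= v)%R by (assert (v ^ 2 <= 1)%R by (rewrite <- (pow1 2); apply pow_incr; lra); simpl in *; nra). lra. }
    assert (Hden : (0 < s ^ 2 * v ^ 2)%R) by (apply Rmult_lt_0_compat; apply pow_lt; lra).
    apply Rmult_le_reg_r with (s ^ 2 * v ^ 2)%R; auto.
    unfold Rdiv. rewrite Rmult_assoc, Rinv_l, Rmult_1_r by lra.
    apply Rle_trans with ((5 * v ^ 3) * (7 * v))%R. apply Rmult_le_compat; auto using Cmod_ge_0.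
    assert (v ^ 2 <= 64 * s ^ 2)%R by (replace (64 * s ^ 2)%R with ((8 * s) ^ 2)%R by ring; apply pow_incr; lra).
    replace (5 * v ^ 3 * (7 * v))%R with (35 * (v ^ 2 * v ^ 2))%R by ring.
    assert (v ^ 2 * v ^ 2 <= 64 * s ^ 2 * v ^ 2)%R by (apply Rmult_le_compat_r; auto; apply pow2_ge_0).
    assert (0 <= s ^ 2 * v ^ 2)%R by lra. nra.
  - unfold Cminus. eapply Rle_trans; [apply Cmod_triangle|]. rewrite Cmod_opp, !Cmod_inv, !Cmod_pow by (apply Cpow_nz; auto).
    assert (/ Cmod u ^ 2 <= 1)%R. { rewrite <- Rinv_1. apply Rinv_le_contravar. lra. rewrite <- (pow1 2). apply pow_incr; lra. }
    assert (/ Cmod (ssin u) ^ 2 <= 64)%R. { rewrite <- (Rinv_inv 64). apply Rinv_le_contravar. lra.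
      apply Rle_trans with ((1 / 8) ^ 2)%R. lra. apply pow_incr; lra. }
    lra.
Qed.

Lemma Cmod_box_lower x n : (Rabs (Re x) <= 1 / 2)%R -> (Rabs (IZR n) - 1 / 2 <= Cmod (x + RtoC (IZR n)))%R.
Proof.
  intros H. eapply Rle_trans; [|apply re_le_Cmod].
  replace (Re (x + RtoC (IZR n))) with (Re x + IZR n)%R by reflexivity.
  revert H; unfold Rabs; repeat destruct Rcase_abs; lra.
Qed.

(** [hsum] and [ecot] have the same principal part 1/x^2 at 0. Removing it from each bounds their
    difference on the whole strip, the starting point of [hdiff_box_0]. *)
Lemma hsum_box : exists K, (0 <= K)%R /\ forall x, nonint x -> (Rabs (Re x) <= 1 / 2)%R ->
  (Cmod (hsum x - / x ^ 2) <= K)%R.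
Proof.
  exists (Series (fun n => 8 * inv2 n)%R).
  assert (E : ex_series (fun n => 8 * inv2 n)%R) by (apply ex_series_scal_R, ex_series_inv2).
  split. apply Series_pos; auto. intros n; pose proof (inv2_pos n); lra.
  intros x Hx Hr. unfold hsum. rewrite Zsum_fold0 by now apply nonint_bndZ.
  rewrite Cplus_0_r.
  match goal with |- (Cmod (?a + ?b - ?a) <= _)%R => replace (a + b - a) with b by ring end.
  apply Csum_bound; auto. intros n.
  assert (P : forall k, (INR n + 1 <= Rabs (IZR k))%R -> (Cmod (/ (x + RtoC (IZR k)) ^ 2) <= 4 * inv2 n)%R).
  { intros k Hk. pose proof (Cmod_box_lower x k Hr). pose proof (pos_INR n).
    rewrite Cmod_inv by (apply Cpow_nz, nonint_neq0; auto). rewrite Cmod_pow. unfold inv2.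
    replace (4 * / (INR n + 1) ^ 2)%R with (/ ((INR n + 1) / 2) ^ 2)%R by (field; lra).
    apply Rinv_le_contravar. apply pow_lt; lra. apply pow_incr; lra. }
  eapply Rle_trans; [apply Cmod_triangle|].
  assert (h1 := P (Z.of_nat n + 1)%Z). assert (h2 := P (- Z.of_nat n - 1)%Z).
  rewrite plus_IZR in h1. rewrite minus_IZR, opp_IZR in h2. rewrite <- INR_IZR_INZ in *.
  pose proof (pos_INR n). rewrite plus_IZR, minus_IZR, opp_IZR, <- INR_IZR_INZ.
  rewrite Rabs_pos_eq in h1 by lra. rewrite Rabs_left in h2 by lra.
  specialize (h1 ltac:(lra)). specialize (h2 ltac:(lra)). lra.
Qed.

Lemma ecot_box : exists K, (0 <= K)%R /\ forall x, nonint x -> (Rabs (Re x) <= 1 / 2)%R ->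
  (Cmod (ecot x - / x ^ 2) <= K)%R.
Proof.
  exists (4 * PI ^ 2 * 3000)%R. pose proof PI_RGT_0.
  split. assert (0 <= PI ^ 2)%R by apply pow2_ge_0. lra.
  intros x Hx Hr. pose proof (nonint_neq0 x 0 Hx) as Hx0. rewrite Cplus_0_r in Hx0.
  assert (HP : tpi <> 0).
  { unfold tpi. intros E. apply (f_equal Im) in E. unfold Cmult, Ci, RtoC in E; simpl in E. lra. }
  rewrite ecot_ssin.
  assert (Hu : (Rabs (Im (tpi * x)) <= PI)%R).
  { destruct (tpi_re_im x) as [_ ->]. rewrite !Rabs_mult, (Rabs_pos_eq 2), (Rabs_pos_eq PI) by lra. nra. }
  assert (Hu0 : tpi * x <> 0) by now apply Cmult_neq_0.
  pose proof (ssin_inv _ Hu0 Hu) as S. pose proof (ssin_lower _ Hu) as L.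
  assert (Hs0 : ssin (tpi * x) <> 0) by (apply Cmod_gt_0; apply Cmod_gt_0 in Hu0; lra).
  assert (E : - (4 * PI ^ 2) / ssin (tpi * x) ^ 2 - / x ^ 2 = - (4 * PI ^ 2) * (/ ssin (tpi * x) ^ 2 - / (tpi * x) ^ 2)).
  { assert (Ht : tpi ^ 2 = - (4 * PI ^ 2)).
    { unfold tpi. replace ((2 * PI * Ci) ^ 2) with (4 * PI ^ 2 * (Ci * Ci)) by ring.
      replace (Ci * Ci) with (- (1)) by (unfold Ci, Cmult, RtoC, Copp; simpl; apply injective_projections; simpl; ring). ring. }
    rewrite <- Ht. rewrite Cpow_mult_l. field. repeat split; auto. }
  rewrite E, Cmod_mult, Cmod_opp, Cmod_mult, Cmod_pow, !Cmod_R, (Rabs_pos_eq 4), (Rabs_pos_eq PI) by lra.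
  apply Rmult_le_compat_l; auto. assert (0 <= PI ^ 2)%R by apply pow2_ge_0. lra.
Qed.

Definition hdiff (x : C) : C := hsum x - ecot x.

Lemma hdiff_shift x n : nonint x -> hdiff (x + RtoC (IZR n)) = hdiff x.
Proof.
  assert (P : forall x, nonint x -> hdiff (x + 1) = hdiff x).
  { intros y Hy. unfold hdiff. now rewrite hsum_periodic, ecot_periodic. }
  assert (Q : forall (m : nat) x, nonint x -> hdiff (x + RtoC (INR m)) = hdiff x).
  { induction m; intros y Hy. now rewrite Cplus_0_r.
    rewrite S_INR, RtoC_plus, Cplus_assoc, P; auto. rewrite INR_IZR_INZ. now apply nonint_shift. }
  intros Hx. destruct (Z_le_gt_dec 0 n) as [h|h].
  - rewrite <- (Z2Nat.id n h), <- INR_IZR_INZ. now apply Q.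
  - rewrite <- (Q (Z.to_nat (- n)) (x + RtoC (IZR n))) by now apply nonint_shift.
    f_equal. rewrite INR_IZR_INZ, Z2Nat.id, opp_IZR, RtoC_opp by lia. ring.
Qed.

Lemma hdiff_dup x : nonint x -> 4 * hdiff x = hdiff (x / 2) + hdiff ((x + 1) / 2).
Proof.
  intros Hx. unfold hdiff.
  replace (4 * (hsum x - ecot x)) with (4 * hsum x - 4 * ecot x) by ring.
  rewrite hsum_dup, ecot_dup by auto. ring.
Qed.

Lemma nonint_half1 x : nonint x -> nonint ((x + 1) / 2).
Proof. intros Hx. apply nonint_half. now apply (nonint_shift x 1). Qed.

Lemma Re_half x : Re (x / 2) = (Re x / 2)%R.
Proof. destruct x as [a b]. unfold Cdiv, Cmult, Cinv, RtoC; simpl. field. Qed.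

(* hdiff is bounded on the strip |Re x| <= 1/2, and the duplication formula halves any such bound. *)
Lemma hdiff_box_0 x : nonint x -> (Rabs (Re x) <= 1 / 2)%R -> hdiff x = 0.
Proof.
  destruct hsum_box as (K1 & HK1 & H1). destruct ecot_box as (K2 & HK2 & H2).
  assert (P : forall j x, nonint x -> (Rabs (Re x) <= 1 / 2)%R -> (Cmod (hdiff x) <= (K1 + K2) * (1 / 2) ^ j)%R).
  { induction j; intros y Hy Hr.
    - simpl. unfold hdiff. pose proof (Cmod_triangle3 (hsum y) (/ y ^ 2) (ecot y)) as T.
      rewrite (Cmod_minus_sym (/ y ^ 2)) in T. specialize (H1 y Hy Hr). specialize (H2 y Hy Hr). lra.
    - assert (B1 : (Cmod (hdiff (y / 2)) <= (K1 + K2) * (1 / 2) ^ j)%R).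
      { apply IHj. now apply nonint_half. rewrite Re_half. unfold Rdiv. rewrite Rabs_mult, (Rabs_pos_eq (/ 2)) by lra. pose proof (Rabs_pos (Re y)). lra. }
      assert (B2 : (Cmod (hdiff ((y + 1) / 2)) <= (K1 + K2) * (1 / 2) ^ j)%R).
      { apply Rabs_le_between in Hr. destruct (Rle_lt_dec (Re y) 0) as [h|h].
        - apply IHj. now apply nonint_half1. rewrite Re_half. replace (Re (y + 1)) with (Re y + 1)%R by reflexivity. apply Rabs_le; lra.
        - rewrite <- (hdiff_shift _ (-1)) by now apply nonint_half1. apply IHj. now apply nonint_shift, nonint_half1.
          replace (Re ((y + 1) / 2 + RtoC (IZR (-1)))) with (Re ((y + 1) / 2) + -1)%R by reflexivity.
          rewrite Re_half. replace (Re (y + 1)) with (Re y + 1)%R by reflexivity. apply Rabs_le; lra. }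
      pose proof (hdiff_dup y Hy) as D. apply (f_equal Cmod) in D. rewrite Cmod_mult, Cmod_R, Rabs_pos_eq in D by lra.
      pose proof (Cmod_triangle (hdiff (y / 2)) (hdiff ((y + 1) / 2))). simpl pow. lra. }
  intros Hx Hr. apply Cmod_eq_0. apply Rle_antisym; [|apply Cmod_ge_0].
  apply le_epsilon. intros eps He. rewrite Rplus_0_l.
  destruct (pow_lt_1_zero (1 / 2) ltac:(rewrite Rabs_pos_eq; lra) (eps / (K1 + K2 + 1)) ltac:(apply Rdiv_lt_0_compat; lra)) as [N HN].
  specialize (HN N (Nat.le_refl _)). rewrite Rabs_pos_eq in HN by (apply pow_nonneg; lra).
  eapply Rle_trans; [apply (P N); auto|].
  pose proof (pow_nonneg (1 / 2) N ltac:(lra)). apply Rmult_le_of_div; lra.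
Qed.

Lemma hsum_ecot x : nonint x -> hsum x = ecot x.
Proof.
  intros Hx. apply Ceq_minus. fold (hdiff x).
  destruct (archimed (Re x - 1 / 2)) as [A1 A2]. set (k := up (Re x - 1 / 2)) in *.
  rewrite <- (hdiff_shift x (- k)) by auto. apply hdiff_box_0. now apply nonint_shift.
  replace (Re (x + RtoC (IZR (- k)))) with (Re x + IZR (- k))%R by reflexivity. rewrite opp_IZR.
  apply Rabs_le; lra.
Qed.

Lemma ev_geom q : (Cmod q < 1)%R -> ev (fun _ => 1) q = / (1 - q).
Proof.
  intros Hq. assert (H1 : 1 - q <> 0).
  { intros E. apply Ceq_minus in E. rewrite <- E, Cmod_1 in Hq. lra. }
  assert (E : ev (fun _ => 1) q = 1 + q * ev (fun _ => 1) q).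
  { unfold ev at 1. rewrite Csum_incr by (apply (ev_absc (fun _ => 1)); auto; apply disc_1).
    unfold ev. rewrite <- Csum_scal by (apply (ev_absc (fun _ => 1)); auto; apply disc_1).
    f_equal. simpl; ring. apply Csum_ext. intros; rewrite Cpow_S; ring. }
  set (F := ev (fun _ => 1) q) in *.
  replace F with ((F - q * F) / (1 - q)) by (field; auto).
  rewrite E at 1. field; auto.
Qed.

Lemma ev_Dgeom q : (Cmod q < 1)%R -> ev (Dq (fun _ => 1)) q = q / (1 - q) ^ 2.
Proof.
  intros Hq. assert (H1 : 1 - q <> 0).
  { intros E. apply Ceq_minus in E. rewrite <- E, Cmod_1 in Hq. lra. }
  pose proof disc_1 as G. pose proof (disc_Dq _ G) as GD.
  assert (E : ev (Dq (fun _ => 1)) q = q * (ev (Dq (fun _ => 1)) q + ev (fun _ => 1) q)).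
  { unfold ev at 1. rewrite Csum_incr by now apply ev_absc.
    rewrite <- ev_plus by auto. unfold ev. rewrite <- Csum_scal by (apply (ev_absc (fun n => Dq (fun _ => 1) n + 1)); auto; now apply disc_plus).
    replace (Dq (fun _ => 1) 0%nat * q ^ 0) with (RtoC 0) by (unfold Dq; simpl; ring). rewrite Cplus_0_l.
    apply Csum_ext. intros n. unfold Dq. rewrite S_INR, RtoC_plus, Cpow_S. ring. }
  rewrite ev_geom in E by auto. set (F := ev (Dq (fun _ => 1)) q) in *.
  replace F with ((F - q * F) / (1 - q)) by (field; auto).
  rewrite E at 1. field; auto.
Qed.

(** * Partial fractions of the tangent *)

Definition nhalf (n : nat) : C := RtoC (INR n) + / 2.

Definition eta1 (n : nat) (x : C) : C := / (nhalf n - x) - / (nhalf n + x).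
Definition eta2 (n : nat) (x : C) : C := / (nhalf n - x) ^ 2 + / (nhalf n + x) ^ 2.

(** The partial fraction expansion of pi tan(pi x); [eta2] is the derivative of [eta1], term by
    term. *)
Definition Htan (x : C) : C := Csum (fun n => eta1 n x).

Lemma nhalf_R n : nhalf n = RtoC (INR n + / 2).
Proof. unfold nhalf. rewrite RtoC_plus, RtoC_inv by lra. reflexivity. Qed.

(** If m is the modulus in question, then y <= m and n + 1/2 <= m + |R0|, so n + 1 <= m + (|R0| + 1)
    m/y. Uniformity in x is what differentiating [Htan] termwise requires. *)
Lemma half_lower y R0 : (0 < y)%R -> exists d, (0 < d)%R /\ forall x n, (y <= Rabs (Im x))%R -> (Cmod x <= R0)%R ->
  (d * (INR n + 1) <= Cmod (nhalf n - x))%R /\ (d * (INR n + 1) <= Cmod (nhalf n + x))%R.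
Proof.
  intros Hy.
  set (c := (1 + (Rabs R0 + 1) / y)%R).
  assert (Hc : (0 < c)%R). { unfold c. pose proof (Rabs_pos R0). assert (0 <= (Rabs R0 + 1) / y)%R by (apply Rmult_le_pos; [lra|left; now apply Rinv_0_lt_compat]). lra. }
  exists (/ c)%R. split. now apply Rinv_0_lt_compat.
  assert (P : forall x n, (y <= Rabs (Im x))%R -> (Cmod x <= R0)%R -> (/ c * (INR n + 1) <= Cmod (nhalf n + x))%R).
  { intros x n Hx Hr. rewrite nhalf_R. set (m := Cmod (RtoC (INR n + / 2) + x)).
    assert (m1 : (y <= m)%R).
    { eapply Rle_trans; [exact Hx|]. unfold m. eapply Rle_trans; [|apply im_le_Cmod].
      right. f_equal. destruct x; simpl; ring. }
    assert (m2 : (INR n + / 2 <= m + Rabs R0)%R).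
    { pose proof (Cmod_triangle_sub (RtoC (INR n + / 2)) (- x)) as T. rewrite Cmod_opp in T.
      replace (RtoC (INR n + / 2) - - x) with (RtoC (INR n + / 2) + x) in T by ring. fold m in T.
      rewrite Cmod_R in T. pose proof (Rle_abs (INR n + / 2)). pose proof (Rle_abs R0). lra. }
    apply Rmult_le_reg_l with c; auto. rewrite <- Rmult_assoc, Rinv_r, Rmult_1_l by lra.
    assert (1 <= m / y)%R by (apply Rmult_le_reg_r with y; auto; field_simplify; lra).
    replace (c * m)%R with (m + (Rabs R0 + 1) * (m / y))%R by (unfold c; field; lra).
    pose proof (Rabs_pos R0). assert ((Rabs R0 + 1) * 1 <= (Rabs R0 + 1) * (m / y))%R by (apply Rmult_le_compat_l; lra). lra. }
  intros x n Hx Hr. split; [|now apply P]. unfold Cminus. apply P. 2: now rewrite Cmod_opp.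
  replace (Im (- x)) with (- Im x)%R by reflexivity. now rewrite Rabs_Ropp.
Qed.

Lemma inv_lower d n (u : C) : (0 < d)%R -> (d * (INR n + 1) <= Cmod u)%R ->
  u <> 0 /\ (/ Cmod u <= / d * / (INR n + 1))%R.
Proof.
  intros Hd Hu. pose proof (pos_INR n). assert (0 < d * (INR n + 1))%R by (apply Rmult_lt_0_compat; lra).
  split. apply Cmod_gt_0; lra. rewrite <- Rinv_mult. apply Rinv_le_contravar; lra.
Qed.

Lemma eta2_Z x n : eta2 n x =
  / (x + / 2 + RtoC (IZR (Z.of_nat n))) ^ 2 + / (x + / 2 + RtoC (IZR (- Z.of_nat n - 1))) ^ 2.
Proof.
  unfold eta2, nhalf. rewrite minus_IZR, opp_IZR, <- INR_IZR_INZ, RtoC_minus, RtoC_opp, Cplus_comm.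
  set (k := RtoC (INR n)).
  replace (x + / 2 + (- k - 1)) with (- (k + / 2 - x)) by field.
  replace ((- (k + / 2 - x)) ^ 2) with ((k + / 2 - x) ^ 2) by ring.
  replace (x + / 2 + k) with (k + / 2 + x) by ring. reflexivity.
Qed.

Lemma Csum_eta2 x : Csum (fun n => eta2 n x) = hsum (x + / 2).
Proof. apply Csum_ext. intros n. apply eta2_Z. Qed.

Lemma eta2_absc x : nonint (x + / 2) -> absc (fun n => eta2 n x).
Proof.
  intros Hx. destruct (bndZ_nat _ (nonint_bndZ _ Hx)) as [Z1 Z2].
  apply absc_ext with (2 := absc_plus _ _ Z1 Z2). intros n. symmetry. apply eta2_Z.
Qed.

Lemma Im_plus_half x : Im (x + / 2) = Im x.
Proof. rewrite <- (RtoC_inv 2) by lra. destruct x; simpl; ring. Qed.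

Lemma eta_absc x : Im x <> 0%R -> absc (fun n => eta1 n x) /\ absc (fun n => eta2 n x).
Proof.
  intros Hx. destruct (half_lower (Rabs (Im x)) (Cmod x) ltac:(now apply Rabs_pos_lt)) as (d & Hd & H).
  assert (Hd2 : (0 < / d)%R) by now apply Rinv_0_lt_compat.
  split.
  - apply absc_le with (b := fun n => (2 * Cmod x * (/ d) ^ 2 * inv2 n)%R). 2: apply ex_series_scal_R, ex_series_inv2.
    intros n. destruct (H x n ltac:(lra) ltac:(lra)) as [h1 h2].
    destruct (inv_lower _ _ _ Hd h1) as [z1 b1]. destruct (inv_lower _ _ _ Hd h2) as [z2 b2].
    unfold eta1. replace (/ (nhalf n - x) - / (nhalf n + x)) with (2 * x * (/ (nhalf n - x) * / (nhalf n + x))) by (field; auto).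
    rewrite !Cmod_mult, Cmod_R, Rabs_pos_eq, !Cmod_inv by (auto; lra). unfold inv2.
    rewrite (Rmult_assoc (2 * Cmod x)). apply Rmult_le_compat_l. pose proof (Cmod_ge_0 x); lra.
    replace ((/ d) ^ 2 * / (INR n + 1) ^ 2)%R with ((/ d * / (INR n + 1)) * (/ d * / (INR n + 1)))%R by (field; pose proof (pos_INR n); lra).
    apply Rmult_le_compat; auto; left; apply Rinv_0_lt_compat; now apply Cmod_gt_0.
  - apply eta2_absc, nonint_im. now rewrite Im_plus_half.
Qed.

Lemma cder_Htan x : (0 < Im x)%R -> cder Htan x (hsum (x + / 2)).
Proof.
  intros Hx. set (y := (Im x / 2)%R).
  destruct (half_lower y (Cmod x + y) ltac:(unfold y; lra)) as (d & Hd & H).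
  assert (Hd2 : (0 < / d)%R) by now apply Rinv_0_lt_compat.
  assert (E2 : ex_series (fun n => 2 * (/ d) ^ 3 * inv2 n)%R) by (apply ex_series_scal_R, ex_series_inv2).
  exists (Series (fun n => 2 * (/ d) ^ 3 * inv2 n)%R), y.
  split. { apply Series_pos; auto. intros n. pose proof (inv2_pos n). pose proof (pow_nonneg (/ d) 3 ltac:(lra)). nra. }
  split. unfold y; lra. intros k Hk.
  assert (Hxk : (y <= Im (x + k))%R).
  { pose proof (im_le_Cmod k) as Hi. pose proof (Rle_abs (- Im k)). rewrite Rabs_Ropp in H0.
    replace (Im (x + k)) with (Im x + Im k)%R by reflexivity. unfold y in *; lra. }
  destruct (eta_absc x ltac:(lra)) as [A1 A2].
  destruct (eta_absc (x + k) ltac:(unfold y in *; lra)) as [A3 _].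
  rewrite <- Csum_eta2. unfold Htan. rewrite <- Csum_minus, <- Csum_scal by auto.
  rewrite <- Csum_minus; [|now apply absc_minus|now apply absc_scal].
  rewrite Rmult_comm, <- Series_scal_l. apply Csum_bound. 2: now apply ex_series_scal_R.
  intros n.
  assert (Hxkm : (Cmod (x + k) <= Cmod x + y)%R) by (eapply Rle_trans; [apply Cmod_triangle|lra]).
  pose proof (Rle_abs (Im (x + k))). pose proof (Rle_abs (Im x)).
  destruct (H (x + k) n ltac:(lra) Hxkm) as [p1 p2].
  destruct (H x n ltac:(unfold y; lra) ltac:(unfold y; lra)) as [p3 p4].
  destruct (inv_lower _ _ _ Hd p1) as [z1 b1]. destruct (inv_lower _ _ _ Hd p2) as [z2 b2]. destruct (inv_lower _ _ _ Hd p3) as [z3 b3]. destruct (inv_lower _ _ _ Hd p4) as [z4 b4].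
  (* The exact remainder 1/(u-k) - 1/u - k/u^2 = k^2/((u-k) u^2), used for both poles. *)
  replace (eta1 n (x + k) - eta1 n x - k * eta2 n x) with
   (k ^ 2 * (/ (nhalf n - (x + k)) * (/ (nhalf n - x)) ^ 2 + - / (nhalf n + (x + k)) * (/ (nhalf n + x)) ^ 2)) by (unfold eta1, eta2; field; auto).
  rewrite Cmod_mult, Cmod_pow. apply Rmult_le_compat_l. apply pow_nonneg, Cmod_ge_0.
  eapply Rle_trans; [apply Cmod_triangle|]. rewrite !Cmod_mult, !Cmod_pow, Cmod_opp, !Cmod_inv by auto.
  assert (Q : forall z z' : C, z <> 0 -> z' <> 0 -> (/ Cmod z <= / d * / (INR n + 1))%R -> (/ Cmod z' <= / d * / (INR n + 1))%R ->
    (/ Cmod z * (/ Cmod z') ^ 2 <= (/ d) ^ 3 * inv2 n)%R).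
  { intros z z' Hz Hz' Hb Hb'. apply Cmod_gt_0 in Hz, Hz'. pose proof (pos_INR n).
    apply Rle_trans with ((/ d * / (INR n + 1)) * (/ d * / (INR n + 1)) ^ 2)%R.
    - apply Rmult_le_compat; auto. left; now apply Rinv_0_lt_compat. apply pow_nonneg; left; now apply Rinv_0_lt_compat.
      apply pow_incr; split; auto. left; now apply Rinv_0_lt_compat.
    - replace ((/ d * / (INR n + 1)) * (/ d * / (INR n + 1)) ^ 2)%R with ((/ d) ^ 3 * inv2 n * / (INR n + 1))%R by (unfold inv2; field; lra).
      rewrite <- (Rmult_1_r ((/ d) ^ 3 * inv2 n)) at 2. apply Rmult_le_compat_l.
      apply Rmult_le_pos. apply pow_nonneg; lra. left; apply inv2_pos.
      rewrite <- Rinv_1. apply Rinv_le_contravar; lra. }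
  pose proof (Q _ _ z1 z3 b1 b3). pose proof (Q _ _ z2 z4 b2 b4). lra.
Qed.

Lemma Cmod_cexp_tpi x : Cmod (cexp (tpi * x)) = exp (- (2 * PI * Im x)).
Proof. rewrite Cmod_cexp. now destruct (tpi_re_im x) as [-> _]. Qed.

Lemma Cmod_cexp_tpi_lt1 x : (0 < Im x)%R -> (Cmod (cexp (tpi * x)) < 1)%R.
Proof.
  intros H. rewrite Cmod_cexp_tpi, <- exp_0. apply exp_increasing. pose proof PI_RGT_0.
  assert (0 < 2 * PI * Im x)%R by (apply Rmult_lt_0_compat; lra). lra.
Qed.

Lemma ecot_half x : ecot (x + / 2) = 4 * PI ^ 2 * (cexp (tpi * x) / (1 + cexp (tpi * x)) ^ 2).
Proof.
  unfold ecot. replace (tpi * (x + / 2)) with (tpi * x + PI * Ci) by (unfold tpi; field).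
  rewrite cexp_add, cexp_PI. set (q := cexp (tpi * x)).
  replace (1 - q * - (1)) with (1 + q) by ring. unfold Cdiv. ring.
Qed.

(** pi tan(pi x) in terms of e^{2 pi i x}. *)
Definition tanq (x : C) : C := - (PI * Ci) * ((cexp (tpi * x) - 1) * / (1 + cexp (tpi * x))).

Lemma one_plus_q x : (0 < Im x)%R -> 1 + cexp (tpi * x) <> 0.
Proof.
  intros H E. pose proof (Cmod_cexp_tpi_lt1 x H). replace (cexp (tpi * x)) with ((1 + cexp (tpi * x)) + - (1)) in H0 by ring.
  rewrite E, Cplus_0_l, Cmod_m1 in H0. lra.
Qed.

Lemma Ci2 : Ci * Ci = - (1).
Proof. unfold Ci, Cmult, RtoC, Copp; simpl; apply injective_projections; simpl; ring. Qed.

Lemma cder_tanq x : (0 < Im x)%R -> cder tanq x (hsum (x + / 2)).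
Proof.
  intros H. pose proof (one_plus_q x H) as H0.
  rewrite hsum_ecot. 2:{ apply nonint_im. rewrite Im_plus_half; lra. }
  rewrite ecot_half. unfold tanq.
  pose proof (cder_cexp_scal tpi x) as De.
  eapply cder_val; [|apply cder_scal, cder_mult; [apply cder_minus; [exact De|apply (cder_const 1)]|
    apply (cder_comp (fun z => / z) (fun z => 1 + cexp (tpi * z))); [apply cder_plus; [apply (cder_const 1)|exact De]|apply cder_inv, H0]]].
  cbv beta. set (q := cexp (tpi * x)) in *. unfold tpi.
  replace (- (PI * Ci) * ((2 * PI * Ci * q - 0) * / (1 + q) + (q - 1) * ((0 + 2 * PI * Ci * q) * - / ((1 + q) * (1 + q)))))
   with (- (Ci * Ci) * (4 * PI ^ 2 * (q / (1 + q) ^ 2))) by (field; auto).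
  rewrite Ci2. ring.
Qed.

(** Both sides have the same derivative on the convex half plane, so they differ by a constant. At
    the points i y both are O(y), so the constant is 0. *)
Lemma Htan_tanq x : (0 < Im x)%R -> Htan x = tanq x.
Proof.
  intros Hx.
  assert (C0 : forall y, (0 < Im y)%R -> Htan y - tanq y = Htan x - tanq x).
  { intros y Hy. apply (cder_0_const (fun z => Htan z - tanq z)). intros t Ht.
    assert (Hi : (0 < Im (x + RtoC t * (y - x)))%R).
    { replace (Im (x + RtoC t * (y - x))) with ((1 - t) * Im x + t * Im y)%R by (destruct x, y; simpl; ring).
      destruct (Req_dec t 0) as [->|Ht0]. lra. assert (0 <= (1 - t) * Im x)%R by nra. nra. }
    eapply cder_val; [|apply cder_minus; [now apply cder_Htan|now apply cder_tanq]]. ring. }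
  apply Ceq_minus, Cmod_eq_0. apply Rle_antisym; [|apply Cmod_ge_0].
  assert (E8 : ex_series (fun n => 8 * inv2 n)%R) by (apply ex_series_scal_R, ex_series_inv2).
  set (K := (Series (fun n => 8 * inv2 n) + 2 * PI ^ 2)%R).
  assert (HK : (0 <= K)%R).
  { apply Rplus_le_le_0_compat. apply Series_pos; auto. intros n; pose proof (inv2_pos n); lra.
    pose proof (pow2_ge_0 PI). lra. }
  assert (B : forall y, (0 < y)%R -> (Cmod (Htan x - tanq x) <= K * y)%R).
  { intros y Hy. rewrite <- (C0 (Ci * RtoC y)) by (simpl; lra).
    unfold Cminus. eapply Rle_trans; [apply Cmod_triangle|]. rewrite Cmod_opp. unfold K. rewrite Rmult_plus_distr_r.
    apply Rplus_le_compat.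
    - rewrite Rmult_comm, <- Series_scal_l. apply Csum_bound. 2: now apply ex_series_scal_R.
      intros n. unfold eta1. rewrite nhalf_R. set (a := (INR n + / 2)%R). pose proof (pos_INR n).
      assert (Ha : (0 < a)%R) by (unfold a; lra).
      assert (L : forall s : R, (a <= Cmod (RtoC a + Ci * RtoC s))%R).
      { intros s. eapply Rle_trans; [|apply re_le_Cmod]. replace (Re (RtoC a + Ci * RtoC s)) with a by (simpl; ring). apply Rle_abs. }
      assert (L1 := L y). assert (L2 := L (- y)%R).
      replace (RtoC a + Ci * RtoC (- y)) with (RtoC a - Ci * RtoC y) in L2 by (rewrite RtoC_opp; ring).
      assert (z1 : RtoC a + Ci * RtoC y <> 0) by (apply Cmod_gt_0; lra).
      assert (z2 : RtoC a - Ci * RtoC y <> 0) by (apply Cmod_gt_0; lra).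
      replace (/ (RtoC a - Ci * RtoC y) - / (RtoC a + Ci * RtoC y)) with (2 * Ci * RtoC y * (/ (RtoC a - Ci * RtoC y) * / (RtoC a + Ci * RtoC y))) by (field; auto).
      rewrite !Cmod_mult, !Cmod_inv, !Cmod_R, Cmod_Ci, (Rabs_pos_eq 2), (Rabs_pos_eq y) by (auto; lra).
      assert (I : forall m, (a <= m)%R -> (0 <= / m <= 2 * / (INR n + 1))%R).
      { intros m Hm. split. left; apply Rinv_0_lt_compat; lra.
        replace (2 * / (INR n + 1))%R with (/ ((INR n + 1) / 2))%R by (field; lra).
        apply Rinv_le_contravar; unfold a in *; lra. }
      pose proof (I _ L1). pose proof (I _ L2).
      replace (y * (8 * inv2 n))%R with (2 * 1 * y * ((2 * / (INR n + 1)) * (2 * / (INR n + 1))))%R by (unfold inv2; field; lra).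
      apply Rmult_le_compat_l. lra. apply Rmult_le_compat; lra.
    - unfold tanq. replace (tpi * (Ci * RtoC y)) with (RtoC (- (2 * PI * y))).
      2:{ unfold tpi. replace (2 * PI * Ci * (Ci * y)) with ((Ci * Ci) * (2 * PI * y)) by ring. rewrite Ci2, RtoC_opp, !RtoC_mult. ring. }
      assert (Er : forall s : R, cexp (RtoC s) = RtoC (exp s)).
      { intros s. unfold cexp, RtoC; cbn [Re Im fst snd]. rewrite cos_0, sin_0. apply injective_projections; cbn [fst snd]; ring. }
      rewrite Er. set (r := exp (- (2 * PI * y))). pose proof PI_RGT_0.
      assert (Hr : (0 < r)%R) by apply exp_pos.
      assert (Hr1 : (1 - 2 * PI * y <= r)%R) by (pose proof (exp_ineq1_le (- (2 * PI * y))); unfold r; lra).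
      assert (Hr2 : (r < 1)%R) by (unfold r; rewrite <- exp_0; apply exp_increasing; assert (0 < 2 * PI * y)%R by (apply Rmult_lt_0_compat; lra); lra).
      replace (RtoC 1 + RtoC r) with (RtoC (1 + r)) by (rewrite RtoC_plus; ring).
      replace (RtoC r - RtoC 1) with (RtoC (r - 1)) by (rewrite RtoC_minus; ring).
      rewrite <- RtoC_inv by lra.
      rewrite !Cmod_mult, Cmod_opp, Cmod_mult, !Cmod_R, Cmod_Ci, (Rabs_pos_eq PI), (Rabs_left (r - 1)), (Rabs_pos_eq (/ (1 + r))) by (try lra; left; apply Rinv_0_lt_compat; lra).
      assert (/ (1 + r) <= 1)%R by (rewrite <- Rinv_1; apply Rinv_le_contravar; lra).
      assert (0 < / (1 + r))%R by (apply Rinv_0_lt_compat; lra).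
      replace (2 * PI ^ 2 * y)%R with (PI * 1 * ((2 * PI * y) * 1))%R by ring.
      apply Rmult_le_compat_l. lra. apply Rmult_le_compat; lra. }
  apply le_epsilon. intros eps He. rewrite Rplus_0_l.
  assert (He' : (0 < eps / (K + 1))%R) by (apply Rdiv_lt_0_compat; lra).
  eapply Rle_trans; [apply (B _ He')|]. apply Rmult_le_of_div; lra.
Qed.

(** tan(pi x) tends to i, not to 0, high in the half plane. This limit is the source of the
    quasi-modular term of L. *)
Lemma Htan_lim x : (1 <= Im x)%R -> (Cmod (Htan x - PI * Ci) <= 4 * PI * exp (- (2 * PI * Im x)))%R.
Proof.
  intros Hx. rewrite Htan_tanq by lra. unfold tanq. pose proof (one_plus_q x ltac:(lra)) as H0.
  pose proof (Cmod_cexp_tpi x) as Hq. set (q := cexp (tpi * x)) in *. pose proof PI_RGT_0. pose proof PI2_1.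
  assert (Hq2 : (Cmod q <= 1 / 2)%R).
  { rewrite Hq, exp_Ropp. replace (1 / 2)%R with (/ 2)%R by field. apply Rinv_le_contravar. lra.
    pose proof (exp_ineq1_le (2 * PI * Im x)). nra. }
  replace (- (PI * Ci) * ((q - 1) * / (1 + q)) - PI * Ci) with (- (2 * PI * Ci) * (q * / (1 + q))) by (field; auto).
  rewrite !Cmod_mult, Cmod_opp, !Cmod_mult, !Cmod_R, Cmod_Ci, (Rabs_pos_eq 2), (Rabs_pos_eq PI), Cmod_inv by (auto; lra).
  pose proof (Cmod_triangle_sub 1 (- q)) as T. rewrite Cmod_1, Cmod_opp in T.
  replace (1 - - q) with (1 + q) in T by ring.
  assert (/ Cmod (1 + q) <= 2)%R by (rewrite <- (Rinv_inv 2); apply Rinv_le_contravar; lra).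
  rewrite <- Hq. replace (4 * PI * Cmod q)%R with (2 * PI * 1 * (Cmod q * 2))%R by ring.
  apply Rmult_le_compat_l. lra. apply Rmult_le_compat_l; auto. apply Cmod_ge_0.
Qed.

(** * Lambert series and the quasi-modularity of L *)

Lemma csum_RtoC (f : nat -> R) n : csum (fun i => RtoC (f i)) (S n) = RtoC (sum_f_R0 f n).
Proof. induction n. simpl; ring. cbn [sum_f_R0]. rewrite RtoC_plus, <- IHn. reflexivity. Qed.

(** The coefficients of the sum over m and d of b_m a_d q^{m d}. For n > 0 the index m = 0 drops out
    because [n mod 0] is n; hence the condition b 0 = 0 in [ev_lambert]. *)
Definition lambert (b a : nat -> R) (n : nat) : R :=
  sum_f_R0 (fun m => if Nat.eqb (n mod m) 0 then (b m * a (n / m)%nat)%R else 0%R) n.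

(** The partial sums of g at the multiples of m are the partial sums of a. *)
Lemma Csum_sparse (a : nat -> C) m : (1 <= m)%nat ->
  let g := fun N => if Nat.eqb (N mod m) 0 then a (N / m)%nat else 0 in
  absc a -> absc g -> Csum g = Csum a.
Proof.
  intros Hm g Ha Hg.
  assert (E : forall n, csum g (m * n) = csum a n).
  { induction n. now rewrite Nat.mul_0_r.
    assert (B : forall j, (1 <= j <= m)%nat -> csum g (m * n + j) = csum g (m * n) + a n).
    { induction j as [|j IH]; intros Hj; [lia|].
      rewrite Nat.add_succ_r. cbn [csum]. destruct j.
      - rewrite Nat.add_0_r. f_equal. unfold g. rewrite Nat.mul_comm, Nat.Div0.mod_mul, Nat.eqb_refl, Nat.div_mul; auto; lia.
      - rewrite IH by lia. unfold g at 2.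
        replace (m * n + S j)%nat with (S j + n * m)%nat by lia. rewrite Nat.Div0.mod_add, Nat.mod_small by lia.
        cbn [Nat.eqb]. ring. }
    replace (m * S n)%nat with (m * n + m)%nat by lia. rewrite B by lia. cbn [csum]. now rewrite IHn. }
  symmetry. apply Csum_unique; auto. intros eps He. destruct (Csum_lim g Hg eps He) as [N HN].
  exists N. intros n Hn. rewrite <- E. left. apply HN. nia.
Qed.

Lemma lambert_bound b a : (forall m, Rabs (b m) <= 1)%R -> (forall d, Rabs (a d) <= INR d)%R ->
  forall n, (Rabs (lambert b a n) <= (INR n + 1) * INR n)%R.
Proof.
  intros Hb Ha n. unfold lambert. rewrite <- Cmod_R, <- csum_RtoC.
  eapply Rle_trans; [apply csum_Cmod with (b := INR n)|].
  - intros k Hk. rewrite Cmod_R. destruct (Nat.eqb (n mod k) 0).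
    + rewrite Rabs_mult. rewrite <- (Rmult_1_l (INR n)). apply Rmult_le_compat; auto using Rabs_pos.
      eapply Rle_trans; [apply Ha|]. apply le_INR. destruct k. simpl; lia. apply Nat.Div0.div_le_upper_bound; nia.
    + rewrite Rabs_R0. apply pos_INR.
  - rewrite S_INR. lra.
Qed.

Lemma lambert_disc b a : (forall m, Rabs (b m) <= 1)%R -> (forall d, Rabs (a d) <= INR d)%R ->
  disc (fun n => RtoC (lambert b a n)).
Proof.
  intros Hb Ha. pose proof disc_1 as G. pose proof (disc_Dq _ G) as GD.
  apply disc_le with (2 := disc_plus _ _ (disc_Dq _ GD) GD). intros n.
  rewrite Cmod_R. eapply Rle_trans; [apply lambert_bound; auto|].
  unfold Dq. pose proof (pos_INR n).
  replace (RtoC (INR n) * (RtoC (INR n) * 1) + RtoC (INR n) * 1) with (RtoC ((INR n + 1) * INR n)) by (rewrite RtoC_mult, RtoC_plus; ring).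
  rewrite Cmod_R. apply Rle_abs.
Qed.

Lemma ev_lambert b a q : b 0%nat = 0%R ->
  (forall m, Rabs (b m) <= 1)%R -> (forall d, Rabs (a d) <= INR d)%R -> (Cmod q < 1)%R ->
  absc (fun m => RtoC (b m) * ev (fun d => RtoC (a d)) (q ^ m)) /\
  Csum (fun m => RtoC (b m) * ev (fun d => RtoC (a d)) (q ^ m)) = ev (fun n => RtoC (lambert b a n)) q.
Proof.
  intros Hb0 Hb Ha Hq. pose proof (Cmod_ge_0 q) as Hq0.
  assert (Ha0 : a 0%nat = 0%R).
  { specialize (Ha 0%nat). simpl in Ha. pose proof (Rabs_pos (a 0%nat)).
    destruct (Req_dec (a 0%nat) 0) as [|h]; auto. apply Rabs_pos_lt in h. lra. }
  assert (Gid : disc (Dq (fun _ => 1))) by apply disc_Dq, disc_1.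
  assert (Ga : disc (fun d => RtoC (a d))).
  { apply disc_le with (2 := Gid). intros n. unfold Dq. rewrite Cmult_1_r, !Cmod_R, (Rabs_pos_eq (INR n)) by apply pos_INR. apply Ha. }
  destruct (disc_geo _ (Cmod q) Gid ltac:(lra)) as [K [HK HKb]].
  (* The Lambert series as an array supported on m | N: row m is the m-th summand, column N collects
     the divisors of N. It is triangular since m <= N for N > 0. *)
  set (t := fun m N => if Nat.eqb (N mod m) 0 then RtoC (b m) * RtoC (a (N / m)%nat) * q ^ N else 0).
  assert (Hquot : forall m N, (Rabs (a (N / m)%nat) <= INR N)%R).
  { intros m N. eapply Rle_trans; [apply Ha|]. apply le_INR. destruct m. simpl; lia. apply Nat.Div0.div_le_upper_bound; nia. }
  assert (Hpow : forall N, (INR N * Cmod q ^ N <= K * ratio (Cmod q) ^ N)%R).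
  { intros N. specialize (HKb N). unfold Dq in HKb. rewrite Cmult_1_r, Cmod_R, Rabs_pos_eq in HKb by apply pos_INR. exact HKb. }
  assert (Hgeo0 : forall N, (0 <= K * ratio (Cmod q) ^ N)%R).
  { intros; apply Rmult_le_pos; auto. apply pow_nonneg, ratio_bounds; lra. }
  assert (Ht : forall m N, (Cmod (t m N) <= K * ratio (Cmod q) ^ N)%R).
  { intros m N. unfold t. destruct (Nat.eqb (N mod m) 0). 2: now rewrite Cmod_0.
    rewrite !Cmod_mult, Cmod_pow, !Cmod_R. eapply Rle_trans; [|apply Hpow].
    apply Rmult_le_compat_r. now apply pow_nonneg. rewrite <- (Rmult_1_l (INR N)). apply Rmult_le_compat; auto using Rabs_pos. }
  assert (Row : forall m, RtoC (b m) * ev (fun d => RtoC (a d)) (q ^ m) = Csum (t m)).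
  { intros m. destruct m.
    - rewrite Hb0, Cmult_0_l. rewrite (Csum_ext _ (fun _ => 0)). now rewrite Csum_0.
      intros N. unfold t. rewrite Hb0. destruct (Nat.eqb _ 0); ring.
    - set (m' := S m). assert (Hqm : (Cmod (q ^ m') < 1)%R).
      { rewrite Cmod_pow. apply pow_lt_1_compat; [lra|unfold m'; lia]. }
      assert (A1 : absc (fun N => if Nat.eqb (N mod m') 0 then RtoC (a (N / m')%nat) * (q ^ m') ^ (N / m') else 0)).
      { apply absc_le with (b := fun N => (K * ratio (Cmod q) ^ N)%R). 2: apply ex_series_geo, ratio_bounds; lra.
        intros N. destruct (Nat.eqb_spec (N mod m') 0) as [E|E]. 2: now rewrite Cmod_0.
        rewrite <- Cpow_mult_r. replace (m' * (N / m'))%nat with N by (apply Nat.Div0.div_exact; exact E).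
        rewrite Cmod_mult, Cmod_pow, Cmod_R. eapply Rle_trans; [|apply Hpow]. apply Rmult_le_compat_r; auto. now apply pow_nonneg. }
      unfold ev. rewrite <- (Csum_sparse (fun d => RtoC (a d) * (q ^ m') ^ d) m' ltac:(unfold m'; lia)); auto.
      2: now apply (ev_absc (fun d => RtoC (a d))).
      rewrite <- Csum_scal by auto. apply Csum_ext. intros N. unfold t.
      destruct (Nat.eqb_spec (N mod m') 0) as [E|E]. 2: ring.
      rewrite <- Cpow_mult_r. replace (m' * (N / m'))%nat with N at 1 by (apply Nat.Div0.div_exact; exact E). ring. }
  destruct (tri_fubini t K (ratio (Cmod q))) as [F1 [F2 F3]]; auto.
  - apply ratio_bounds; lra.
  - intros m N Hm. unfold t. destruct N.
    + rewrite Nat.Div0.mod_0_l, Nat.eqb_refl, Nat.Div0.div_0_l, Ha0. ring.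
    + rewrite Nat.mod_small by lia. reflexivity.
  - split. now apply absc_ext with (2 := F1).
    rewrite (Csum_ext _ _ Row), F3. apply Csum_ext. intros N. unfold lambert. rewrite <- csum_RtoC, Cmult_comm, <- csum_scal.
    apply csum_ext. intros m Hm. unfold t. destruct (Nat.eqb (N mod m) 0); rewrite ?RtoC_mult; ring.
Qed.

(* The index of summation in lambert is n/d: mu n is the sum of (-1)^d d over d | n, mu_odd n that of d with n/d odd. *)
Definition mu : nat -> R := lambert (fun m => if Nat.eqb m 0 then 0%R else 1%R) (fun d => ((-1) ^ d * INR d)%R).
Definition mu_odd : nat -> R := lambert (fun m => if Nat.odd m then 1%R else 0%R) (fun d => INR d).

Lemma mu_weight_le m : (Rabs (if Nat.eqb m 0 then 0 else 1) <= 1)%R.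
Proof. destruct (Nat.eqb m 0); rewrite ?Rabs_R0, ?Rabs_R1; lra. Qed.
Lemma mu_value_le d : (Rabs ((-1) ^ d * INR d) <= INR d)%R.
Proof. rewrite Rabs_mult, pow_1_abs, Rabs_pos_eq, Rmult_1_l by apply pos_INR. lra. Qed.
Lemma mu_odd_weight_le m : (Rabs (if Nat.odd m then 1 else 0) <= 1)%R.
Proof. destruct (Nat.odd m); rewrite ?Rabs_R0, ?Rabs_R1; lra. Qed.
Lemma mu_odd_value_le d : (Rabs (INR d) <= INR d)%R.
Proof. rewrite Rabs_pos_eq by apply pos_INR. lra. Qed.

Definition cmu (n : nat) : C := RtoC (mu n).
Definition cmu_odd (n : nat) : C := RtoC (mu_odd n).

Lemma disc_mu : disc cmu.
Proof. apply lambert_disc. apply mu_weight_le. apply mu_value_le. Qed.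
Lemma disc_mu_odd : disc cmu_odd.
Proof. apply lambert_disc. apply mu_odd_weight_le. apply mu_odd_value_le. Qed.

Lemma ev_alt q : (Cmod q < 1)%R -> ev (fun d => RtoC ((-1) ^ d * INR d)) q = - (q / (1 + q) ^ 2).
Proof.
  intros Hq. transitivity (ev (Dq (fun _ => 1)) (- q)).
  - apply Csum_ext. intros n. unfold Dq. replace (- q) with (RtoC (-1) * q) by (rewrite RtoC_m1; ring).
    rewrite Cpow_mult_l, RtoC_mult, RtoC_pow. ring.
  - rewrite ev_Dgeom by now rewrite Cmod_opp. replace (1 - - q) with (1 + q) by ring. unfold Cdiv. ring.
Qed.

(** The imaginary part alone controls n; then |r| <= |(n+1/2) w - r| + (n+1/2)|w| controls m. The
    slack 1/2 lets one bound serve r at distance 1/2 from m or -m as well. *)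
Lemma lat_lower w : (0 < Im w)%R -> exists c, (0 < c)%R /\ forall n m (r : R), (INR m - / 2 <= Rabs r)%R ->
  (c * (INR n + 1) <= Cmod (nhalf n * w - RtoC r))%R /\ (c * (INR m + 1) <= Cmod (nhalf n * w - RtoC r))%R.
Proof.
  intros Hw. set (y := Im w) in *. pose proof (Cmod_ge_0 w).
  set (k := (1 + (Cmod w + 3) / y)%R).
  assert (Hy : (0 <= (Cmod w + 3) / y)%R) by (apply Rmult_le_pos; [lra|left; now apply Rinv_0_lt_compat]).
  assert (Hk : (0 < k)%R) by (unfold k; lra).
  exists (/ k)%R. split. now apply Rinv_0_lt_compat. intros n m r Hr.
  rewrite nhalf_R. set (a := (INR n + / 2)%R). pose proof (pos_INR n). assert (Ha : (/ 2 <= a)%R) by (unfold a; lra).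
  set (X := Cmod (RtoC a * w - RtoC r)).
  assert (X1 : (a * y <= X)%R).
  { unfold X. eapply Rle_trans; [|apply im_le_Cmod]. replace (Im (RtoC a * w - RtoC r)) with (a * y)%R by (unfold y; destruct w; simpl; ring).
    apply Rle_abs. }
  assert (X2 : (Rabs r <= X + a * Cmod w)%R).
  { rewrite <- Cmod_R. replace (RtoC r) with (- (RtoC a * w - RtoC r) + RtoC a * w) by ring.
    eapply Rle_trans; [apply Cmod_triangle|]. rewrite Cmod_opp, Cmod_mult, Cmod_R, Rabs_pos_eq by lra. unfold X; lra. }
  assert (X3 : (a <= X / y)%R) by (apply Rmult_le_reg_r with y; auto; field_simplify; lra).
  assert (X4 : (a * (Cmod w + 3) <= X * ((Cmod w + 3) / y))%R).
  { replace (X * ((Cmod w + 3) / y))%R with ((X / y) * (Cmod w + 3))%R by (field; lra). apply Rmult_le_compat_r; lra. }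
  assert (HkX : (k * X = X + X * ((Cmod w + 3) / y))%R) by (unfold k; ring).
  assert (0 <= X)%R by apply Cmod_ge_0. assert (0 <= a * Cmod w)%R by (apply Rmult_le_pos; lra).
  split; apply Rmult_le_reg_l with k; auto; rewrite <- Rmult_assoc, Rinv_r, Rmult_1_l by lra; rewrite HkX; unfold a in *; lra.
Qed.

(** * The double sum over the lattice, by rows and by columns *)

Section Lattice.
Variable w : C.
Hypothesis Hw : (0 < Im w)%R.
Let z : C := - / w.

(* With x = (n+1/2) w - m, the term 1/x^2 - 1/(x^2 - 1/4) is even under (n+1/2, m) -> -(n+1/2, m); lat_sq and lat_tel are
   its two parts folded over the signs of n+1/2 and m, so that n and m run over nat. *)
Definition lat_tan (n m : nat) : C := / (nhalf n * w - (RtoC (INR m) + / 2)) - / (nhalf n * w + (RtoC (INR m) + / 2)).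

Definition lat_tel (n m : nat) : C :=
  match m with O => 2 * lat_tan n 0 | S k => 2 * (lat_tan n m - lat_tan n k) end.

Definition lat_sq (n m : nat) : C :=
  match m with
  | O => 2 * / (nhalf n * w) ^ 2
  | S k => 2 * (/ (nhalf n * w - RtoC (INR m)) ^ 2 + / (nhalf n * w + RtoC (INR m)) ^ 2) end.

Definition lat (n m : nat) : C := lat_sq n m - lat_tel n m.

Lemma w_neq0 : w <> 0.
Proof. intros E. rewrite E in Hw. simpl in Hw. lra. Qed.

Lemma Im_z : (0 < Im z)%R.
Proof.
  pose proof w_neq0 as H0. apply Cmod_gt_0 in H0.
  assert (E : (Im z * Cmod w ^ 2 = Im w)%R).
  { rewrite Cmod2_alt. assert (0 < Re w ^ 2 + Im w ^ 2)%R by (rewrite <- Cmod2_alt; now apply pow_lt).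
    unfold z. destruct w as [a b]. unfold Copp, Cinv; simpl in *. field. lra. }
  assert (0 < Cmod w ^ 2)%R by now apply pow_lt. nra.
Qed.

(** 1/x^2 - 1/(x^2 - 1/4) = -(1/4)/(x x (x - 1/2)(x + 1/2)). Bounding the two factors x through n
    and the two others through m gives the product majorant that [fubini] wants. *)
Lemma lat_bound : exists c, (0 < c)%R /\ forall n m, (Cmod (lat n m) <= (c * inv2 n) * inv2 m)%R.
Proof.
  destruct (lat_lower w Hw) as (c & Hc & L).
  assert (Hc4 : (0 < / c ^ 4)%R) by (apply Rinv_0_lt_compat, pow_lt; lra).
  exists (/ c ^ 4)%R. split; auto.
  assert (P : forall n m (r s : R), (INR m <= Rabs r)%R -> (s = / 2 \/ s = - / 2)%R ->
     nhalf n * w - RtoC (r + s) <> 0 /\ (INR m - / 2 <= Rabs (r + s))%R).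
  { intros n m r s Hr Hs. assert (Hrs : (INR m - / 2 <= Rabs (r + s))%R).
    { revert Hr. unfold Rabs. repeat destruct Rcase_abs; destruct Hs; subst; lra. }
    split; auto. apply Cmod_gt_0. destruct (L n m (r + s)%R Hrs) as [l1 _]. pose proof (pos_INR n).
    assert (0 < c * (INR n + 1))%R by (apply Rmult_lt_0_compat; lra). lra. }
  assert (B : forall n m (r : R), (INR m <= Rabs r)%R ->
     (Cmod (/ (nhalf n * w - RtoC r) ^ 2 - (/ (nhalf n * w - RtoC (r + / 2)) - / (nhalf n * w - RtoC (r - / 2)))) <= / 4 * (/ c ^ 4 * inv2 n * inv2 m))%R).
  { intros n m r Hr. destruct (P n m r (/ 2)%R Hr ltac:(auto)) as [z1 r1]. destruct (P n m r (- / 2)%R Hr ltac:(auto)) as [z2 r2].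
    fold (r - / 2)%R in z2, r2.
    assert (r0 : (INR m - / 2 <= Rabs r)%R) by lra.
    destruct (L n m r r0) as [l1 l2]. destruct (L n m _ r1) as [l3 l4]. destruct (L n m _ r2) as [l5 l6].
    pose proof (pos_INR n). pose proof (pos_INR m).
    assert (p1 : (0 < c * (INR n + 1))%R) by (apply Rmult_lt_0_compat; lra).
    assert (p2 : (0 < c * (INR m + 1))%R) by (apply Rmult_lt_0_compat; lra).
    assert (z0 : nhalf n * w - RtoC r <> 0) by (apply Cmod_gt_0; lra).
    set (X := nhalf n * w - RtoC r) in *. set (Y := nhalf n * w - RtoC (r + / 2)) in *. set (Z := nhalf n * w - RtoC (r - / 2)) in *.
    assert (EY : Y = X - / 2) by (unfold X, Y; rewrite RtoC_plus, RtoC_inv by lra; ring).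
    assert (EZ : Z = X + / 2) by (unfold X, Z; rewrite RtoC_minus, RtoC_inv by lra; ring).
    replace (/ X ^ 2 - (/ Y - / Z)) with (- / 4 * (/ X * / X * (/ Y * / Z))).
    2:{ rewrite EY, EZ in *. field. repeat split; auto.
        intros E; apply z2. apply (f_equal (fun t => t * / 2)) in E. rewrite Cmult_0_l in E. rewrite <- E. field.
        intros E; apply z1. apply (f_equal (fun t => t * / 2)) in E. rewrite Cmult_0_l in E. rewrite <- E. field. }
    rewrite !Cmod_mult, Cmod_opp, !Cmod_inv, Cmod_R, (Rabs_pos_eq 4) by (auto; try lra; intros E; apply RtoC_inj in E; lra).
    apply Rmult_le_compat_l. lra.
    assert (I : forall u t, (0 < t)%R -> (t <= u)%R -> (0 <= / u <= / t)%R).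
    { intros u t Ht Hu. split. left; apply Rinv_0_lt_compat; lra. apply Rinv_le_contravar; lra. }
    pose proof (I _ _ p1 l1). pose proof (I _ _ p2 l4). pose proof (I _ _ p2 l6).
    replace (/ c ^ 4 * inv2 n * inv2 m)%R with (/ (c * (INR n + 1)) * / (c * (INR n + 1)) * (/ (c * (INR m + 1)) * / (c * (INR m + 1))))%R
      by (unfold inv2; field; lra).
    apply Rmult_le_compat. apply Rmult_le_pos; lra. apply Rmult_le_pos; lra.
    apply Rmult_le_compat; lra. apply Rmult_le_compat; lra. }
  intros n m. unfold lat.
  set (bb := (/ c ^ 4 * inv2 n * inv2 m)%R) in *.
  destruct m as [|m].
  - specialize (B n 0%nat 0%R ltac:(simpl; rewrite Rabs_R0; lra)). fold bb in B.
    unfold lat_sq, lat_tel, lat_tan. simpl INR.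
    replace (2 * / (nhalf n * w) ^ 2 - 2 * (/ (nhalf n * w - (0 + / 2)) - / (nhalf n * w + (0 + / 2)))) with
     (2 * (/ (nhalf n * w - 0) ^ 2 - (/ (nhalf n * w - RtoC (0 + / 2)) - / (nhalf n * w - RtoC (0 - / 2))))).
    2:{ rewrite RtoC_plus, RtoC_minus, RtoC_inv by lra.
        replace (nhalf n * w - 0) with (nhalf n * w) by ring. replace (nhalf n * w - (0 - / 2)) with (nhalf n * w + (0 + / 2)) by ring. ring. }
    rewrite Cmod_mult, Cmod_R, Rabs_pos_eq by lra. pose proof (Cmod_ge_0 (/ (nhalf n * w - 0) ^ 2 - (/ (nhalf n * w - RtoC (0 + / 2)) - / (nhalf n * w - RtoC (0 - / 2))))). lra.
  - pose proof (pos_INR (S m)) as Hm. pose proof (B n (S m) (INR (S m)) ltac:(rewrite Rabs_pos_eq; lra)) as B1.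
    pose proof (B n (S m) (- INR (S m))%R ltac:(rewrite Rabs_Ropp, Rabs_pos_eq; lra)) as B2. fold bb in B1, B2.
    unfold lat_sq, lat_tel, lat_tan.
    match goal with |- (Cmod ?x <= _)%R => replace x with
      (2 * ((/ (nhalf n * w - RtoC (INR (S m))) ^ 2 - (/ (nhalf n * w - RtoC (INR (S m) + / 2)) - / (nhalf n * w - RtoC (INR (S m) - / 2)))) +
       (/ (nhalf n * w - RtoC (- INR (S m))) ^ 2 - (/ (nhalf n * w - RtoC (- INR (S m) + / 2)) - / (nhalf n * w - RtoC (- INR (S m) - / 2)))))) end.
    2:{ assert (EM : RtoC (INR (S m)) = RtoC (INR m) + 1) by (rewrite S_INR, RtoC_plus; reflexivity).
        rewrite !RtoC_plus, !RtoC_minus, !RtoC_opp, !RtoC_inv by lra.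
        rewrite EM. set (M := RtoC (INR m)). set (A := nhalf n * w).
        replace (A - (M + 1 - / 2)) with (A - (M + / 2)) by field.
        replace (A - - (M + 1)) with (A + (M + 1)) by ring.
        replace (A - (- (M + 1) + / 2)) with (A + (M + / 2)) by field.
        replace (A - (- (M + 1) - / 2)) with (A + (M + 1 + / 2)) by ring. ring. }
    rewrite Cmod_mult, Cmod_R, Rabs_pos_eq by lra.
    match goal with |- (2 * Cmod (?x + ?y) <= _)%R => pose proof (Cmod_triangle x y) end.
    pose proof (Cmod_ge_0 (lat n (S m))).
    assert (0 <= bb)%R. { unfold bb. pose proof (inv2_pos n). pose proof (inv2_pos (S m)). repeat apply Rmult_le_pos; lra. }
    lra.
Qed.

Lemma nonint_aw n : nonint (nhalf n * w).
Proof.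
  apply nonint_im. rewrite nhalf_R. pose proof (pos_INR n).
  replace (Im (RtoC (INR n + / 2) * w)) with ((INR n + / 2) * Im w)%R by (destruct w; simpl; ring). nra.
Qed.

Lemma csum_telescope (v : nat -> C) M :
  csum (fun m => match m with O => 2 * v 0%nat | S k => 2 * (v m - v k) end) (S M) = 2 * v M.
Proof. induction M. simpl; ring. cbn [csum] in *. rewrite IHM. ring. Qed.

Lemma Csum_telescope (v : nat -> C) l :
  absc (fun m => match m with O => 2 * v 0%nat | S k => 2 * (v m - v k) end) ->
  (forall eps, (0 < eps)%R -> exists N, forall m, (N <= m)%nat -> (Cmod (v m - l) <= eps)%R) ->
  Csum (fun m => match m with O => 2 * v 0%nat | S k => 2 * (v m - v k) end) = 2 * l.
Proof.
  intros Ha H. apply Csum_unique; auto. intros eps He.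
  destruct (H (eps / 2)%R ltac:(lra)) as [N HN]. exists (S N). intros [|n] Hn; [lia|].
  rewrite csum_telescope. specialize (HN n ltac:(lia)).
  replace (2 * v n - 2 * l) with (2 * (v n - l)) by ring. rewrite Cmod_mult, Cmod_R, Rabs_pos_eq by lra. lra.
Qed.

(** For fixed n the correction telescopes in m and [lat_tan n m] tends to 0, so a row only sees
    1/x^2. *)
Lemma row_lat n : Csum (lat n) = 2 * hsum (nhalf n * w).
Proof.
  destruct lat_bound as (c & Hc & B).
  assert (A : absc (lat n)) by (apply absc_le with (1 := B n), ex_series_scal_R, ex_series_inv2).
  pose proof (nonint_aw n) as Hn. pose proof (nonint_bndZ _ Hn) as HZ.
  assert (Sq : absc (lat_sq n) /\ Csum (lat_sq n) = 2 * hsum (nhalf n * w)).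
  { destruct (bndZ_nat _ HZ) as [Z1 Z2].
    assert (A1 : absc (fun k => lat_sq n (S k))).
    { apply absc_ext with (a := fun k => 2 * (/ (nhalf n * w + RtoC (IZR (- Z.of_nat k - 1))) ^ 2 + / (nhalf n * w + RtoC (IZR (Z.of_nat (1 + k)))) ^ 2)).
      - intros k. unfold lat_sq. rewrite S_INR, INR_IZR_INZ. rewrite minus_IZR, opp_IZR, RtoC_minus, RtoC_opp.
        replace (Z.of_nat (1 + k)) with (Z.of_nat k + 1)%Z by lia. rewrite plus_IZR, RtoC_plus.
        set (a := nhalf n * w). set (k' := RtoC (IZR (Z.of_nat k))).
        replace (a + (- k' - 1)) with (a - (k' + 1)) by ring. ring.
      - apply absc_scal, absc_plus; auto. apply (absc_shift _ 1 Z1). }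
    assert (A0 : absc (lat_sq n)) by now apply absc_incr.
    split; auto. rewrite (Csum_incr _ A0). unfold hsum. rewrite Zsum_fold0 by auto.
    rewrite Cmult_plus_distr_l. f_equal. unfold lat_sq. now rewrite Cplus_0_r.
    rewrite <- Csum_scal.
    - apply Csum_ext. intros k. unfold lat_sq. rewrite S_INR, INR_IZR_INZ. rewrite minus_IZR, opp_IZR, RtoC_minus, RtoC_opp.
      rewrite plus_IZR, RtoC_plus.
      set (a := nhalf n * w). set (k' := RtoC (IZR (Z.of_nat k))).
      replace (a + (- k' - 1)) with (a - (k' + 1)) by ring. ring.
    - apply absc_plus; auto. apply absc_ext with (2 := absc_shift _ 1 Z1). intros k. replace (Z.of_nat (1 + k)) with (Z.of_nat k + 1)%Z by lia. reflexivity. }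
  destruct Sq as [A0 E0].
  assert (At : absc (lat_tel n)).
  { apply absc_ext with (a := fun m => lat_sq n m - lat n m). intros m; unfold lat; ring. now apply absc_minus. }
  unfold lat. rewrite Csum_minus, E0 by auto.
  assert (Et : Csum (lat_tel n) = 2 * 0).
  { apply (Csum_telescope (lat_tan n) 0 At).
    destruct (lat_lower w Hw) as (d & Hd & L). intros eps He.
    destruct (archimed_cor1 (eps * d / 2) ltac:(apply Rmult_lt_0_compat; [apply Rmult_lt_0_compat; lra|lra])) as [N [HN HN0]]. exists N. intros m Hm.
    assert (Q : forall r : R, (INR m - / 2 <= Rabs r)%R -> (Cmod (/ (nhalf n * w - RtoC r)) <= eps / 2)%R).
    { intros r Hr. destruct (L n m r Hr) as [_ l].
      assert (0 < INR N)%R by (apply lt_0_INR; lia). assert (INR N <= INR m)%R by (apply le_INR; lia).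
      assert (0 < d * (INR m + 1))%R by (apply Rmult_lt_0_compat; lra).
      rewrite Cmod_inv by (apply Cmod_gt_0; lra).
      apply Rle_trans with (/ (d * INR N))%R. apply Rinv_le_contravar. now apply Rmult_lt_0_compat. nra.
      rewrite Rinv_mult. apply Rmult_le_reg_l with d; auto. rewrite <- Rmult_assoc, Rinv_r, Rmult_1_l by lra. lra. }
    pose proof (pos_INR m).
    assert (Q1 := Q (INR m + / 2)%R ltac:(rewrite Rabs_pos_eq; lra)). assert (Q2 := Q (- (INR m + / 2))%R ltac:(rewrite Rabs_Ropp, Rabs_pos_eq; lra)).
    rewrite RtoC_opp, RtoC_plus, RtoC_inv in Q2 by lra. rewrite RtoC_plus, RtoC_inv in Q1 by lra.
    replace (nhalf n * w - - (RtoC (INR m) + / 2)) with (nhalf n * w + (RtoC (INR m) + / 2)) in Q2 by ring.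
    replace (lat_tan n m - 0) with (/ (nhalf n * w - (RtoC (INR m) + / 2)) + - / (nhalf n * w + (RtoC (INR m) + / 2))) by (unfold lat_tan; ring).
    eapply Rle_trans; [apply Cmod_triangle|]. rewrite Cmod_opp. lra. }
  rewrite Et. ring.
Qed.

Lemma nonint_half0 : nonint (0 + / 2).
Proof.
  exists (/ 2)%R. split. lra. intros n. rewrite Cplus_0_l, <- RtoC_inv, <- RtoC_plus, Cmod_R by lra.
  replace (/ 2 + IZR n)%R with (IZR (2 * n + 1) / 2)%R by (rewrite plus_IZR, mult_IZR; field).
  unfold Rdiv. rewrite Rabs_mult, (Rabs_pos_eq (/ 2)), <- abs_IZR by lra.
  assert (IZR 1 <= IZR (Z.abs (2 * n + 1)))%R by (apply IZR_le; lia). lra.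
Qed.

Let q := cexp (tpi * z).
Let alt (d : nat) : C := RtoC ((-1) ^ d * INR d).
Let bmu (m : nat) : R := if Nat.eqb m 0 then 0%R else 1%R.

(** Dividing by w turns (n+1/2) w - m into n + 1/2 + m z, so column m is a sum over half-integers,
    evaluated by [hsum_ecot] and expanded in powers of q. The column m = 0 occurs once, hence its
    separate value. *)
Lemma col_sq m : absc (fun n => lat_sq n m) /\ Csum (fun n => lat_sq n m) =
  match m with O => PI ^ 2 / w ^ 2 | S k => - (8 * PI ^ 2 / w ^ 2) * (RtoC (bmu m) * ev alt (q ^ m)) end.
Proof.
  pose proof w_neq0 as Hw0. destruct m as [|k].
  - pose proof (eta2_absc 0 nonint_half0) as A.
    assert (E : forall n, / w ^ 2 * eta2 n 0 = lat_sq n 0).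
    { intros n. unfold eta2, lat_sq.
      assert (Hn : nhalf n <> 0). { rewrite nhalf_R. intros E. apply RtoC_inj in E. pose proof (pos_INR n). lra. }
      replace (nhalf n - 0) with (nhalf n) by ring. rewrite Cplus_0_r. field. auto. }
    split. apply absc_ext with (1 := E). now apply absc_scal.
    rewrite <- (Csum_ext _ _ E), Csum_scal, Csum_eta2, hsum_ecot, ecot_half, Cmult_0_r, cexp_0 by (auto; apply nonint_half0).
    field. auto.
  - set (m := S k). set (x := RtoC (INR m) * z).
    assert (Hm : (0 < INR m)%R) by (apply lt_0_INR; unfold m; lia).
    assert (Hx : (0 < Im x)%R).
    { unfold x. rewrite im_scal_l. pose proof Im_z. now apply Rmult_lt_0_compat. }
    assert (Hn : nonint (x + / 2)) by (apply nonint_im; rewrite Im_plus_half; lra).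
    pose proof (eta2_absc x Hn) as A.
    assert (E : forall n, 2 / w ^ 2 * eta2 n x = lat_sq n m).
    { intros n. unfold eta2, lat_sq, m. fold m.
      pose proof (nonint_aw n) as Na.
      pose proof (nonint_neq0 _ (Z.of_nat m) Na) as N1. pose proof (nonint_neq0 _ (- Z.of_nat m) Na) as N2.
      rewrite opp_IZR, RtoC_opp in N2. rewrite <- INR_IZR_INZ in N1, N2.
      assert (Ex : x = - RtoC (INR m) / w) by (unfold x, z; field; auto).
      replace (nhalf n - x) with ((nhalf n * w + RtoC (INR m)) / w) by (rewrite Ex; field; auto).
      replace (nhalf n + x) with ((nhalf n * w + - RtoC (INR m)) / w) by (rewrite Ex; field; auto).
      replace (nhalf n * w - RtoC (INR m)) with (nhalf n * w + - RtoC (INR m)) by ring.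
      field. auto. }
    split. apply absc_ext with (1 := E). now apply absc_scal.
    rewrite <- (Csum_ext _ _ E), Csum_scal, Csum_eta2, hsum_ecot, ecot_half by auto.
    assert (Eq : cexp (tpi * x) = q ^ m).
    { unfold q. rewrite cexp_pow. f_equal. unfold x. ring. }
    rewrite Eq. unfold alt. rewrite ev_alt.
    2:{ rewrite <- Eq. now apply Cmod_cexp_tpi_lt1. }
    unfold bmu, m. cbn [Nat.eqb]. unfold Cdiv. ring.
Qed.

Lemma cols_sq : absc (fun m => Csum (fun n => lat_sq n m)) /\ Csum (fun m => Csum (fun n => lat_sq n m)) = PI ^ 2 / w ^ 2 - 8 * PI ^ 2 / w ^ 2 * ev cmu q.
Proof.
  destruct (ev_lambert bmu (fun d => ((-1) ^ d * INR d)%R) q) as [A E].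
  - reflexivity.
  - apply mu_weight_le.
  - apply mu_value_le.
  - apply Cmod_cexp_tpi_lt1, Im_z.
  - fold alt in A, E.
    assert (A1 : absc (fun k => Csum (fun n => lat_sq n (S k)))).
    { apply absc_ext with (a := fun k => - (8 * PI ^ 2 / w ^ 2) * (RtoC (bmu (S k)) * ev alt (q ^ S k))).
      intros k. now destruct (col_sq (S k)) as [_ ->].
      apply absc_scal. apply (absc_shift _ 1 A). }
    assert (A0 : absc (fun m => Csum (fun n => lat_sq n m))).
    { now apply absc_incr. }
    split; auto. rewrite (Csum_incr _ A0). destruct (col_sq 0) as [_ ->].
    change (ev cmu q) with (ev (fun n => RtoC (lambert bmu (fun d => ((-1) ^ d * INR d)%R) n)) q). rewrite <- E.
    rewrite (Csum_incr _ A). change (bmu 0) with 0%R. rewrite Cmult_0_l, Cplus_0_l.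
    rewrite (Csum_ext _ (fun k => - (8 * PI ^ 2 / w ^ 2) * (RtoC (bmu (S k)) * ev alt (q ^ S k)))).
    rewrite Csum_scal by (apply (absc_shift _ 1 A)). unfold Cminus, Cdiv. f_equal. unfold alt. ring.
    intros k. now destruct (col_sq (S k)) as [_ ->].
Qed.

Let V (m : nat) : C := - / w * Htan ((RtoC (INR m) + / 2) * z).

Lemma Im_rz m : (Im ((RtoC (INR m) + / 2) * z) = (INR m + / 2) * Im z)%R.
Proof. rewrite <- RtoC_inv, <- RtoC_plus by lra. apply im_scal_l. Qed.

Lemma col_tan m : absc (fun n => lat_tan n m) /\ Csum (fun n => lat_tan n m) = V m.
Proof.
  pose proof w_neq0 as Hw0. pose proof (pos_INR m). pose proof Im_z.
  set (x := (RtoC (INR m) + / 2) * z).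
  assert (Hx : (0 < Im x)%R) by (unfold x; rewrite Im_rz; apply Rmult_lt_0_compat; lra).
  destruct (eta_absc x ltac:(lra)) as [A _].
  assert (E : forall n, - / w * eta1 n x = lat_tan n m).
  { intros n. unfold eta1, lat_tan. set (r := RtoC (INR m) + / 2) in *.
    assert (Ex : x = - r / w) by (unfold x, z; field; auto).
    assert (Hr : r = RtoC (INR m + / 2)) by (unfold r; rewrite RtoC_plus, RtoC_inv by lra; reflexivity).
    assert (N : forall s : R, nhalf n * w + RtoC s <> 0).
    { intros s E. apply (f_equal Im) in E. rewrite nhalf_R in E.
      replace (Im (RtoC (INR n + / 2) * w + RtoC s)) with ((INR n + / 2) * Im w)%R in E by (destruct w; simpl; ring).
      simpl in E. pose proof (pos_INR n). assert (0 < (INR n + / 2) * Im w)%R by (apply Rmult_lt_0_compat; lra). lra. }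
    pose proof (N (INR m + / 2)%R) as N1. pose proof (N (- (INR m + / 2))%R) as N2. rewrite RtoC_opp in N2. rewrite <- Hr in N1, N2.
    replace (nhalf n - x) with ((nhalf n * w + r) / w) by (rewrite Ex; field; auto).
    replace (nhalf n + x) with ((nhalf n * w + - r) / w) by (rewrite Ex; field; auto).
    replace (nhalf n * w - r) with (nhalf n * w + - r) by ring.
    field. auto. }
  split. apply absc_ext with (1 := E). now apply absc_scal.
  rewrite <- (Csum_ext _ _ E), Csum_scal by auto. reflexivity.
Qed.

Lemma col_tel m : absc (fun n => lat_tel n m) /\ Csum (fun n => lat_tel n m) =
  match m with O => 2 * V 0 | S k => 2 * (V m - V k) end.
Proof.
  destruct m as [|k]; unfold lat_tel.
  - destruct (col_tan 0) as [A E]. split. now apply absc_scal. now rewrite Csum_scal, E.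
  - destruct (col_tan (S k)) as [A E]. destruct (col_tan k) as [A' E'].
    split. now apply absc_scal, absc_minus. rewrite Csum_scal by now apply absc_minus.
    now rewrite Csum_minus, E, E'.
Qed.

(** Summed over n first, the telescoping correction has the nonzero limit -pi i/w: this is where the
    two orders of summation of the conditionally convergent series differ. *)
Lemma V_lim eps : (0 < eps)%R -> exists N, forall m, (N <= m)%nat -> (Cmod (V m - - / w * (PI * Ci)) <= eps)%R.
Proof.
  intros He. pose proof w_neq0 as Hw0. pose proof Im_z as Hz. pose proof PI_RGT_0. pose proof PI2_1.
  pose proof (proj1 (Cmod_gt_0 w) Hw0) as Hcw.
  set (K := (4 * PI / Cmod w)%R). assert (HK : (0 < K)%R) by (apply Rdiv_lt_0_compat; lra).
  destruct (archimed (/ Im z)) as [U1 _]. destruct (archimed (K / (eps * Im z))) as [U2 _].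
  set (N1 := up (/ Im z)) in *. set (N2 := up (K / (eps * Im z))) in *.
  exists (Z.to_nat (Z.max N1 N2)). intros m Hm.
  assert (Hm1 : (IZR N1 <= INR m)%R) by (rewrite INR_IZR_INZ; apply IZR_le; lia).
  assert (Hm2 : (IZR N2 <= INR m)%R) by (rewrite INR_IZR_INZ; apply IZR_le; lia).
  set (x := (RtoC (INR m) + / 2) * z).
  assert (Hx : (INR m * Im z <= Im x)%R) by (unfold x; rewrite Im_rz; lra).
  assert (Hx1 : (1 <= Im x)%R).
  { eapply Rle_trans; [|exact Hx]. apply Rle_trans with (/ Im z * Im z)%R. right; field; lra. apply Rmult_le_compat_r; lra. }
  assert (Hx2 : (K <= eps * Im x)%R).
  { apply Rle_trans with (K / (eps * Im z) * (eps * Im z))%R. right; field; lra.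
    apply Rle_trans with (INR m * (eps * Im z))%R. apply Rmult_le_compat_r; nra. nra. }
  unfold V. fold x. replace (- / w * Htan x - - / w * (PI * Ci)) with (- / w * (Htan x - PI * Ci)) by ring.
  rewrite Cmod_mult, Cmod_opp, Cmod_inv by auto.
  pose proof (Htan_lim x Hx1) as L.
  apply Rle_trans with (K * exp (- (2 * PI * Im x)))%R.
  { unfold K. replace (4 * PI / Cmod w * exp (- (2 * PI * Im x)))%R with (/ Cmod w * (4 * PI * exp (- (2 * PI * Im x))))%R by (field; lra).
    apply Rmult_le_compat_l; auto. left; now apply Rinv_0_lt_compat. }
  rewrite exp_Ropp. pose proof (exp_ineq1_le (2 * PI * Im x)) as Hexp.
  assert (Im x <= exp (2 * PI * Im x))%R by nra.
  apply Rmult_le_reg_r with (exp (2 * PI * Im x)). apply exp_pos.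
  rewrite Rmult_assoc, Rinv_l, Rmult_1_r by (pose proof (exp_pos (2 * PI * Im x)); lra). nra.
Qed.

(** The rows give the left side, where the correction contributes 0. By columns the correction
    contributes 2(-pi i/w), which enters with a minus sign and becomes the last term. *)
Lemma lattice_sum : Csum (fun n => 2 * hsum (nhalf n * w)) =
  PI ^ 2 / w ^ 2 - 8 * PI ^ 2 / w ^ 2 * ev cmu q + 2 * PI * Ci / w.
Proof.
  pose proof w_neq0 as Hw0. destruct lat_bound as (c & Hc & B).
  assert (Hu : ex_series (fun n => c * inv2 n)%R) by (apply ex_series_scal_R, ex_series_inv2).
  assert (Hu0 : forall n, (0 <= c * inv2 n)%R) by (intros n; pose proof (inv2_pos n); nra).
  assert (Hv0 : forall n, (0 <= inv2 n)%R) by (intros n; pose proof (inv2_pos n); lra).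
  pose proof (fubini _ _ _ Hu ex_series_inv2 Hu0 Hv0 B) as F.
  pose proof (fubini_cols _ _ _ Hu ex_series_inv2 B) as FC.
  rewrite (Csum_ext _ _ row_lat) in F. rewrite F.
  destruct cols_sq as [A0 E0].
  assert (Ec : forall m, Csum (fun n => lat n m) = Csum (fun n => lat_sq n m) - Csum (fun n => lat_tel n m)).
  { intros m. unfold lat. apply Csum_minus. apply col_sq. apply col_tel. }
  assert (At : absc (fun m => Csum (fun n => lat_tel n m))).
  { apply absc_ext with (a := fun m => Csum (fun n => lat_sq n m) - Csum (fun n => lat n m)).
    intros m; rewrite Ec; ring. now apply absc_minus. }
  rewrite (Csum_ext _ _ Ec), Csum_minus, E0 by auto.
  assert (Et : Csum (fun m => Csum (fun n => lat_tel n m)) = 2 * (- / w * (PI * Ci))).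
  { rewrite (Csum_ext _ _ (fun m => proj2 (col_tel m))). apply (Csum_telescope V).
    apply absc_ext with (1 := fun m => proj2 (col_tel m)). exact At.
    apply V_lim. }
  rewrite Et. field. auto.
Qed.

Lemma lattice_rows_absc : absc (fun n => 2 * hsum (nhalf n * w)).
Proof.
  destruct lat_bound as (c & Hc & B). apply absc_ext with (1 := row_lat).
  apply (fubini_rows _ (fun n => c * inv2 n)%R inv2); auto.
  apply ex_series_scal_R, ex_series_inv2. apply ex_series_inv2.
Qed.
End Lattice.

(** With p = e^{pi i w}, the exponential attached to (n+1/2) w is p^(2n+1), so exactly the odd
    multipliers of the Lambert series occur. *)
Lemma lattice_rows w : (0 < Im w)%R ->
  Csum (fun n => 2 * hsum (nhalf n * w)) = - (8 * PI ^ 2) * ev cmu_odd (cexp (PI * Ci * w)).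
Proof.
  intros Hw. set (p := cexp (PI * Ci * w)).
  assert (Hp2 : p ^ 2 = cexp (tpi * w)).
  { unfold p. rewrite cexp_pow. f_equal. unfold tpi. simpl INR. replace (RtoC (1 + 1)) with (RtoC 2) by reflexivity. ring. }
  assert (Hp : (Cmod p < 1)%R).
  { pose proof (Cmod_cexp_tpi_lt1 w Hw) as H. rewrite <- Hp2, Cmod_pow in H. pose proof (Cmod_ge_0 p).
    destruct (Rlt_le_dec (Cmod p) 1); auto. assert (1 <= Cmod p ^ 2)%R by (rewrite <- (pow1 2); apply pow_incr; lra). lra. }
  set (bm := fun m => if Nat.odd m then 1%R else 0%R).
  destruct (ev_lambert bm INR p) as [A E]; auto. apply mu_odd_weight_le. apply mu_odd_value_le.
  set (I := fun d => RtoC (INR d)) in *.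
  change (ev cmu_odd p) with (ev (fun n => RtoC (lambert bm INR n)) p). rewrite <- E.
  assert (Ev0 : forall k, RtoC (bm (2 * k)%nat) * ev I (p ^ (2 * k)) = 0).
  { intros k. unfold bm. rewrite Nat.odd_mul. simpl. ring. }
  assert (Ev1 : forall k, 2 * hsum (nhalf k * w) = - (8 * PI ^ 2) * (RtoC (bm (2 * k + 1)%nat) * ev I (p ^ (2 * k + 1)))).
  { intros k. unfold bm. rewrite Nat.add_1_r, Nat.odd_succ, Nat.even_mul. cbn [Nat.even orb].
    rewrite hsum_ecot by now apply nonint_aw. unfold ecot.
    assert (Eq : cexp (tpi * (nhalf k * w)) = p ^ S (2 * k)).
    { unfold p. rewrite cexp_pow. f_equal. rewrite S_INR, mult_INR, RtoC_plus, RtoC_mult. simpl INR. unfold nhalf, tpi.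
      replace (RtoC (1 + 1)) with (RtoC 2) by reflexivity. field. }
    rewrite Eq. replace (ev I (p ^ S (2 * k))) with (ev (Dq (fun _ => 1)) (p ^ S (2 * k))).
    2:{ apply ev_ext. intros n. unfold Dq, I. ring. }
    rewrite ev_Dgeom. ring. rewrite Cmod_pow. apply pow_lt_1_compat. split; auto. apply Cmod_ge_0. lia. }
  assert (A1 : absc (fun k => RtoC (bm (2 * k + 1)%nat) * ev I (p ^ (2 * k + 1)))).
  { apply absc_ext with (a := fun k => / - (8 * PI ^ 2) * (2 * hsum (nhalf k * w))).
    - intros k. rewrite Ev1. field. intros E0. apply RtoC_inj in E0. pose proof PI_RGT_0. lra.
    - apply absc_scal. now apply lattice_rows_absc. }
  rewrite (Csum_even_odd _ A); auto.
  - rewrite (Csum_ext (fun n => RtoC (bm (2 * n)%nat) * ev I (p ^ (2 * n))) (fun _ => 0)) by auto.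
    rewrite Csum_0, Cplus_0_l, <- Csum_scal by auto. now apply Csum_ext.
  - apply absc_ext with (a := fun _ => 0). intros; now rewrite Ev0.
    apply (Csum_finite (fun _ => 0) 0). auto.
Qed.

Lemma lattice_identity w : (0 < Im w)%R ->
  (1 - 8 * ev cmu (cexp (tpi * - / w))) / w ^ 2 = - 8 * ev cmu_odd (cexp (PI * Ci * w)) - 2 * Ci / (PI * w).
Proof.
  intros Hw. pose proof (lattice_rows w Hw) as E. rewrite lattice_sum in E by auto.
  pose proof (w_neq0 w Hw) as H0.
  assert (HP : RtoC PI <> 0) by (intros E0; apply RtoC_inj in E0; pose proof PI_RGT_0; lra).
  set (M := ev cmu _) in *. set (Mt := ev cmu_odd _) in *.
  replace (- 8 * Mt) with (/ PI ^ 2 * (- (8 * PI ^ 2) * Mt)) by (field; auto).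
  rewrite <- E. field. auto.
Qed.

(** * Signs of the coefficients *)

Lemma pow_m1_even n : Nat.even n = true -> ((-1) ^ n = 1)%R.
Proof. intros H. apply Nat.even_spec in H. destruct H as [k ->]. apply pow_1_even. Qed.

Lemma pow_m1_odd n : Nat.odd n = true -> ((-1) ^ n = -1)%R.
Proof. intros H. apply Nat.odd_spec in H. destruct H as [k ->]. rewrite Nat.add_1_r. apply pow_1_odd. Qed.

Lemma mu_0 : mu 0 = 0%R.
Proof. unfold mu, lambert. simpl. ring. Qed.

Lemma mu_1 : mu 1 = (-1)%R.
Proof. unfold mu, lambert. simpl. ring. Qed.

Lemma sum_even_part (f : nat -> R) k :
  sum_f_R0 (fun m => if Nat.even m then f (Nat.div2 m) else 0%R) (2 * k) = sum_f_R0 f k.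
Proof.
  induction k. reflexivity.
  replace (2 * S k)%nat with (S (S (2 * k))) by lia. cbn [sum_f_R0]. rewrite IHk.
  replace (Nat.even (S (2 * k))) with false by (symmetry; rewrite Nat.even_succ, Nat.odd_mul; reflexivity).
  replace (Nat.even (S (S (2 * k)))) with true by (symmetry; cbn [Nat.even]; rewrite Nat.even_mul; reflexivity).
  replace (Nat.div2 (S (S (2 * k)))) with (S k) by (cbn [Nat.div2]; now rewrite Nat.div2_double). ring.
Qed.

Lemma sum_le_extend (f : nat -> R) k j : (forall m, 0 <= f m)%R -> (sum_f_R0 f k <= sum_f_R0 f (k + j))%R.
Proof.
  intros H. induction j. rewrite Nat.add_0_r; lra. rewrite Nat.add_succ_r. cbn [sum_f_R0]. specialize (H (S (k + j))). lra.
Qed.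

(* For n = 2k, a divisor m of n with n/m odd is m = 2m' with m' | k; its term -k/m' is absorbed by the term +2k/m' of m'. *)
Lemma mu_sign n : (0 <= (-1) ^ n * mu n)%R.
Proof.
  destruct (Nat.even n) eqn:En.
  - rewrite (pow_m1_even n En), Rmult_1_l. apply Nat.even_spec in En. destruct En as [k ->].
    set (d := fun m => if Nat.eqb m 0 then 0%R else if Nat.eqb (k mod m) 0 then INR (k / m) else 0%R).
    assert (Hd : forall m, (0 <= d m)%R).
    { intros m. unfold d. destruct (Nat.eqb m 0); [lra|]. destruct (Nat.eqb _ 0); [apply pos_INR|lra]. }
    apply Rle_trans with (sum_f_R0 (fun m => 2 * d m - (if Nat.even m then d (Nat.div2 m) else 0))%R (2 * k)).
    + rewrite minus_sum, sum_even_part.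
      rewrite (sum_eq (fun m => 2 * d m)%R (fun m => d m * 2)%R), <- scal_sum by (intros; ring).
      pose proof (sum_le_extend d k k Hd). replace (k + k)%nat with (2 * k)%nat in H by lia.
      assert (0 <= sum_f_R0 d k)%R by (apply cond_pos_sum; auto).
      lra.
    + unfold mu, lambert. apply sum_Rle. intros m Hm. unfold d at 1.
      destruct (Nat.eqb_spec m 0) as [->|Hm0].
      { simpl. destruct (Nat.eqb _ 0); unfold d; simpl; lra. }
      destruct (Nat.eqb_spec (k mod m) 0) as [Ek|Ek].
      * assert (E2 : k = (m * (k / m))%nat) by (apply Nat.Div0.div_exact; auto).
        assert (E3 : (2 * k = 2 * (k / m) * m)%nat) by nia.
        replace ((2 * k) mod m) with 0%nat by (rewrite E3; symmetry; apply Nat.Div0.mod_mul).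
        replace (2 * k / m)%nat with (2 * (k / m))%nat by (rewrite E3 at 1; now rewrite Nat.div_mul).
        cbn [Nat.eqb].
        rewrite pow_m1_even by (rewrite Nat.even_mul; reflexivity). rewrite mult_INR. simpl (INR 2).
        destruct (Nat.even m). specialize (Hd (Nat.div2 m)). lra. lra.
      * destruct (Nat.eqb_spec ((2 * k) mod m) 0) as [E2|E2].
        2:{ destruct (Nat.even m). specialize (Hd (Nat.div2 m)). lra. lra. }
        assert (E3 : (2 * k = m * (2 * k / m))%nat) by (apply Nat.Div0.div_exact; auto).
        set (t := (2 * k / m)%nat) in *.
        assert (Ht : Nat.odd t = true).
        { destruct (Nat.odd t) eqn:Eo; auto. exfalso. rewrite <- Nat.negb_even in Eo. apply Bool.negb_false_iff, Nat.even_spec in Eo.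
          destruct Eo as [s Hs]. apply Ek. replace k with (s * m)%nat by nia. apply Nat.Div0.mod_mul. }
        assert (Hme : Nat.even m = true).
        { assert (He : Nat.even (m * t) = true) by (rewrite <- E3, Nat.even_mul; reflexivity).
          rewrite Nat.even_mul in He. rewrite <- Nat.negb_even in Ht. apply Bool.negb_true_iff in Ht. rewrite Ht, Bool.orb_false_r in He. auto. }
        rewrite Hme, pow_m1_odd by auto. apply Nat.even_spec in Hme. destruct Hme as [m' ->].
        rewrite Nat.div2_double. unfold d. destruct (Nat.eqb_spec m' 0) as [->|Hm']. lia.
        assert (Hk : k = (t * m')%nat) by nia. rewrite Hk, Nat.Div0.mod_mul, Nat.eqb_refl, Nat.div_mul by auto. lra.
  - assert (Ho : Nat.odd n = true) by (rewrite <- Nat.negb_even, En; reflexivity).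
    rewrite (pow_m1_odd n Ho). unfold mu, lambert. rewrite scal_sum. apply cond_pos_sum. intros m.
    destruct (Nat.eqb_spec (n mod m) 0) as [E|E]; [|lra].
    destruct (Nat.eqb_spec m 0); [lra|].
    rewrite pow_m1_odd. pose proof (pos_INR (n / m)). lra.
    assert (E3 : (n = m * (n / m))%nat) by (apply Nat.Div0.div_exact; auto).
    rewrite E3 in Ho. rewrite Nat.odd_mul in Ho. now apply andb_prop in Ho.
Qed.

(** * Sequences with alternating signs, stable under Cauchy products *)

Definition altpos (x : C) (n : nat) : Prop := exists y, (0 <= y)%R /\ x = RtoC ((-1) ^ n * y).
Definition altgt (x : C) (n : nat) : Prop := exists y, (0 < y)%R /\ x = RtoC ((-1) ^ n * y).

Lemma altgt_pos x n : altgt x n -> altpos x n.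
Proof. intros (y & Hy & E). exists y. split; auto; lra. Qed.

Lemma altpos_0 n : altpos 0 n.
Proof. exists 0%R. split. lra. now rewrite Rmult_0_r. Qed.

Lemma altpos_plus x y n : altpos x n -> altpos y n -> altpos (x + y) n.
Proof.
  intros (a & Ha & ->) (b & Hb & ->). exists (a + b)%R. split. lra. rewrite <- RtoC_plus. f_equal. ring.
Qed.

Lemma altgt_plus x y n : altpos x n -> altgt y n -> altgt (x + y) n.
Proof.
  intros (a & Ha & ->) (b & Hb & ->). exists (a + b)%R. split. lra. rewrite <- RtoC_plus. f_equal. ring.
Qed.

Lemma altpos_scal c x n : (0 <= c)%R -> altpos x n -> altpos (RtoC c * x) n.
Proof.
  intros Hc (a & Ha & ->). exists (c * a)%R. split. now apply Rmult_le_pos. rewrite <- RtoC_mult. f_equal. ring.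
Qed.

Lemma altgt_scal c x n : (0 < c)%R -> altgt x n -> altgt (RtoC c * x) n.
Proof.
  intros Hc (a & Ha & ->). exists (c * a)%R. split. now apply Rmult_lt_0_compat. rewrite <- RtoC_mult. f_equal. ring.
Qed.

Lemma altpos_mult x y n m : altpos x n -> altpos y m -> altpos (x * y) (n + m).
Proof.
  intros (a & Ha & ->) (b & Hb & ->). exists (a * b)%R. split. now apply Rmult_le_pos.
  rewrite <- RtoC_mult, pow_add. f_equal. ring.
Qed.

Lemma altgt_mult x y n m : altgt x n -> altgt y m -> altgt (x * y) (n + m).
Proof.
  intros (a & Ha & ->) (b & Hb & ->). exists (a * b)%R. split. now apply Rmult_lt_0_compat.
  rewrite <- RtoC_mult, pow_add. f_equal. ring.
Qed.

Lemma altgt_neq0 x n : altgt x n -> x <> 0.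
Proof.
  intros (a & Ha & ->) E. apply RtoC_inj in E. apply Rmult_integral in E.
  destruct E as [E|E]. revert E. apply pow_nonzero. lra. lra.
Qed.

Lemma altpos_csum (t : nat -> C) N n : (forall i, (i < N)%nat -> altpos (t i) n) -> altpos (csum t N) n.
Proof.
  induction N; intros H; simpl. apply altpos_0. apply altpos_plus. apply IHN; intros; apply H; lia. apply H; lia.
Qed.

Lemma altgt_csum (t : nat -> C) N n j : (j < N)%nat -> (forall i, (i < N)%nat -> altpos (t i) n) -> altgt (t j) n -> altgt (csum t N) n.
Proof.
  induction N; intros Hj H Hg; simpl. lia.
  destruct (Nat.eq_dec j N) as [->|Hn].
  - apply altgt_plus; auto. apply altpos_csum. intros; apply H; lia.
  - rewrite Cplus_comm. apply altgt_plus. apply H; lia. apply IHN; auto. lia.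
Qed.

Lemma altpos_conv a b n : (forall n, altpos (a n) n) -> (forall n, altpos (b n) n) -> altpos (conv a b n) n.
Proof.
  intros Ha Hb. apply altpos_csum. intros i Hi. replace n with (i + (n - i))%nat at 2 by lia. now apply altpos_mult.
Qed.

(** Strictness passes from index n to n+1 through the single term with b_1; the other terms carry
    the same sign or vanish. *)
Lemma altgt_sol b n : (forall n, altpos (b n) n) -> altgt (b 1%nat) 1 -> altgt (sol b n) n.
Proof.
  intros Hb H1. induction n as [n IH] using (well_founded_induction lt_wf). destruct n.
  - exists 1%R. split. lra. rewrite sol_0. simpl. f_equal. ring.
  - assert (E : sol b (S n) = RtoC (/ INR (S n)) * csum (fun i => sol b i * b (S n - i)%nat) (S n)).
    { rewrite <- sol_rec, RtoC_inv by (apply not_0_INR; lia). field. apply RtoC_INR_neq0. }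
    rewrite E. apply altgt_scal. apply Rinv_0_lt_compat, lt_0_INR; lia.
    apply altgt_csum with n; auto.
    + intros i Hi. replace (S n) with (i + (S n - i))%nat at 2 by lia. apply altpos_mult; auto. apply altgt_pos, IH; lia.
    + replace (S n - n)%nat with 1%nat by lia. replace (S n) with (n + 1)%nat by lia. apply altgt_mult; auto.
Qed.

Lemma altpos_mu n : altpos (cmu n) n.
Proof.
  exists ((-1) ^ n * mu n)%R. split. apply mu_sign. unfold cmu. f_equal.
  rewrite <- Rmult_assoc, <- pow_add. replace (n + n)%nat with (2 * n)%nat by lia. rewrite pow_1_even. ring.
Qed.

Lemma altgt_mu1 : altgt (cmu 1) 1.
Proof. exists 1%R. split. lra. unfold cmu. rewrite mu_1. f_equal. ring. Qed.

(** The expansion of L^2 - 4 D L for L = 1 - 8 M. *)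
Definition cB (n : nat) : C :=
  (if Nat.eqb n 0 then 1 else 0) + (- 16 * cmu n + (32 * Dq cmu n + 64 * conv cmu cmu n)).

Lemma cB_0 : cB 0 = 1.
Proof. unfold cB, Dq, conv, cmu. simpl. rewrite mu_0. ring. Qed.

Lemma cB_1 : altgt (cB 1) 1.
Proof.
  exists 16%R. split. lra.
  unfold cB, Dq, conv, cmu. cbn [Nat.eqb INR csum Nat.sub]. rewrite mu_0, mu_1.
  rewrite RtoC_m1.
  replace (RtoC ((-1) ^ 1 * 16)) with (RtoC (-16)) by (f_equal; ring). ring.
Qed.

(** For n >= 1 the term -16 mu_n, of the wrong sign, is outweighed by 32 n mu_n. *)
Lemma altpos_B n : altpos (cB n) n.
Proof.
  destruct n.
  - rewrite cB_0. exists 1%R. split. lra. f_equal. ring.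
  - replace (cB (S n)) with (RtoC (32 * INR (S n) - 16) * cmu (S n) + RtoC 64 * conv cmu cmu (S n)).
    + apply altpos_plus; apply altpos_scal. rewrite S_INR. pose proof (pos_INR n); lra. apply altpos_mu. lra.
      apply altpos_conv; apply altpos_mu.
    + unfold cB, Dq. cbn [Nat.eqb]. rewrite RtoC_minus, RtoC_mult. ring.
Qed.

(** * Behaviour under w -> -1/w *)

Definition qz (z : C) : C := cexp (tpi * z).
(** The local parameter at the cusp 0 in the coordinate w = -1/z; this cusp has width 2, hence pi i
    instead of 2 pi i. *)
Definition pw (w : C) : C := cexp (PI * Ci * w).
Definition inv_neg (w : C) : C := - / w.

Lemma PI_neq0 : RtoC PI <> 0.
Proof. intros E. apply RtoC_inj in E. pose proof PI_RGT_0; lra. Qed.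

Lemma tpi_neq0 : tpi <> 0.
Proof. unfold tpi. repeat apply Cmult_neq_0; try apply Ci_nz; try apply PI_neq0. intros E; apply RtoC_inj in E; lra. Qed.

Lemma H_neq0 w : (0 < Im w)%R -> w <> 0.
Proof. intros H E. rewrite E in H. simpl in H. lra. Qed.

Lemma Im_inv_neg w : (0 < Im w)%R -> (0 < Im (inv_neg w))%R.
Proof. exact (Im_z w). Qed.

Lemma qz_lt1 z : (0 < Im z)%R -> (Cmod (qz z) < 1)%R.
Proof. apply Cmod_cexp_tpi_lt1. Qed.

Lemma Cmod_pw w : Cmod (pw w) = exp (- (PI * Im w)).
Proof.
  unfold pw. rewrite Cmod_cexp. f_equal. destruct w. unfold Cmult, Ci, RtoC; simpl. ring.
Qed.

Lemma pw_lt1 w : (0 < Im w)%R -> (Cmod (pw w) < 1)%R.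
Proof.
  intros H. rewrite Cmod_pw, <- exp_0. apply exp_increasing. pose proof PI_RGT_0.
  assert (0 < PI * Im w)%R by (apply Rmult_lt_0_compat; lra). lra.
Qed.

Lemma pw_small eps : (0 < eps)%R -> exists Y, (0 < Y)%R /\ forall w, (Y < Im w)%R -> (Cmod (pw w) <= eps)%R.
Proof.
  intros He. exists (/ eps)%R. split. now apply Rinv_0_lt_compat. intros w Hw.
  assert (0 < / eps)%R by now apply Rinv_0_lt_compat.
  rewrite Cmod_pw, exp_Ropp. pose proof PI2_1. pose proof (exp_ineq1_le (PI * Im w)).
  rewrite <- (Rinv_inv eps). apply Rinv_le_contravar; auto. nra.
Qed.

Lemma pw_period w : pw (w + 2) = pw w.
Proof.
  unfold pw. replace (PI * Ci * (w + 2)) with (PI * Ci * w + tpi) by (unfold tpi; ring).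
  rewrite cexp_add, cexp_tpi. ring.
Qed.

Lemma qz_shift z : qz (z - 1) = qz z.
Proof.
  unfold qz. replace (tpi * z) with (tpi * (z - 1) + tpi) by ring.
  rewrite cexp_add, cexp_tpi. ring.
Qed.

Lemma cder_evq a z : disc a -> (0 < Im z)%R -> cder (fun x => ev a (qz x)) z (tpi * ev (Dq a) (qz z)).
Proof. intros Ha Hz. apply cder_ev_exp; auto. now apply qz_lt1. Qed.

Lemma cder_evp a w : disc a -> (0 < Im w)%R -> cder (fun x => ev a (pw x)) w (PI * Ci * ev (Dq a) (pw w)).
Proof. intros Ha Hz. apply cder_ev_exp; auto. now apply pw_lt1. Qed.

Lemma cder_inv_neg w : (0 < Im w)%R -> cder inv_neg w (/ w ^ 2).
Proof.
  intros H. unfold inv_neg. apply cder_ext with (f := fun x => - (1) * / x). intros; ring.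
  eapply cder_val; [|apply cder_scal, cder_inv, H_neq0, H]. field. now apply H_neq0.
Qed.

Lemma cder_comp_inv_neg f w l : (0 < Im w)%R -> cder f (inv_neg w) l -> cder (fun x => f (inv_neg x)) w (l / w ^ 2).
Proof.
  intros H Hf. eapply cder_val; [|apply (cder_comp f inv_neg); [now apply cder_inv_neg|exact Hf]].
  unfold Cdiv; ring.
Qed.

Lemma cder_ext_H (f g : C -> C) w l : (0 < Im w)%R -> (forall x, (0 < Im x)%R -> f x = g x) -> cder f w l -> cder g w l.
Proof.
  intros H E. apply cder_ext_loc with (Im w / 2)%R. lra. intros k Hk. apply E.
  replace (Im (w + k)) with (Im w + Im k)%R by reflexivity.
  pose proof (im_le_Cmod k). pose proof (Rle_abs (- Im k)). rewrite Rabs_Ropp in H1. lra.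
Qed.

Lemma H_convex a b t : (0 < Im a)%R -> (0 < Im b)%R -> (0 <= t <= 1)%R -> (0 < Im (a + RtoC t * (b - a)))%R.
Proof.
  intros Ha Hb Ht. replace (Im (a + RtoC t * (b - a))) with ((1 - t) * Im a + t * Im b)%R by (destruct a, b; simpl; ring).
  destruct (Req_dec t 0) as [->|Ht0]. lra. assert (0 <= (1 - t) * Im a)%R by nra. nra.
Qed.

Lemma cder_0_H f a b : (forall w, (0 < Im w)%R -> cder f w 0) -> (0 < Im a)%R -> (0 < Im b)%R -> f a = f b.
Proof.
  intros H Ha Hb. symmetry. apply cder_0_const. intros t Ht. apply H. now apply H_convex.
Qed.

(** Stands in for logarithms: solutions of u' = g u and v' = -g v have a constant product, so a
    solution is determined up to a factor once an inverse solution is known. *)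
Lemma ode_product f1 f2 g a b :
  (forall w, (0 < Im w)%R -> cder f1 w (g w * f1 w)) -> (forall w, (0 < Im w)%R -> cder f2 w (- g w * f2 w)) ->
  (0 < Im a)%R -> (0 < Im b)%R -> f1 a * f2 a = f1 b * f2 b.
Proof.
  intros H1 H2 Ha Hb. apply (cder_0_H (fun w => f1 w * f2 w)); auto. intros w Hw.
  eapply cder_val; [|apply cder_mult; [apply H1|apply H2]; auto]. ring.
Qed.

Definition Lz (z : C) : C := 1 - 8 * ev cmu (qz z).
Definition Lt (w : C) : C := - 8 * ev cmu_odd (pw w).
(** The 4 is the weight of C, of which L is the logarithmic derivative. *)
Definition kappa : C := 4 / tpi.

Lemma Lz_inv w : (0 < Im w)%R -> Lz (inv_neg w) = w ^ 2 * Lt w + kappa * w.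
Proof.
  intros Hw. pose proof (H_neq0 w Hw) as H0. pose proof (lattice_identity w Hw) as E.
  unfold Lz, Lt, qz, pw, inv_neg. pose proof PI_neq0. pose proof Ci_nz.
  set (A := ev cmu _) in *. set (B := ev cmu_odd _) in *.
  replace (1 - 8 * A) with (w ^ 2 * ((1 - 8 * A) / w ^ 2)) by (field; auto). rewrite E.
  assert (K : kappa = - (2 * Ci / PI)).
  { unfold kappa, tpi. replace (4 / (2 * PI * Ci)) with (2 * - (- (1)) / (PI * Ci)) by (field; auto).
    rewrite <- Ci2. field; auto. }
  rewrite K. field. auto.
Qed.

(** The expansion of B at the cusp 0, that is [Lt]^2 - 4 D [Lt]. In the parameter p the derivation D
    is half of p d/dp, which makes 16 out of 32. *)
Definition cBt (n : nat) : C := 16 * Dq cmu_odd n + 64 * conv cmu_odd cmu_odd n.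

Lemma disc_delta : disc (fun n => if Nat.eqb n 0 then 1 else 0).
Proof. apply disc_bounded with 1%R. intros [|n]; simpl; rewrite ?Cmod_1, ?Cmod_0; lra. Qed.

Lemma ev_delta q : ev (fun n => if Nat.eqb n 0 then 1 else 0) q = 1.
Proof.
  unfold ev. destruct (Csum_finite (fun n => (if Nat.eqb n 0 then 1 else 0) * q ^ n) 1) as [_ ->].
  intros [|k] Hk; [lia|]. simpl. ring. simpl. ring.
Qed.

Lemma disc_B : disc cB.
Proof.
  pose proof disc_mu as G. apply disc_plus. apply disc_delta. apply disc_plus. now apply disc_scal.
  apply disc_plus; apply disc_scal. now apply disc_Dq. now apply disc_conv.
Qed.

Lemma disc_Bt : disc cBt.
Proof.
  pose proof disc_mu_odd as G. apply disc_plus; apply disc_scal. now apply disc_Dq. now apply disc_conv.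
Qed.

Lemma cBt_0 : cBt 0 = 0.
Proof. unfold cBt, Dq, conv, cmu_odd, mu_odd, lambert. simpl. rewrite Rmult_0_l. ring. Qed.

Lemma ev_B z : (0 < Im z)%R -> ev cB (qz z) = Lz z ^ 2 + 32 * ev (Dq cmu) (qz z).
Proof.
  intros Hz. pose proof (qz_lt1 z Hz) as Hq. pose proof disc_mu as G. pose proof (disc_Dq _ G) as GD. pose proof (disc_conv _ _ G G) as GC.
  unfold cB. rewrite ev_plus, ev_delta, ev_plus, ev_plus, !ev_scal, ev_conv; auto using disc_delta.
  - unfold Lz. ring.
  - now apply disc_scal.
  - now apply disc_scal.
  - now apply disc_scal.
  - apply disc_plus; now apply disc_scal.
  - apply disc_plus. now apply disc_scal. apply disc_plus; now apply disc_scal.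
Qed.

Lemma ev_Bt w : (0 < Im w)%R -> ev cBt (pw w) = Lt w ^ 2 + 16 * ev (Dq cmu_odd) (pw w).
Proof.
  intros Hz. pose proof (pw_lt1 w Hz) as Hq. pose proof disc_mu_odd as G. pose proof (disc_Dq _ G) as GD. pose proof (disc_conv _ _ G G) as GC.
  unfold cBt. rewrite ev_plus, !ev_scal, ev_conv; auto.
  - unfold Lt. ring.
  - now apply disc_scal.
  - now apply disc_scal.
Qed.

(** The derivative of [Lz_inv], computed on both sides. *)
Lemma DL_inv w : (0 < Im w)%R ->
  tpi * (- 8 * ev (Dq cmu) (qz (inv_neg w))) / w ^ 2 = 2 * w * Lt w + w ^ 2 * (PI * Ci * (- 8 * ev (Dq cmu_odd) (pw w))) + kappa.
Proof.
  intros Hw. apply (cder_unique (fun x => Lz (inv_neg x)) w).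
  - apply cder_comp_inv_neg; auto. unfold Lz.
    eapply cder_val; [|apply cder_minus; [apply (cder_const 1)|apply cder_scal, cder_evq; [apply disc_mu|now apply Im_inv_neg]]]. ring.
  - apply cder_ext_H with (f := fun x => x ^ 2 * Lt x + kappa * x); auto.
    intros x Hx. symmetry. now apply Lz_inv.
    eapply cder_val; [|apply cder_plus; [apply cder_mult; [apply (cder_pow (fun x => x) 2 w 1), cder_id|apply cder_scal, cder_evp; [apply disc_mu_odd|auto]]|apply cder_scal, cder_id]].
    unfold Lt. simpl INR. simpl pred. replace (RtoC (1 + 1)) with (RtoC 2) by reflexivity. ring.
Qed.

(** L^2 contributes the extra terms 2 kappa w^3 [Lt] + kappa^2 w^2, and 4 D L contributes the same
    ones because kappa = 4/(2 pi i). *)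
Lemma B_inv w : (0 < Im w)%R -> ev cB (qz (inv_neg w)) = w ^ 4 * ev cBt (pw w).
Proof.
  intros Hw. rewrite ev_B by now apply Im_inv_neg. rewrite ev_Bt, Lz_inv by auto.
  pose proof (DL_inv w Hw) as E. pose proof (H_neq0 w Hw) as H0. pose proof tpi_neq0 as T0.
  set (X := ev (Dq cmu) _) in *. set (Y := ev (Dq cmu_odd) _) in *.
  assert (EX : 32 * X = - (4 / tpi) * w ^ 2 * (tpi * (- 8 * X) / w ^ 2)) by (field; auto).
  rewrite EX, E. unfold kappa.
  assert (Et : PI * Ci = tpi / 2) by (unfold tpi; field).
  rewrite Et. field. auto.
Qed.

(** The term 4 w^3, due to the weight 4 of B, is the defect that kappa w B from B L compensates in
    [residue_4m]. *)
Lemma DB_inv w : (0 < Im w)%R ->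
  tpi * ev (Dq cB) (qz (inv_neg w)) / w ^ 2 = 4 * w ^ 3 * ev cBt (pw w) + w ^ 4 * (PI * Ci * ev (Dq cBt) (pw w)).
Proof.
  intros Hw. apply (cder_unique (fun x => ev cB (qz (inv_neg x))) w).
  - apply (cder_comp_inv_neg (fun x => ev cB (qz x))); auto. apply cder_evq. apply disc_B. now apply Im_inv_neg.
  - apply cder_ext_H with (f := fun x => x ^ 4 * ev cBt (pw x)); auto.
    intros x Hx. symmetry. now apply B_inv.
    eapply cder_val; [|apply cder_mult; [apply (cder_pow (fun x => x) 4 w 1), cder_id|apply cder_evp; [apply disc_Bt|auto]]].
    simpl INR. simpl pred. replace (RtoC (1 + 1 + 1 + 1)) with (RtoC 4) by (f_equal; ring). ring.
Qed.

(** The polar factor q^{-r}, kept apart so that all other factors are power series in q. *)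
Definition qir (r : nat) (z : C) : C := cexp (- (RtoC (INR r) * tpi) * z).

Lemma qir_q r z : qir r z * qz z ^ r = 1.
Proof. unfold qir, qz. rewrite cexp_pow, <- cexp_add, <- cexp_0. f_equal. ring. Qed.

Lemma qir_shift r z : qir r (z - 1) = qir r z.
Proof.
  pose proof (qir_q r z) as H1. pose proof (qir_q r (z - 1)) as H2. rewrite qz_shift in H2.
  transitivity (qir r (z - 1) * (qir r z * qz z ^ r)). rewrite H1. ring.
  transitivity (qir r z * (qir r (z - 1) * qz z ^ r)). ring. rewrite H2. ring.
Qed.

Lemma cder_qir r z : cder (qir r) z (- (RtoC (INR r) * tpi) * qir r z).
Proof. apply cder_cexp_scal. Qed.

(** The coefficients of q^r C^{-r}: after removing q^{-r}, the equation D Y = -r L Y becomes D X = 8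
    r M X. *)
Definition cX (r : nat) : nat -> C := sol (fun n => RtoC (8 * INR r) * cmu n).
Definition Yz (r : nat) (z : C) : C := ev (cX r) (qz z) * qir r z.

Lemma disc_bX r : disc (fun n => RtoC (8 * INR r) * cmu n).
Proof. apply disc_scal, disc_mu. Qed.

Lemma disc_X r : disc (cX r).
Proof. apply disc_sol, disc_bX. Qed.

Lemma ev_DX r q : (Cmod q < 1)%R -> ev (Dq (cX r)) q = RtoC (8 * INR r) * ev cmu q * ev (cX r) q.
Proof.
  intros Hq. rewrite (ev_ext _ (conv (cX r) (fun n => RtoC (8 * INR r) * cmu n))).
  rewrite ev_conv, ev_scal; auto using disc_X, disc_bX, disc_mu. ring.
  intros n. apply (Dq_sol (fun n => RtoC (8 * INR r) * cmu n)). unfold cmu. rewrite mu_0. ring.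
Qed.

Lemma cder_Y r z : (0 < Im z)%R -> cder (Yz r) z (- (tpi * RtoC (INR r)) * Lz z * Yz r z).
Proof.
  intros Hz. unfold Yz. eapply cder_val; [|apply cder_mult; [apply cder_evq; auto using disc_X|apply cder_qir]].
  rewrite ev_DX by now apply qz_lt1. unfold Lz. rewrite RtoC_mult. ring.
Qed.

(** With s = 16 r this is C^{-r} at the cusp 0 up to a constant: -r [Lt] is 8 r times the series of
    [cmu_odd], and p d/dp = 2 D doubles it. The opposite s gives the inverse series. *)
Definition cXt (s : R) : nat -> C := sol (fun n => RtoC s * cmu_odd n).

Lemma disc_bXt s : disc (fun n => RtoC s * cmu_odd n).
Proof. apply disc_scal, disc_mu_odd. Qed.

Lemma disc_Xt s : disc (cXt s).
Proof. apply disc_sol, disc_bXt. Qed.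

Lemma cder_Xt s w : (0 < Im w)%R -> cder (fun x => ev (cXt s) (pw x)) w (PI * Ci * RtoC s * ev cmu_odd (pw w) * ev (cXt s) (pw w)).
Proof.
  intros Hw. eapply cder_val; [|apply cder_evp; auto using disc_Xt].
  rewrite (ev_ext _ (conv (cXt s) (fun n => RtoC s * cmu_odd n))).
  rewrite ev_conv, ev_scal; auto using disc_Xt, disc_bXt, disc_mu_odd, pw_lt1. ring.
  intros n. apply (Dq_sol (fun n => RtoC s * cmu_odd n)). unfold cmu_odd, mu_odd, lambert. simpl. rewrite Rmult_0_l. ring.
Qed.

(** The product is constant by [ode_product]; as p tends to 0 it approaches the product of the
    constant terms, which is 1. *)
Lemma Xt_inverse s w : (0 < Im w)%R -> ev (cXt s) (pw w) * ev (cXt (- s)) (pw w) = 1.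
Proof.
  intros Hw. set (c := ev (cXt s) (pw w) * ev (cXt (- s)) (pw w)).
  assert (E : forall v, (0 < Im v)%R -> ev (conv (cXt s) (cXt (- s))) (pw v) = c).
  { intros v Hv. rewrite ev_conv by auto using disc_Xt, pw_lt1. unfold c.
    apply (ode_product (fun x => ev (cXt s) (pw x)) (fun x => ev (cXt (- s)) (pw x)) (fun x => PI * Ci * RtoC s * ev cmu_odd (pw x))); auto.
    intros x Hx. now apply cder_Xt. intros x Hx. eapply cder_val; [|now apply cder_Xt]. rewrite RtoC_opp. ring. }
  destruct (ev_near0 (conv (cXt s) (cXt (- s))) ltac:(apply disc_conv; apply disc_Xt)) as (K & HK & H).
  assert (E0 : conv (cXt s) (cXt (- s)) 0%nat = 1) by (unfold conv; simpl; unfold cXt; rewrite !sol_0; ring).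
  apply Ceq_eps. intros eps He.
  destruct (pw_small (Rmin (1 / 2) (eps / (K + 1)))) as (Y & HY & HP).
  { apply Rmin_pos. lra. apply Rdiv_lt_0_compat; lra. }
  set (v := (0, Y + 1)%R : C). specialize (HP v ltac:(unfold v; simpl; lra)).
  pose proof (Rmin_l (1 / 2) (eps / (K + 1))). pose proof (Rmin_r (1 / 2) (eps / (K + 1))).
  specialize (H (pw v) ltac:(lra)). rewrite E, E0 in H by (unfold v; simpl; lra).
  eapply Rle_trans; [exact H|]. pose proof (Cmod_ge_0 (pw v)). apply Rmult_le_of_div; lra.
Qed.

(* Y_r = C^{-r} for the weight 4 form C = eta(2z)^16/eta(z)^8, which does not vanish at the cusp 0. *)
Lemma Y_inv r : exists k, forall w, (0 < Im w)%R -> w ^ (4 * r) * Yz r (inv_neg w) = k * ev (cXt (16 * INR r)) (pw w).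
Proof.
  set (u := fun w => w ^ (4 * r) * Yz r (inv_neg w)).
  set (g := fun w => PI * Ci * RtoC (16 * INR r) * ev cmu_odd (pw w)).
  assert (Du : forall w, (0 < Im w)%R -> cder u w (g w * u w)).
  { intros w Hw. pose proof (H_neq0 w Hw) as H0. pose proof tpi_neq0 as T0. unfold u.
    eapply cder_val; [|apply cder_mult; [apply (cder_pow (fun x => x) (4 * r) w 1), cder_id|apply cder_comp_inv_neg; [auto|apply cder_Y; now apply Im_inv_neg]]].
    rewrite Lz_inv by auto. unfold g, kappa, Lt.
    (* Differentiating w^(4r) produces 4r/w, which cancels the contribution of kappa w in L; what is
       left is the equation solved by [cXt]. *)
    assert (Ep : RtoC (INR (4 * r)) * 1 * w ^ pred (4 * r) = 4 * RtoC (INR r) / w * w ^ (4 * r)).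
    { rewrite mult_INR, RtoC_mult. replace (RtoC (INR 4)) with (RtoC 4) by (f_equal; simpl; ring).
      destruct r. simpl INR. unfold Cdiv. ring. replace (pred (4 * S r)) with (4 * r + 3)%nat by lia. replace (4 * S r)%nat with (S (4 * r + 3)) by lia.
      rewrite Cpow_S. field. auto. }
    rewrite Ep, RtoC_mult. set (W := w ^ (4 * r)). set (y := Yz r (inv_neg w)). set (M := ev cmu_odd (pw w)).
    assert (Et : PI * Ci = tpi / 2) by (unfold tpi; field). rewrite Et. field. auto. }
  assert (Hi : (0 < Im Ci)%R) by (simpl; lra).
  exists (u Ci * ev (cXt (- (16 * INR r))) (pw Ci)). intros w Hw. change (w ^ (4 * r) * Yz r (inv_neg w)) with (u w).
  rewrite <- (ode_product u (fun x => ev (cXt (- (16 * INR r))) (pw x)) g w Ci Du); auto.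
  - transitivity (u w * (ev (cXt (16 * INR r)) (pw w) * ev (cXt (- (16 * INR r))) (pw w))).
    rewrite Xt_inverse by auto. ring. ring.
  - intros x Hx. eapply cder_val; [|now apply cder_Xt]. unfold g. rewrite RtoC_opp. ring.
Qed.

(** * The residue theorem on Gamma_0(2) *)

(** The partial sums of a convergent series eventually stay near the limit, so its terms are
    bounded; every radius 0 < rho < 1 occurs as |q|. *)
Lemma fourier_disc f A : fourier_expansion f A -> disc A.
Proof.
  intros H.
  assert (P : forall rho, (0 < rho < 1)%R -> exists M, forall n, (Cmod (A n) * rho ^ n <= M)%R).
  { intros rho Hr. pose proof PI_RGT_0.
    assert (Hl : (ln rho < 0)%R) by (rewrite <- ln_1; apply ln_increasing; lra).
    (* The point of the imaginary axis where |q| = rho. *)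
    set (z := (0, - ln rho / (2 * PI))%R : C).
    assert (Hz : in_H z). { unfold in_H, z; simpl. apply Rdiv_lt_0_compat; lra. }
    assert (Hq : Cmod (qpar z) = rho).
    { unfold qpar. change (2 * PI * Ci) with tpi. rewrite Cmod_cexp_tpi. unfold z; cbn [Im snd].
      replace (- (2 * PI * (- ln rho / (2 * PI))))%R with (ln rho) by (field; lra). apply exp_ln; lra. }
    specialize (H z Hz). unfold is_series in H.
    set (a := fun n => A n * qpar z ^ n) in *.
    assert (Hs : (0 < sqrt 2)%R) by (apply sqrt_lt_R0; lra).
    destruct (proj1 (filterlim_locally (F := eventually) (sum_n a) (f z)) H (mkposreal 1 ltac:(lra))) as [N HN].
    assert (L : forall n, (N <= n)%nat -> (Cmod (sum_n a n - f z) <= 2)%R).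
    { intros n Hn. specialize (HN n Hn). apply C_NormedModule_mixin_compat2 in HN. cbn [pos] in HN.
      change (Cmod (sum_n a n - f z) < sqrt 2 * 1)%R in HN.
      assert (sqrt 2 < 2)%R by (rewrite <- (sqrt_Rsqr 2) at 2 by lra; apply sqrt_lt_1; unfold Rsqr; lra). lra. }
    destruct (finite_max (fun n => Cmod (A n) * rho ^ n)%R (S N)) as (M & HM & Hmax).
    exists (M + 4)%R. intros n. destruct (Nat.le_gt_cases n (S N)) as [h|h].
    - specialize (Hmax n h). lra.
    - destruct n as [|n]; [lia|].
      assert (E : a (S n) = (sum_n a (S n) - f z) - (sum_n a n - f z)).
      { rewrite sum_Sn. change (plus (sum_n a n) (a (S n))) with (sum_n a n + a (S n)). ring. }
      rewrite <- Hq, <- Cmod_pow, <- Cmod_mult. fold (a (S n)). rewrite E. unfold Cminus at 1.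
      eapply Rle_trans; [apply Cmod_triangle|]. rewrite Cmod_opp.
      pose proof (L (S n) ltac:(lia)). pose proof (L n ltac:(lia)). lra. }
  (* Enlarging the radius covers rho = 0, which is not the modulus of any q. *)
  intros rho Hr. destruct (P (Rmax rho (1 / 2))) as [M HM].
  - split. pose proof (Rmax_r rho (1 / 2)); lra. apply Rmax_lub_lt; lra.
  - exists M. intros n. eapply Rle_trans; [|apply (HM n)]. apply Rmult_le_compat_l. apply Cmod_ge_0.
    apply pow_incr. split. lra. apply Rmax_l.
Qed.

Lemma fourier_ev f A z : fourier_expansion f A -> (0 < Im z)%R -> f z = ev A (qz z).
Proof.
  intros H Hz. symmetry. apply is_series_Csum; [|exact (H z Hz)].
  apply ev_absc. now apply fourier_disc with f. now apply qz_lt1.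
Qed.

Section Residue.
Variables (h r : nat) (f : C -> C) (A tau sigma : nat -> C).
Hypothesis Hmod : is_modform_Gamma0_2 h f.
Hypothesis HA : fourier_expansion f A.
Hypothesis Htau : disc tau.
Hypothesis Hsig : disc sigma.
Hypothesis Hsig0 : sigma 0%nat = 0.
Hypothesis Hinv : forall w, (0 < Im w)%R ->
  w ^ h * (ev tau (qz (inv_neg w)) * qir r (inv_neg w)) = w ^ 2 * ev sigma (pw w).

(** Here T = q^{-r} times the series of [tau], and [Hinv] is its transformation of weight 2 - h,
    free of negative exponents. So [gam] are the coefficients of q^r f T, and [gam r] is the
    constant term of f T. *)
Let gam := conv A tau.
Let g (z : C) : C := ev gam (qz z) * qir r z.
(** Termwise integration of q^(n-r). The exponent 0 is left out here and supplies the linear term of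
    [G], which is what breaks its periodicity. *)
Let prim (n : nat) : C := if Nat.eqb n r then 0 else gam n / (tpi * (RtoC (INR n) - RtoC (INR r))).
Let G (z : C) : C := gam r * z + ev prim (qz z) * qir r z.

Lemma disc_gam : disc gam.
Proof. apply disc_conv; auto. now apply fourier_disc with f. Qed.

Lemma INR_diff_neq0 n : n <> r -> RtoC (INR n) - RtoC (INR r) <> 0.
Proof. intros Hn E. apply Hn, INR_eq. apply Ceq_minus in E. now apply RtoC_inj in E. Qed.

Lemma disc_prim : disc prim.
Proof.
  apply disc_le with (2 := disc_gam). intros n. unfold prim.
  destruct (Nat.eqb_spec n r) as [E|E]. rewrite Cmod_0; apply Cmod_ge_0.
  pose proof (INR_diff_neq0 n E) as Hd.
  rewrite Cmod_div by (apply Cmult_neq_0; auto; apply tpi_neq0).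
  assert (H1 : (1 <= Cmod (RtoC (INR n) - RtoC (INR r)))%R).
  { rewrite <- RtoC_minus, Cmod_R. rewrite !INR_IZR_INZ, <- minus_IZR, <- abs_IZR. apply IZR_le. lia. }
  assert (H2 : (1 <= Cmod tpi)%R).
  { unfold tpi. rewrite !Cmod_mult, !Cmod_R, Cmod_Ci, !Rabs_pos_eq by (pose proof PI_RGT_0; lra). pose proof PI2_1; lra. }
  rewrite Cmod_mult. pose proof (Cmod_ge_0 (gam n)).
  assert (1 <= Cmod tpi * Cmod (RtoC (INR n) - RtoC (INR r)))%R by nra.
  apply Rmult_le_reg_r with (Cmod tpi * Cmod (RtoC (INR n) - RtoC (INR r)))%R. lra.
  unfold Rdiv. rewrite Rmult_assoc, Rinv_l, Rmult_1_r by lra. rewrite <- (Rmult_1_r (Cmod (gam n))) at 1.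
  apply Rmult_le_compat_l; auto.
Qed.

Lemma ev_monomial c q : disc (fun n => if Nat.eqb n r then c else 0) /\ ev (fun n => if Nat.eqb n r then c else 0) q = c * q ^ r.
Proof.
  split.
  - apply disc_bounded with (Cmod c). intros n. destruct (Nat.eqb n r). lra. rewrite Cmod_0. apply Cmod_ge_0.
  - unfold ev. destruct (Csum_finite (fun n => (if Nat.eqb n r then c else 0) * q ^ n) (S r)) as [_ ->].
    + intros k Hk. destruct (Nat.eqb_spec k r); [lia|ring].
    + cbn [csum]. rewrite Nat.eqb_refl, csum_0. ring. intros k Hk. destruct (Nat.eqb_spec k r); [lia|ring].
Qed.

Lemma cder_G z : (0 < Im z)%R -> cder G z (g z).
Proof.
  intros Hz. pose proof disc_prim as GP. pose proof (disc_Dq _ GP) as GD. pose proof (qz_lt1 z Hz) as Hq.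
  destruct (ev_monomial (gam r) (qz z)) as [Gm Em].
  unfold G. eapply cder_val; [|apply cder_plus; [apply cder_scal, cder_id|apply cder_mult; [now apply cder_evq|apply cder_qir]]].
  unfold g.
  rewrite (ev_ext gam (fun n => (tpi * Dq prim n + (- (RtoC (INR r) * tpi)) * prim n) + (if Nat.eqb n r then gam r else 0))).
  - rewrite ev_plus, ev_plus, !ev_scal, Em; auto.
    + transitivity (gam r * (qir r z * qz z ^ r) + (tpi * ev (Dq prim) (qz z) * qir r z + ev prim (qz z) * (- (RtoC (INR r) * tpi) * qir r z))).
      rewrite qir_q. ring. ring.
    + now apply disc_scal.
    + now apply disc_scal.
    + apply disc_plus; now apply disc_scal.
  - intros n. unfold prim, Dq. destruct (Nat.eqb_spec n r) as [->|E]. ring.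
    field. split. now apply INR_diff_neq0. apply tpi_neq0.
Qed.

Lemma g_eq z : (0 < Im z)%R -> g z = f z * (ev tau (qz z) * qir r z).
Proof.
  intros Hz. unfold g, gam. rewrite ev_conv; auto. rewrite (fourier_ev f A z HA Hz). ring.
  now apply fourier_disc with f. now apply qz_lt1.
Qed.

Lemma g_inv w : (0 < Im w)%R -> g (inv_neg w) / w ^ 2 = f (inv_neg w) / w ^ h * ev sigma (pw w).
Proof.
  intros Hw. pose proof (H_neq0 w Hw) as H0. rewrite g_eq by now apply Im_inv_neg.
  set (T := ev tau _ * _). assert (ET : T = w ^ 2 * ev sigma (pw w) / w ^ h).
  { rewrite <- Hinv by auto. fold T. field. now apply Cpow_nz. }
  rewrite ET. field. split; auto. now apply Cpow_nz.
Qed.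

(** The matrix (1, 0; -2, 1) fixes the cusp 0 and becomes w -> w + 2 in the coordinate w = -1/z. *)
Lemma f_period w : (0 < Im w)%R -> f (inv_neg (w + 2)) / (w + 2) ^ h = f (inv_neg w) / w ^ h.
Proof.
  intros Hw. pose proof (H_neq0 w Hw) as H0.
  assert (Hw2 : (0 < Im (w + 2))%R) by (destruct w; simpl in *; lra).
  pose proof (H_neq0 _ Hw2) as H02.
  destruct Hmod as (_ & Hm & _).
  specialize (Hm 1%Z 0%Z (-2)%Z 1%Z (inv_neg w)).
  assert (E1 : mobius 1 0 (-2) 1 (inv_neg w) = inv_neg (w + 2)).
  { unfold mobius, inv_neg. replace (RtoC (IZR (-2))) with (- (2)) by (rewrite <- RtoC_opp; reflexivity). field. auto. }
  assert (E2 : jfac (-2) 1 h (inv_neg w) = (w + 2) ^ h / w ^ h).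
  { unfold jfac, inv_neg. replace (RtoC (IZR (-2))) with (- (2)) by (rewrite <- RtoC_opp; reflexivity).
    replace (- (2) * - / w + 1) with ((w + 2) * / w) by (field; auto).
    rewrite Cpow_mult_l, Cpow_inv by auto. reflexivity. }
  rewrite E1, E2 in Hm. rewrite Hm.
  - field. split; now apply Cpow_nz.
  - split. reflexivity. now exists (-1)%Z.
  - now apply Im_inv_neg.
Qed.

Lemma f_bounded : exists M Y, (0 < M)%R /\ (0 < Y)%R /\ forall w, (Y < Im w)%R -> (Cmod (f (inv_neg w) / w ^ h) <= M)%R.
Proof.
  destruct Hmod as (_ & _ & Hc). destruct (Hc 0%Z (-1)%Z 1%Z 0%Z eq_refl) as (M & Y & H).
  exists (Rmax M 1), (Rmax Y 1). split. pose proof (Rmax_r M 1); lra. split. pose proof (Rmax_r Y 1); lra.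
  intros w Hw. pose proof (Rmax_l Y 1). pose proof (Rmax_r Y 1).
  eapply Rle_trans; [|apply (Rmax_l M 1)]. specialize (H w ltac:(lra)).
  pose proof (H_neq0 w ltac:(lra)) as H0'.
  replace (mobius 0 (-1) 1 0 w) with (inv_neg w) in H.
  replace (jfac 1 0 h w) with (w ^ h) in H. exact H.
  unfold jfac. f_equal. ring.
  unfold mobius, inv_neg. rewrite RtoC_m1. field. auto.
Qed.

Let W (w : C) : C := G (inv_neg (w + 2)) - G (inv_neg w).

Lemma cder_Ginv w : (0 < Im w)%R -> cder (fun x => G (inv_neg x)) w (g (inv_neg w) / w ^ 2).
Proof. intros Hw. apply cder_comp_inv_neg; auto. apply cder_G. now apply Im_inv_neg. Qed.

Lemma W_const a b : (0 < Im a)%R -> (0 < Im b)%R -> W a = W b.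
Proof.
  intros Ha Hb. apply cder_0_H; auto. intros w Hw.
  assert (Hw2 : (0 < Im (w + 2))%R) by (destruct w; simpl in *; lra).
  unfold W. eapply cder_val; [|apply cder_minus; [apply (cder_comp (fun x => G (inv_neg x)) (fun x => x + 2)); [apply cder_plus; [apply cder_id|apply (cder_const 2)]|now apply cder_Ginv]|now apply cder_Ginv]].
  cbv beta. rewrite (g_inv w Hw), (g_inv _ Hw2), f_period, pw_period by auto. ring.
Qed.

(** W is the integral of f T dz over the image of a horizontal segment of length 2. High in the half
    plane f stays bounded at the cusp 0 while the series of [sigma] is O(p). *)
Lemma W_0 w : (0 < Im w)%R -> W w = 0.
Proof.
  intros Hw. destruct f_bounded as (M & Y & HM & HY & Hf). destruct (ev_near0 sigma Hsig) as (K & HK & Hs).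
  apply Ceq_eps. intros eps He.
  (* The length 2 of the segment and the factor 2 of [cder_MVT] turn the bound M K d of the
     derivative into 4 M K d. *)
  set (d := Rmin (1 / 2) (eps / (4 * M * (K + 1)))).
  assert (Hd : (0 < d)%R).
  { apply Rmin_pos. lra. apply Rdiv_lt_0_compat; auto. apply Rmult_lt_0_compat; lra. }
  destruct (pw_small d Hd) as (Y' & HY' & Hp).
  set (v := (0, Rmax Y Y' + 1)%R : C).
  pose proof (Rmax_l Y Y'). pose proof (Rmax_r Y Y').
  rewrite (W_const w v) by (auto; unfold v; simpl; lra).
  replace (W v - 0) with (W v) by ring. unfold W.
  eapply Rle_trans; [apply (cder_MVT (fun x => G (inv_neg x)) (fun t => g (inv_neg (v + RtoC t * (v + 2 - v))) / (v + RtoC t * (v + 2 - v)) ^ 2) v (v + 2) (M * (K * d))%R)|].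
  - intros t Ht. set (x := v + RtoC t * (v + 2 - v)).
    assert (Hx : Im x = (Rmax Y Y' + 1)%R) by (unfold x, v; simpl; ring).
    split. apply cder_Ginv; lra. rewrite g_inv, Cmod_mult by lra.
    apply Rmult_le_compat; auto using Cmod_ge_0. apply Hf; lra.
    specialize (Hp x ltac:(lra)). pose proof (Rmin_l (1 / 2) (eps / (4 * M * (K + 1)))). fold d in H1.
    specialize (Hs (pw x) ltac:(lra)). rewrite Hsig0 in Hs. replace (ev sigma (pw x) - 0) with (ev sigma (pw x)) in Hs by ring.
    eapply Rle_trans; [exact Hs|]. apply Rmult_le_compat_l; auto.
  - replace (v + 2 - v) with (RtoC 2) by ring. rewrite Cmod_R, Rabs_pos_eq by lra.
    pose proof (Rmin_r (1 / 2) (eps / (4 * M * (K + 1)))). fold d in H1.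
    apply Rle_trans with (4 * M * (K + 1) * (eps / (4 * M * (K + 1))))%R. 2: right; field; split; lra.
    apply Rle_trans with (4 * M * (K + 1) * d)%R. nra. apply Rmult_le_compat_l; auto. nra.
Qed.

(* Evaluate W at -1+i, whose two images under w -> -1/(w+2), -1/w differ by 1. *)
Lemma residue_0 : gam r = 0.
Proof.
  set (w0 := (-1, 1)%R : C).
  pose proof (W_0 w0 ltac:(unfold w0; simpl; lra)) as E. unfold W in E.
  assert (E1 : inv_neg (w0 + 2) = inv_neg w0 - 1).
  { unfold inv_neg, w0, Cminus, Copp, Cplus, Cinv, RtoC; simpl. apply injective_projections; simpl; field. }
  rewrite E1 in E. unfold G in E. rewrite qz_shift, qir_shift in E.
  set (z0 := inv_neg w0) in *. set (P := ev prim (qz z0)) in *.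
  replace (gam r) with (- (gam r * (z0 - 1) + P * qir r z0 - (gam r * z0 + P * qir r z0))) by ring.
  rewrite E. ring.
Qed.
End Residue.

(** * The two choices of T, and the conclusion *)

Lemma conv_leading (A t : nat -> C) r : (forall n, (1 <= n <= r)%nat -> A n = 0) -> conv A t r = A 0%nat * t r.
Proof.
  intros H. unfold conv. rewrite csum_incr, Nat.sub_0_r, csum_0. ring.
  intros k Hk. rewrite H by lia. ring.
Qed.

Lemma altgt_X r n : (0 < r)%nat -> altgt (cX r n) n.
Proof.
  intros Hr. assert (0 < INR r)%R by (now apply lt_0_INR). apply altgt_sol.
  - intros k. apply altpos_scal. lra. apply altpos_mu.
  - apply altgt_scal. lra. apply altgt_mu1.
Qed.

(** Weight count: C^{-r} has weight -4m - 4 and B has weight 4, which gives -4m = 2 - h. *)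
Lemma residue_4m_plus_2 m f A : is_modform_Gamma0_2 (4 * m + 2) f -> fourier_expansion f A ->
  conv A (conv (cX (m + 1)) cB) (m + 1) = 0.
Proof.
  intros Hm HA. set (r := (m + 1)%nat). destruct (Y_inv r) as [k Hk].
  apply (residue_0 (4 * m + 2) r f A (conv (cX r) cB) (fun n => k * conv cBt (cXt (16 * INR r)) n)); auto.
  - apply disc_conv. apply disc_X. apply disc_B.
  - apply disc_scal, disc_conv. apply disc_Bt. apply disc_Xt.
  - unfold conv. simpl. rewrite cBt_0. ring.
  - intros w Hw. pose proof (H_neq0 w Hw) as H0. pose proof (qz_lt1 _ (Im_inv_neg w Hw)) as Hq. pose proof (pw_lt1 w Hw) as Hp.
    rewrite ev_conv, ev_scal, ev_conv; auto using disc_X, disc_B, disc_Bt, disc_Xt.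
    2: apply disc_conv; auto using disc_Bt, disc_Xt.
    specialize (Hk w Hw). unfold Yz in Hk.
    rewrite B_inv by auto.
    set (X := ev (cX r) _) in *. set (Bt := ev cBt _). set (Q := qir r _) in *. set (Xt := ev (cXt _) _) in *.
    replace (w ^ 2 * (k * (Bt * Xt))) with (w ^ 2 * Bt * (k * Xt)) by ring. rewrite <- Hk.
    replace (4 * r)%nat with (4 * m + 2 + 2)%nat by (unfold r; lia). rewrite (Cpow_add_r w (4 * m + 2) 2). ring.
Qed.

(** L C^{-r} is entered as -(1/r) D(q^{-r} X) = q^{-r}(X - D X/r), in terms of X alone, so that the
    integration by parts can later be done on coefficients. *)
Lemma residue_4m m f A : is_modform_Gamma0_2 (4 * m) f -> fourier_expansion f A ->
  let r := (m + 1)%nat in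
  conv A (fun n => conv (fun n => cX r n + RtoC (- / INR r) * Dq (cX r) n) cB n + RtoC (-1) * conv (cX r) (Dq cB) n) r = 0.
Proof.
  intros Hm HA r. destruct (Y_inv r) as [k Hk].
  assert (Hr : RtoC (INR r) <> 0) by (unfold r; rewrite Nat.add_1_r; apply RtoC_INR_neq0).
  pose proof (disc_X r) as GX. pose proof (disc_Dq _ GX) as GDX. pose proof disc_B as GB. pose proof (disc_Dq _ GB) as GDB.
  pose proof disc_Bt as GBt. pose proof (disc_Dq _ GBt) as GDBt. pose proof (disc_Xt (16 * INR r)) as GXt.
  pose proof disc_mu_odd as Gm.
  assert (GXL : disc (fun n => cX r n + RtoC (- / INR r) * Dq (cX r) n)) by (apply disc_plus; auto; now apply disc_scal).
  (* B L - D B at the cusp 0: B [Lt] - (1/2) p dB/dp, with [Lt] equal to -8 times the series of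
     [cmu_odd]. *)
  set (sg := fun n => - 8 * conv cBt cmu_odd n + RtoC (- / 2) * Dq cBt n).
  assert (Gsg : disc sg) by (apply disc_plus; apply disc_scal; auto; now apply disc_conv).
  apply (residue_0 (4 * m) r f A _ (fun n => k * conv sg (cXt (16 * INR r)) n)); auto.
  - apply disc_plus. now apply disc_conv. apply disc_scal; now apply disc_conv.
  - apply disc_scal, disc_conv; auto.
  - unfold conv, sg, conv, Dq. simpl. rewrite cBt_0. ring.
  - intros w Hw. pose proof (H_neq0 w Hw) as H0. pose proof (qz_lt1 _ (Im_inv_neg w Hw)) as Hq. pose proof (pw_lt1 w Hw) as Hp.
    rewrite ev_plus, ev_scal, !ev_conv, ev_plus, ev_scal, ev_DX, ev_scal, ev_conv; auto using disc_conv.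
    2: now apply disc_scal. 2: apply disc_scal; now apply disc_conv.
    unfold sg. rewrite ev_plus, !ev_scal, ev_conv; auto using disc_conv.
    2: apply disc_scal; now apply disc_conv. 2: now apply disc_scal.
    specialize (Hk w Hw). unfold Yz in Hk.
    pose proof (DB_inv w Hw) as EB. pose proof (Lz_inv w Hw) as EL. rewrite (B_inv w Hw) in *.
    unfold Lz in EL. unfold Lt in EL.
    set (X := ev (cX r) _) in *. set (Bt := ev cBt _) in *. set (Q := qir r _) in *. set (Xt := ev (cXt _) _) in *.
    set (M := ev cmu _) in *. set (Mt := ev cmu_odd _) in *. set (DB := ev (Dq cB) _) in *. set (DBt := ev (Dq cBt) _) in *.
    pose proof tpi_neq0 as T0.
    assert (EB' : DB = w ^ 2 / tpi * (4 * w ^ 3 * Bt + w ^ 4 * (PI * Ci * DBt))) by (rewrite <- EB; field; auto).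
    assert (Et : PI * Ci = tpi / 2) by (unfold tpi; field). rewrite Et in EB'.
    transitivity (w ^ (4 * m) * (X * Q) * ((1 - 8 * M) * (w ^ 4 * Bt) - DB)).
    { rewrite RtoC_opp, RtoC_inv, RtoC_mult by (intros E; apply Hr; now rewrite E).
      rewrite RtoC_m1. field. auto. }
    rewrite EL, EB'.
    transitivity (w ^ 2 * (- 8 * (Bt * Mt) + - / 2 * DBt) * (k * Xt)).
    2:{ rewrite RtoC_opp, RtoC_inv by lra. ring. }
    rewrite <- Hk. replace (4 * r)%nat with (4 * m + 4)%nat by (unfold r; lia). rewrite (Cpow_add_r w (4 * m) 4).
    unfold kappa. field. auto.
Qed.

Theorem theorem2p1 (h : nat) (f : C -> C) (A : nat -> C) :
  (0 < h)%nat -> Nat.Even h ->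
  is_modform_Gamma0_2 h f ->
  fourier_expansion f A ->
  A 0%nat <> 0 ->
  exists n : nat, (1 <= n <= r2 h)%nat /\ A n <> 0.
Proof.
  intros Hh He Hm HA H0. apply NNPP. intros Hno.
  assert (Hz : forall n, (1 <= n <= r2 h)%nat -> A n = 0).
  { intros n Hn. apply NNPP. intros E. apply Hno. now exists n. }
  destruct He as [j Hj]. destruct (Nat.Even_or_Odd j) as [[m Em]|[m Em]].
  - replace h with (4 * m)%nat in * by lia.
    assert (Er : r2 (4 * m) = (m + 1)%nat) by (unfold r2; rewrite Nat.mul_comm, Nat.div_mul; lia). rewrite Er in Hz.
    pose proof (residue_4m m f A Hm HA) as R. cbv zeta in R. rewrite conv_leading in R by auto.
    set (r := (m + 1)%nat) in *. set (X := cX r) in *.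
    (* h > 0 gives m >= 1, hence r >= 2; for r = 1 the factor 1/r - 1 would vanish, in accordance
       with the constant forms of weight 0. *)
    assert (Hr : (1 < INR r)%R) by (unfold r; rewrite plus_INR; simpl; assert (0 < INR m)%R by (apply lt_0_INR; lia); lra).
    (* D B has no constant term, so strictness comes from its coefficient of index 1, paired with
       X_m. *)
    assert (Hneq : conv X (Dq cB) r <> 0).
    { apply altgt_neq0 with r. apply altgt_csum with m. unfold r; lia.
      - intros i Hi. replace r with (i + (r - i))%nat at 2 by lia. apply altpos_mult. apply altgt_pos, altgt_X; unfold r; lia.
        apply altpos_scal. apply pos_INR. apply altpos_B.
      - replace (r - m)%nat with 1%nat by (unfold r; lia). change (altgt (X m * Dq cB 1%nat) (m + 1)). apply altgt_mult. apply altgt_X; unfold r; lia.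
        apply altgt_scal. simpl; lra. apply cB_1. }
    (* Integration by parts on coefficients: (1 - i/r) X_i B_{r-i} = (1/r) X_i (r-i) B_{r-i}. *)
    assert (Ec : conv (fun n => X n + RtoC (- / INR r) * Dq X n) cB r = RtoC (/ INR r) * conv X (Dq cB) r).
    { unfold conv. rewrite <- csum_scal. apply csum_ext. intros i Hi. unfold Dq.
      rewrite minus_INR, RtoC_minus, RtoC_opp, RtoC_inv by (try lia; lra). field. intros E; apply RtoC_inj in E; lra. }
    rewrite Ec in R.
    replace (RtoC (/ INR r) * conv X (Dq cB) r + RtoC (-1) * conv X (Dq cB) r) with (RtoC (/ INR r - 1) * conv X (Dq cB) r) in R.
    2:{ rewrite RtoC_minus. rewrite RtoC_m1. ring. }
    revert R. repeat apply Cmult_neq_0; auto. intros E. apply RtoC_inj in E.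
    assert (/ INR r < 1)%R by (rewrite <- Rinv_1; apply Rinv_lt_contravar; lra). lra.
  - replace h with (4 * m + 2)%nat in * by lia.
    assert (Er : r2 (4 * m + 2) = (m + 1)%nat).
    { unfold r2. replace (4 * m + 2)%nat with (2 + m * 4)%nat by lia. rewrite Nat.div_add by lia. simpl. lia. }
    rewrite Er in Hz. pose proof (residue_4m_plus_2 m f A Hm HA) as R. rewrite conv_leading in R by auto.
    revert R. apply Cmult_neq_0; auto. apply altgt_neq0 with (m + 1)%nat.
    (* The strict term is the last one, X_r B_0 with B_0 = 1. *)
    apply altgt_csum with (m + 1)%nat. lia.
    + intros i Hi. replace (m + 1)%nat with (i + (m + 1 - i))%nat at 3 by lia. apply altpos_mult. apply altgt_pos, altgt_X; lia. apply altpos_B.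
    + rewrite Nat.sub_diag, cB_0, Cmult_1_r. apply altgt_X. lia.
Qed.
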